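(* Let $\mathcal{G}$ and $\mathcal{G}'$ be locally definable groups, let $U$ be a definably connected definable neighborhood of the identity $e$ of $\mathcal{G}$, and let $f:U\subseteq\mathcal{G}\to\mathcal{G}'$ be a definable local homomorphism. Assume that there is a definable neighborhood $V$ of $e$ which is generic in $\mathcal{G}$ and satisfies $V^{-1}V\subseteq U$. If $\mathcal{G}$ is simply connected, then $f$ extends uniquely to a locally definable group homomorphism $\overline{f}:\mathcal{G}\to\mathcal{G}'$.
   Context: Work in a sufficiently $\kappa$-saturated o-minimal structure $\mathcal{M}$; ''definable'' means definable in $\mathcal{M}$ with parameters. A group is locally definable if its domain and the graph of its group operation are countable unions of definable sets; a map between locally definable sets is locally definable if its restriction to each definable subset is definable. Every $n$-dimensional locally definable group carries a unique group topology (the $\tau$-topology) in which every point has a definable neighborhood definably homeomorphic to $M^n$; all topological notions refer to it. Path connectedness, homotopy and simple connectedness are defined as in algebraic topology, but using locally definable paths and homotopies (so $\mathcal{G}$ simply connected means it is path connected in this sense and every locally definable loop is locally definably null-homotopic). A local homomorphism $f:U\to\mathcal{G}'$ is a map with $f(hh')=f(h)f(h')$ whenever $h,h',hh'\in U$. A subset $X\subseteq\mathcal{G}$ is left (right) generic if $\mathcal{G}=AX$ ($\mathcal{G}=XA$) for some $A\subseteq\mathcal{G}$ with $|A|<\kappa$, and generic if it is both left and right generic. *)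

(* Defs.v *)
From mathcomp Require Import all_boot.
Set Implicit Arguments.
Unset Strict Implicit.
Unset Printing Implicit Defensive.

(* First-order structures in the style of van den Dries (Tame topology,*)
(* Ch. 1): a carrier M, a strict order, and for every n a collection   *)
(* Def n of "definable" (with parameters) subsets of M^n.              *)
Record ostruct := OStruct {
  carrier : Type;
  olt : carrier -> carrier -> Prop;
  Def : forall n : nat, (('I_n -> carrier) -> Prop) -> Prop }.

Arguments Def o {n}.

Definition pt (S : ostruct) (n : nat) := 'I_n -> carrier S.

Definition ptcat (S : ostruct) m n (x : pt S m) (y : pt S n) : pt S (m + n) :=
  fun i => match split i with inl j => x j | inr k => y k end.

Definition pt1 (S : ostruct) (a : carrier S) : pt S 1 := fun _ => a.
Definition pt2 (S : ostruct) (t s : carrier S) : pt S 2 :=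
  fun i => if val i == 0 then t else s.

Definition ole (S : ostruct) (a b : carrier S) := olt a b \/ a = b.

Definition lo_ok (S : ostruct) (o : option (carrier S)) (a : carrier S) :=
  match o with None => True | Some b => olt b a end.
Definition hi_ok (S : ostruct) (a : carrier S) (o : option (carrier S)) :=
  match o with None => True | Some b => olt a b end.

Definition ominimal (S : ostruct) : Prop :=
  (inhabited (carrier S)) /\ (
      (forall a : carrier S, ~ olt a a)
      /\ (forall a b c : carrier S, olt a b -> olt b c -> olt a c)
      /\ (forall a b : carrier S, olt a b \/ a = b \/ olt b a)) /\ (
      (forall a b : carrier S, olt a b -> exists c, olt a c /\ olt c b)
      /\ (forall a : carrier S, exists b c, olt b a /\ olt a c)) /\ (
      (forall n, Def S (fun _ : pt S n => False))
      /\ (forall n, Def S (fun _ : pt S n => True))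
      /\ (forall n (A : pt S n -> Prop), Def S A -> Def S (fun x => ~ A x))
      /\ (forall n (A B : pt S n -> Prop), Def S A -> Def S B ->
             Def S (fun x => A x \/ B x))) /\ (
      (forall n (A : pt S n -> Prop), Def S A ->
          Def S (fun z : pt S (n + 1) => exists x y, A x /\ z = ptcat x y))
      /\ (forall n (A : pt S n -> Prop), Def S A ->
          Def S (fun z : pt S (1 + n) => exists y x, A x /\ z = ptcat y x))
      /\ (forall n (i j : 'I_n), Def S (fun x : pt S n => x i = x j))
      /\ (forall n (A : pt S (n + 1) -> Prop), Def S A ->
          Def S (fun x : pt S n => exists y : pt S 1, A (ptcat x y)))) /\ (
      Def S (fun x : pt S 2 => olt (x ord0) (x ord_max))
      /\ (forall a : carrier S, Def S (fun x : pt S 1 => x ord0 = a))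
      /\ (forall A : pt S 1 -> Prop, Def S A ->
            exists (k : nat) (p : 'I_k -> carrier S) (l : nat)
                   (lo hi : 'I_l -> option (carrier S)),
              forall x, A x <-> ((exists i, x ord0 = p i)
                   \/ (exists j, lo_ok (lo j) (x ord0) /\ hi_ok (x ord0) (hi j))))).

(* |I| < kappa, where kappa is the cardinality of the type K *)
Definition card_lt (K I : Type) : Prop :=
  (exists f : I -> K, injective f) /\ ~ (exists g : K -> I, injective g).

Definition saturated (S : ostruct) (K : Type) : Prop :=
  forall (n : nat) (I : Type) (F : I -> pt S n -> Prop),
    card_lt K I -> (forall i, Def S (F i)) ->
    (forall (k : nat) (h : 'I_k -> I), exists x, forall j, F (h j) x) ->
    exists x, forall i, F i x.

Definition uncountable (K : Type) : Prop := ~ (exists f : K -> nat, injective f).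

Definition ldef (S : ostruct) n (X : pt S n -> Prop) : Prop :=
  exists D : nat -> pt S n -> Prop,
    (forall k, Def S (D k)) /\ (forall x, X x <-> exists k, D k x).

Definition defmap (S : ostruct) m n (A : pt S m -> Prop) (f : pt S m -> pt S n) :=
  Def S (fun z : pt S (m + n) => exists x, A x /\ z = ptcat x (f x)).

Definition ldmap (S : ostruct) m n (A : pt S m -> Prop) (f : pt S m -> pt S n) :=
  forall D : pt S m -> Prop, Def S D -> (forall x, D x -> A x) -> defmap D f.

Record ldgroup (S : ostruct) (N : nat) := LDGroup {
  gset : pt S N -> Prop;
  gmul : pt S N -> pt S N -> pt S N;
  ginv : pt S N -> pt S N;
  gone : pt S N;
  gset_ld : ldef gset;
  gmul_ld : ldef (fun z : pt S (N + N + N) =>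
              exists x y, gset x /\ gset y /\ z = ptcat (ptcat x y) (gmul x y));
  gone_in : gset gone;
  gmul_in : forall x y, gset x -> gset y -> gset (gmul x y);
  ginv_in : forall x, gset x -> gset (ginv x);
  gmulA : forall x y z, gset x -> gset y -> gset z ->
            gmul x (gmul y z) = gmul (gmul x y) z;
  gmul1 : forall x, gset x -> gmul gone x = x;
  gmulV : forall x, gset x -> gmul (ginv x) x = gone }.

Definition box (S : ostruct) n (a b x : pt S n) : Prop :=
  forall i, olt (a i) (x i) /\ olt (x i) (b i).

Definition proj_has_interior (S : ostruct) N k (D : pt S N -> Prop) (s : 'I_k -> 'I_N) :=
  exists a b : pt S k, (forall i, olt (a i) (b i)) /\
    forall y, box a b y -> exists x, D x /\ y = (fun i => x (s i)).

Definition has_dim (S : ostruct) N (X : pt S N -> Prop) (n : nat) : Prop :=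
  (exists (D : pt S N -> Prop) (s : 'I_n -> 'I_N),
      Def S D /\ (forall x, D x -> X x) /\ injective s /\ proj_has_interior D s)
  /\ (forall k (D : pt S N -> Prop) (s : 'I_k -> 'I_N),
      Def S D -> (forall x, D x -> X x) -> injective s ->
      proj_has_interior D s -> k <= n).

Definition topology_on (S : ostruct) N (X : pt S N -> Prop)
    (T : (pt S N -> Prop) -> Prop) : Prop :=
  [/\ T (fun _ => False), T X,
      (forall O, T O -> forall x, O x -> X x),
      (forall F : (pt S N -> Prop) -> Prop, (forall O, F O -> T O) ->
          T (fun x => exists O, F O /\ O x)) &
      (forall O1 O2, T O1 -> T O2 -> T (fun x => O1 x /\ O2 x))].

Definition nbhd (S : ostruct) N (T : (pt S N -> Prop) -> Prop) (W : pt S N -> Prop) g :=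
  exists O, T O /\ O g /\ (forall y, O y -> W y).

Definition is_tau_topology (S : ostruct) N (G : ldgroup S N)
    (T : (pt S N -> Prop) -> Prop) : Prop :=
  [/\ topology_on (gset G) T,
      (forall O x y, T O -> gset G x -> gset G y -> O (gmul G x y) ->
         exists O1 O2, [/\ T O1, T O2, O1 x, O2 y &
            forall u v, O1 u -> O2 v -> O (gmul G u v)]),
      (forall O x, T O -> gset G x -> O (ginv G x) ->
         exists O', [/\ T O', O' x & forall u, O' u -> O (ginv G u)]) &
      exists n, has_dim (gset G) n /\
        forall g, gset G g -> exists (W : pt S N -> Prop) (phi : pt S N -> pt S n),
          [/\ Def S W, (forall x, W x -> gset G x), nbhd T W g, defmap W phi &
              (forall x y, W x -> W y -> phi x = phi y -> x = y)] /\
          [/\ (forall z, exists x, W x /\ phi x = z),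
              (forall x, W x -> forall a b, box a b (phi x) ->
                 exists O, [/\ T O, O x & forall y, W y -> O y -> box a b (phi y)]) &
              (forall x, W x -> forall O, T O -> O x ->
                 exists a b, box a b (phi x) /\
                   forall y, W y -> box a b (phi y) -> O y)]].

Definition relopen (S : ostruct) N (T : (pt S N -> Prop) -> Prop) (U A : pt S N -> Prop) :=
  exists O, T O /\ forall x, A x <-> (O x /\ U x).

Definition def_connected (S : ostruct) N (T : (pt S N -> Prop) -> Prop) (U : pt S N -> Prop) :=
  ~ exists A B : pt S N -> Prop,
      [/\ Def S A /\ Def S B, relopen T U A /\ relopen T U B,
          (forall x, A x -> U x) /\ (forall x, B x -> U x),
          (exists x, A x) /\ (exists x, B x) &
          (forall x, ~ (A x /\ B x)) /\ (forall x, U x -> A x \/ B x)].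

Definition cont_into (S : ostruct) k N (D : pt S k -> Prop) (f : pt S k -> pt S N)
    (T : (pt S N -> Prop) -> Prop) :=
  forall x, D x -> forall O, T O -> O (f x) ->
    exists a b, box a b x /\ forall y, D y -> box a b y -> O (f y).

Definition ival (S : ostruct) (a b : carrier S) (x : pt S 1) :=
  ole a (x ord0) /\ ole (x ord0) b.

Definition square (S : ostruct) (a b c d : carrier S) (x : pt S 2) :=
  (ole a (x ord0) /\ ole (x ord0) b) /\ (ole c (x ord_max) /\ ole (x ord_max) d).

Definition ldpath (S : ostruct) N (G : ldgroup S N) (T : (pt S N -> Prop) -> Prop)
    (a b : carrier S) (gam : pt S 1 -> pt S N) :=
  [/\ olt a b, ldmap (ival a b) gam, (forall t, ival a b t -> gset G (gam t)) &
      cont_into (ival a b) gam T].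

Definition path_connected (S : ostruct) N (G : ldgroup S N) T :=
  forall x y, gset G x -> gset G y ->
    exists a b gam, [/\ ldpath G T a b gam, gam (pt1 a) = x & gam (pt1 b) = y].

Definition simply_connected (S : ostruct) N (G : ldgroup S N) T :=
  path_connected G T /\
  forall a b gam x, ldpath G T a b gam -> gam (pt1 a) = x -> gam (pt1 b) = x ->
    exists c d (H : pt S 2 -> pt S N),
      [/\ olt c d /\ ldmap (square a b c d) H,
          (forall z, square a b c d z -> gset G (H z)),
          cont_into (square a b c d) H T,
          (forall t, ival a b (pt1 t) ->
              H (pt2 t c) = gam (pt1 t) /\ H (pt2 t d) = x) &
          (forall s, ival c d (pt1 s) -> H (pt2 a s) = x /\ H (pt2 b s) = x)].

Definition left_generic (S : ostruct) (K : Type) N (G : ldgroup S N) (X : pt S N -> Prop) :=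
  exists A : pt S N -> Prop, card_lt K {x | A x} /\ (forall a, A a -> gset G a) /\
    forall g, gset G g <-> exists a x, [/\ A a, X x & g = gmul G a x].

Definition right_generic (S : ostruct) (K : Type) N (G : ldgroup S N) (X : pt S N -> Prop) :=
  exists A : pt S N -> Prop, card_lt K {x | A x} /\ (forall a, A a -> gset G a) /\
    forall g, gset G g <-> exists a x, [/\ A a, X x & g = gmul G x a].

Definition generic (S : ostruct) K N (G : ldgroup S N) X :=
  left_generic K G X /\ right_generic K G X.

Definition local_hom (S : ostruct) N N' (G : ldgroup S N) (G' : ldgroup S N')
    (U : pt S N -> Prop) (f : pt S N -> pt S N') :=
  (forall h, U h -> gset G' (f h)) /\
  forall h h', U h -> U h' -> U (gmul G h h') ->
    f (gmul G h h') = gmul G' (f h) (f h').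

Definition ld_hom_extending (S : ostruct) N N' (G : ldgroup S N) (G' : ldgroup S N')
    (U : pt S N -> Prop) (f fb : pt S N -> pt S N') :=
  [/\ forall g, gset G g -> gset G' (fb g),
      ldmap (gset G) fb,
      forall g h, gset G g -> gset G h -> fb (gmul G g h) = gmul G' (fb g) (fb h) &
      forall u, U u -> fb u = f u].

(* Main.v *)
(* Subdivide a definable path gam into fine steps, on which all increments gam(u)^-1 gam(v) lie in U;
   this is possible because, by genericity and saturation, finitely many translates of V cover the
   path. The holonomy of gam is the product of the values of f on the successive increments; since f
   is a local homomorphism it does not depend on the subdivision. For a map on a rectangle with
   constant left edge, the holonomy of the top edge is that of the bottom edge times that of the right
   edge. Applied to a null homotopy this shows that loops at the identity have trivial holonomy, and
   applied to g1(t) g2(min(t, s)) that holonomy is multiplicative for pointwise products of paths; the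
   latter replaces concatenation and reversal, which need not exist in M. So the holonomy of a path
   from e to g depends only on g, and defines a homomorphism.
   It remains to see that this homomorphism agrees with f on U. Both change in the same way along any
   path inside U, so the agreement set A contains a neighborhood of e, and is relatively clopen in U;
   U being only definably connected, A must be shown definable. On all but finitely many points of
   each coordinate line the inclusion of U into G is continuous (otherwise disjoint translates of an
   open set would give a subset of dimension dim G + 1), hence A is constant on the intervals of
   continuity, and points chosen definably in these intervals reduce the number of coordinates. *)
Require Import Defs.
From mathcomp Require Import all_boot.
From Stdlib Require Import Classical ClassicalEpsilon FunctionalExtensionality PropExtensionality.
From Stdlib Require FinFun.
Set Implicit Arguments.
Unset Strict Implicit.
Unset Printing Implicit Defensive.

(** * Definable sets and maps *)

Section Definability.
Variable S : ostruct.
Hypothesis omin : ominimal S.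
Local Notation M := (carrier S).
Local Notation Def := (@Def S).

(** Saturation together with tameness of the line takes their place: a parameter that can be found
    for every finite part of a sequence can be found for the whole sequence, and a definable subset
    of the line that contains an infinite sequence contains an interval. Interior and dimension are
    developed from this one coordinate at a time, without cell decomposition. Connectedness of an
    interval can be used only for definable sets, while holonomy is at first a union over the number
    of steps. Saturation bounds this number over a definable family of paths; for a fixed number of
    steps holonomy is one definable relation and can enter an induction along an interval. Existence
    of a subdivision cannot be obtained in this way, the set of points reached by finitely many
    steps not being known to be definable; genericity is what gets past this. For the agreement set
    no bounded family of paths covering [U] is at hand, which is why it is approached through
    coordinate lines. *)

Lemma Def_ext n (A B : pt S n -> Prop) : (forall x, A x <-> B x) -> Def A -> Def B.
Proof.
move=> AB; suff -> : B = A by [].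
by apply: functional_extensionality => x; apply: propositional_extensionality; rewrite AB.
Qed.

Lemma Def_false n : Def (fun _ : pt S n => False).
Proof. by have [_ [_ [_ [[h _] _]]]] := omin; apply: h. Qed.
Lemma Def_true n : Def (fun _ : pt S n => True).
Proof. by have [_ [_ [_ [[_ [h _]] _]]]] := omin; apply: h. Qed.
Lemma Def_not n (A : pt S n -> Prop) : Def A -> Def (fun x => ~ A x).
Proof. by have [_ [_ [_ [[_ [_ [h _]]] _]]]] := omin; apply: h. Qed.
Lemma Def_or n (A B : pt S n -> Prop) : Def A -> Def B -> Def (fun x => A x \/ B x).
Proof. by have [_ [_ [_ [[_ [_ [_ h]]] _]]]] := omin; apply: h. Qed.
Lemma Def_and n (A B : pt S n -> Prop) : Def A -> Def B -> Def (fun x => A x /\ B x).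
Proof.
move=> dA dB; have := Def_not (Def_or (Def_not dA) (Def_not dB)).
apply: Def_ext => x; split; last by case=> a b [].
by move=> h; split; apply: NNPP => h'; apply: h; [left|right].
Qed.
Lemma Def_padl n (A : pt S n -> Prop) :
  Def A -> Def (fun z : pt S (1 + n) => exists y x, A x /\ z = ptcat y x).
Proof. by have [_ [_ [_ [_ [[_ [h _]] _]]]]] := omin; apply: h. Qed.
Lemma Def_diag n (i j : 'I_n) : Def (fun x : pt S n => x i = x j).
Proof. by have [_ [_ [_ [_ [[_ [_ [h _]]] _]]]]] := omin; apply: h. Qed.
Lemma Def_proj n (A : pt S (n + 1) -> Prop) :
  Def A -> Def (fun x : pt S n => exists y : pt S 1, A (ptcat x y)).
Proof. by have [_ [_ [_ [_ [[_ [_ [_ h]]] _]]]]] := omin; apply: h. Qed.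
Lemma Def_lt : Def (fun x : pt S 2 => olt (x ord0) (x ord_max)).
Proof. by have [_ [_ [_ [_ [_ [h _]]]]]] := omin. Qed.
Lemma Def_const (a : M) : Def (fun x : pt S 1 => x ord0 = a).
Proof. by have [_ [_ [_ [_ [_ [_ [h _]]]]]]] := omin; apply: h. Qed.

Lemma ptcatl m n (x : pt S m) (y : pt S n) i : ptcat x y (lshift n i) = x i.
Proof. by rewrite /ptcat (unsplitK (inl i)). Qed.
Lemma ptcatr m n (x : pt S m) (y : pt S n) i : ptcat x y (rshift m i) = y i.
Proof. by rewrite /ptcat (unsplitK (inr i)). Qed.
Definition lpt m n (z : pt S (m + n)) : pt S m := fun i => z (lshift n i).
Definition rpt m n (z : pt S (m + n)) : pt S n := fun i => z (rshift m i).
Lemma lptK m n (x : pt S m) (y : pt S n) : lpt (ptcat x y) = x.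
Proof. by apply: functional_extensionality => i; rewrite /lpt ptcatl. Qed.
Lemma rptK m n (x : pt S m) (y : pt S n) : rpt (ptcat x y) = y.
Proof. by apply: functional_extensionality => i; rewrite /rpt ptcatr. Qed.
Lemma ptcatK m n (z : pt S (m + n)) : ptcat (lpt z) (rpt z) = z.
Proof.
apply: functional_extensionality => i; rewrite -(splitK i).
by case: (split i) => j; rewrite /unsplit ?ptcatl ?ptcatr.
Qed.

(* Predicates on assignments of all the variables x_0, x_1, ..., depending only on the
   first n: variables can then be added, shifted and projected away without casts. *)
Definition denv n (P : (nat -> M) -> Prop) :=
  exists A : pt S n -> Prop, Def A /\ forall e, P e <-> A (fun i => e i).

Lemma denv_ext n P Q : (forall e, P e <-> Q e) -> denv n P -> denv n Q.
Proof. by move=> PQ [A [dA hA]]; exists A; split=> // e; rewrite -PQ hA. Qed.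
Lemma denv_and n P Q : denv n P -> denv n Q -> denv n (fun e => P e /\ Q e).
Proof.
move=> [A [dA hA]] [B [dB hB]]; exists (fun x => A x /\ B x); split; first exact: Def_and.
by move=> e; rewrite hA hB.
Qed.
Lemma denv_true n : denv n (fun _ => True).
Proof. by exists (fun _ => True); split; first exact: Def_true. Qed.
Lemma denv_shift1 n P : denv n P -> denv (1 + n) (fun e => P (fun i => e i.+1)).
Proof.
move=> [A [dA hA]]; exists (fun z : pt S (1 + n) => exists y x, A x /\ z = ptcat y x).
split; first exact: Def_padl.
move=> e; rewrite hA; split.
  move=> Ae; exists (lpt (fun i : 'I_(1+n) => e i)), (rpt (fun i : 'I_(1+n) => e i)).
  by rewrite ptcatK.
move=> [y [x [Ax E]]]; suff -> : (fun i : 'I_n => e i.+1) = x by [].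
apply: functional_extensionality => i.
by move/(congr1 (@rpt 1 n)): E; rewrite rptK => <-.
Qed.
Lemma denv_shift k n P : denv n P -> denv (k + n) (fun e => P (fun i => e (k + i))).
Proof.
move=> dP; elim: k => [|k IH]; first exact: denv_ext dP.
exact: denv_ext (denv_shift1 IH).
Qed.
Lemma denv_eq n i j : i < n -> j < n -> denv n (fun e => e i = e j).
Proof.
move=> hi hj; exists (fun x : pt S n => x (Ordinal hi) = x (Ordinal hj)).
by split=> //; apply: Def_diag.
Qed.
Lemma denv_ex1 n P :
  denv (n + 1) P -> denv n (fun e => exists a, P (fun i => if i < n then e i else a)).
Proof.
move=> [A [dA hA]]; exists (fun x : pt S n => exists y : pt S 1, A (ptcat x y)).
split; first exact: Def_proj.
move=> e; split=> [[a]|[y]].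
  rewrite hA => h; exists (fun _ => a); suff <- : (fun i : 'I_(n+1) => if i < n then e i else a) =
    ptcat (fun i : 'I_n => e i) (fun=> a) by [].
  apply: functional_extensionality => i; rewrite -(splitK i).
  by case: (split i) => j /=; rewrite ?ptcatl ?ptcatr ?ltn_ord // ltnNge leq_addr.
move=> h; exists (y ord0); rewrite hA; suff -> :
   (fun i : 'I_(n+1) => if i < n then e i else y ord0) = ptcat (fun i : 'I_n => e i) y by [].
apply: functional_extensionality => i; rewrite -(splitK i).
case: (split i) => j /=; rewrite ?ptcatl ?ptcatr ?ltn_ord // ltnNge leq_addr /=.
by rewrite (ord1 j).
Qed.
Lemma denv_local n P : denv n P ->
  forall e e', (forall i, i < n -> e i = e' i) -> P e -> P e'.
Proof.
move=> [A [_ hA]] e e' E; rewrite !hA.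
suff -> : (fun i : 'I_n => e i) = (fun i : 'I_n => e' i) by [].
by apply: functional_extensionality => i; apply: E.
Qed.
Lemma denv_exs m n P :
  denv (n + m) P -> denv n (fun e => exists y : nat -> M, P (fun i => if i < n then e i else y i)).
Proof.
elim: m P => [|m IH] P dP.
  rewrite addn0 in dP; apply: denv_ext (dP) => e; split=> [h|[y]].
    by exists e; apply: (denv_local dP _ h) => i ->.
  by apply: (denv_local dP) => i ->.
rewrite -addn1 addnA in dP; apply: denv_ext (IH _ (denv_ex1 dP)) => e; split=> [[y [a h]]|[y h]].
  exists (fun i => if i < n + m then y i else a); apply: (denv_local dP _ h) => i hi.
  case: (ltnP i n) => // h1; case: ltnP => // h2.
  by move: (leq_trans h1 (leq_trans (leq_addr m n) h2)); rewrite ltnn.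
exists y, (y (n + m)); apply: (denv_local dP _ h) => i hi.
case: (ltnP i n) => h1; first by rewrite (leq_trans h1) ?leq_addr.
by case: ltnP => // h2; congr y; apply/eqP; rewrite eqn_leq h2 andbT; rewrite addn1 ltnS in hi.
Qed.

Lemma denv_forall n k (P : 'I_k -> (nat -> M) -> Prop) :
  (forall i, denv n (P i)) -> denv n (fun e => forall i, P i e).
Proof.
elim: k P => [|k IH] P dP.
  by apply: denv_ext (denv_true n) => e; split=> // _ [].
apply: denv_ext (denv_and (dP ord0) (IH _ (fun i => dP (lift ord0 i)))) => e; split.
  by case=> h0 h i; case: (unliftP ord0 i) => [j ->|->].
by move=> h; split.
Qed.

(** The axioms allow padding, diagonals and projection of the last coordinate. So [A] is put on [m]
    fresh variables, these are equated with the variables named by [s], and then projected away. *)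
Lemma Def_reindex m n (s : 'I_m -> 'I_n) (A : pt S m -> Prop) :
  Def A -> Def (fun x : pt S n => A (fun j => x (s j))).
Proof.
move=> dA.
have dA' : denv m (fun e => A (fun i => e i)) by exists A.
have hs i : s i < n + m by rewrite (leq_trans (ltn_ord _)) ?leq_addr.
have dE (i : 'I_m) : denv (n + m) (fun e => e (n + i) = e (s i)).
  by apply: denv_eq => //; rewrite ltn_add2l.
have [B [dB hB]] := denv_exs (denv_and (denv_shift n dA') (denv_forall dE)).
have [[d] _] := omin.
apply: Def_ext dB => x.
pose e i := if insub i is Some j then x j else d.
have He (i : 'I_n) : e i = x i by rewrite /e valK.
have -> : x = (fun i : 'I_n => e i) by apply: functional_extensionality => i.
rewrite -hB; split=> [[y []]|h].
  have F i : (n + i < n) = false by rewrite ltnNge leq_addr.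
  move=> hA hy; suff -> : (fun j => e (s j)) = (fun i : 'I_m => if n + i < n then e (n + i) else y (n + i)) by [].
  by apply: functional_extensionality => j; rewrite hy ltn_ord.
exists (fun i => if insub (i - n) is Some j then e (s j) else d); split=> [|i].
  suff -> : (fun i : 'I_m => if n + i < n then e (n + i) else
    if insub (n + i - n) is Some j then e (s j) else d) = (fun j => e (s j)) by [].
  by apply: functional_extensionality => j; rewrite ltnNge leq_addr /= addKn valK.
by rewrite ltn_ord ltnNge leq_addr /= addKn valK.
Qed.

Lemma Def_projs m n (A : pt S (n + m) -> Prop) :
  Def A -> Def (fun x : pt S n => exists y : pt S m, A (ptcat x y)).
Proof.
move=> dA; have dA' : denv (n + m) (fun e => A (fun i => e i)) by exists A.
have [B [dB hB]] := denv_exs dA'.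
have [[d] _] := omin.
apply: Def_ext dB => x.
pose e i := if insub i is Some j then x j else d.
have He (i : 'I_n) : e i = x i by rewrite /e valK.
have Ex : x = (fun i : 'I_n => e i) by apply: functional_extensionality => i.
rewrite Ex -hB -Ex; split=> [[y h]|[y h]].
  exists (fun i => y (n + i)).
  suff <- : (fun i : 'I_(n + m) => if i < n then e i else y i) = ptcat x (fun i : 'I_m => y (n + i)) by [].
  apply: functional_extensionality => i; rewrite -(splitK i).
  by case: (split i) => j /=; rewrite ?ptcatl ?ptcatr ?ltn_ord // ltnNge leq_addr.
exists (fun i => if insub (i - n) is Some j then y j else d).
suff -> : (fun i : 'I_(n + m) => if i < n then e i else
  if insub (i - n) is Some j then y j else d) = ptcat x y by [].
apply: functional_extensionality => i; rewrite -(splitK i).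
by case: (split i) => j /=; rewrite ?ptcatl ?ptcatr ?ltn_ord // ltnNge leq_addr /= addKn valK.
Qed.
End Definability.

(* Types whose elements are coded by points of some M^n, so that definability of
   predicates with tuple variables can be stated without explicit coordinates. *)
Class coded (S : ostruct) (X : Type) := Coded {
  cdim : nat; enc : X -> pt S cdim; dec : pt S cdim -> X;
  encK : forall x, dec (enc x) = x; decK : forall z, enc (dec z) = z }.
Arguments cdim {S} X {_}.
Arguments enc {S X _}.
Arguments dec {S X _}.

Lemma pt1K S (z : pt S 1) : (fun=> z ord0) = z.
Proof. by apply: functional_extensionality => i; rewrite ord1. Qed.
#[export] Instance coded_carrier S : coded S (carrier S) :=
  @Coded S (carrier S) 1 (fun a _ => a) (fun z => z ord0) (fun _ => erefl) (@pt1K S).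
#[export] Instance coded_pt S n : coded S (pt S n) :=
  @Coded S (pt S n) n id id (fun _ => erefl) (fun _ => erefl).
Section CodedProduct.
Context {S : ostruct} {X Y : Type} {cX : coded S X} {cY : coded S Y}.
Lemma pair_encK (p : X * Y) :
  (fun z => (dec (lpt z), dec (rpt z))) (ptcat (enc p.1) (enc p.2)) = p.
Proof. by case: p => x y /=; rewrite lptK rptK !encK. Qed.
Lemma pair_decK z : (fun p : X * Y => ptcat (enc p.1) (enc p.2)) (dec (lpt z), dec (rpt z)) = z.
Proof. by rewrite /= !decK ptcatK. Qed.
#[export] Instance coded_prod : coded S (X * Y) := Coded pair_encK pair_decK.
End CodedProduct.

Definition dset {S : ostruct} {X} {cX : coded S X} (P : X -> Prop) :=
  @Def S (cdim X) (fun z : pt S (cdim X) => P (dec z)).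
(** Maps that only copy, permute or drop coordinates; pulling back along them is [Def_reindex]. *)
Definition cmap {S : ostruct} {X Y} {cX : coded S X} {cY : coded S Y} (g : X -> Y) :=
  exists s : 'I_(cdim Y) -> 'I_(cdim X), forall x i, enc (g x) i = enc x (s i).
Definition dmap {S : ostruct} {X Y} {cX : coded S X} {cY : coded S Y} (g : X -> Y) :=
  dset (fun p : X * Y => p.2 = g p.1).
(** Only the graph over [D] is constrained: a Rocq function is total, and its values outside [D] are
    arbitrary. *)
Definition dmapon {S : ostruct} {X Y} {cX : coded S X} {cY : coded S Y}
   (D : X -> Prop) (g : X -> Y) := dset (fun p : X * Y => D p.1 /\ p.2 = g p.1).

Section DefinablePredicates.
Variable S : ostruct.
Hypothesis omin : ominimal S.
Local Notation M := (carrier S).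
Local Notation dset := (@dset S _ _).

Section OneType.
Context {X : Type} {cX : coded S X}.
Implicit Types P Q : X -> Prop.

Lemma dset_iff P Q : (forall x, P x <-> Q x) -> dset P -> dset Q.
Proof. by move=> PQ; apply: Def_ext => z; apply: PQ. Qed.
Lemma dset_and P Q : dset P -> dset Q -> dset (fun x => P x /\ Q x).
Proof. exact: Def_and. Qed.
Lemma dset_or P Q : dset P -> dset Q -> dset (fun x => P x \/ Q x).
Proof. exact: Def_or. Qed.
Lemma dset_not P : dset P -> dset (fun x => ~ P x).
Proof. exact: Def_not. Qed.
Lemma dset_imp P Q : dset P -> dset Q -> dset (fun x => P x -> Q x).
Proof.
move=> dP dQ; apply: dset_iff (dset_or (dset_not dP) dQ) => x.
by split=> [[]|h] //; case: (classic (P x)) => p; [right; apply: h|left].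
Qed.
Lemma dset_true : dset (fun _ : X => True).
Proof. exact: Def_true. Qed.
Lemma dset_false : dset (fun _ : X => False).
Proof. exact: Def_false. Qed.
Lemma dset_prop (A : Prop) : dset (fun _ : X => A).
Proof.
by case: (classic A) => a; [apply: dset_iff dset_true|apply: dset_iff dset_false].
Qed.
Lemma dset_forall_ord k (P : 'I_k -> X -> Prop) :
  (forall i, dset (P i)) -> dset (fun x => forall i, P i x).
Proof.
elim: k P => [|k IH] P dP; first by apply: dset_iff dset_true => x; split=> // _ [].
apply: dset_iff (dset_and (dP ord0) (IH _ (fun i => dP (lift ord0 i)))) => x; split.
  by case=> h0 h i; case: (unliftP ord0 i) => [j ->|->].
by move=> h; split.
Qed.
Lemma dset_exists_ord k (P : 'I_k -> X -> Prop) :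
  (forall i, dset (P i)) -> dset (fun x => exists i, P i x).
Proof.
move=> dP; apply: dset_iff (dset_not (dset_forall_ord (fun i => dset_not (dP i)))) => x.
split=> [h|[i p] /(_ i)] //; apply: NNPP => h'; apply: h => i p; apply: h'; by exists i.
Qed.
Lemma dset_exists_lt k (P : nat -> X -> Prop) :
  (forall i, dset (P i)) -> dset (fun x => exists i, i < k /\ P i x).
Proof.
move=> dP; apply: dset_iff (dset_exists_ord (fun i : 'I_k => dP i)) => x.
by split=> [[i p]|[i [hi p]]]; [exists i|exists (Ordinal hi)].
Qed.
Lemma cmap_id : @cmap S X X _ _ id.
Proof. by exists id. Qed.
End OneType.

Section TwoTypes.
Context {X Y : Type} {cX : coded S X} {cY : coded S Y}.

Lemma dset_cmap (g : X -> Y) P : cmap g -> dset P -> dset (fun x => P (g x)).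
Proof.
move=> [s hs] dP; apply: Def_ext (Def_reindex omin s dP) => z.
suff -> : dec (fun j => z (s j)) = g (dec z) by [].
rewrite -[RHS]encK; congr dec; apply: functional_extensionality => i.
by rewrite hs decK.
Qed.
Lemma dset_ex (P : X -> Y -> Prop) :
  dset (fun p : X * Y => P p.1 p.2) -> dset (fun x => exists y, P x y).
Proof.
move=> dP; apply: Def_ext (Def_projs omin dP) => z /=; split=> [[y]|[y]] h.
  by exists (dec y); rewrite /= lptK rptK in h.
by exists (enc y); rewrite /= lptK rptK encK.
Qed.
Lemma dset_all (P : X -> Y -> Prop) :
  dset (fun p : X * Y => P p.1 p.2) -> dset (fun x => forall y, P x y).
Proof.
move=> dP; apply: dset_iff (dset_not (dset_ex (P := fun x y => ~ P x y) (dset_not dP))) => x.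
split=> [h y|h [y]]; last by apply.
by apply: NNPP => h'; apply: h; exists y.
Qed.
Lemma cmap_fst : @cmap S (X * Y) X _ _ fst.
Proof. by exists (@lshift _ _) => p i /=; rewrite ptcatl. Qed.
Lemma cmap_snd : @cmap S (X * Y) Y _ _ snd.
Proof. by exists (@rshift _ _) => p i /=; rewrite ptcatr. Qed.
End TwoTypes.

Section ThreeTypes.
Context {X Y Z : Type} {cX : coded S X} {cY : coded S Y} {cZ : coded S Z}.
Lemma cmap_comp (g : X -> Y) (h : Y -> Z) : cmap g -> cmap h -> cmap (fun x => h (g x)).
Proof.
by move=> [s hs] [t ht]; exists (fun i => s (t i)) => x i; rewrite ht hs.
Qed.
Lemma cmap_pair (g : X -> Y) (h : X -> Z) : cmap g -> cmap h -> cmap (fun x => (g x, h x)).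
Proof.
move=> [s hs] [t ht].
exists (fun i => match split i with inl j => s j | inr j => t j end) => x i /=.
rewrite -{1}(splitK i); case: (split i) => j; by rewrite /= ?ptcatl ?ptcatr.
Qed.
End ThreeTypes.

Lemma cmap_coord n (i : 'I_n) : @cmap S (pt S n) M _ _ (fun x => x i).
Proof. by exists (fun _ => i). Qed.

Lemma dset_lt : dset (fun p : M * M => olt p.1 p.2).
Proof.
apply: Def_ext (Def_lt omin) => z /=; rewrite /lpt /rpt.
suff [-> ->] : lshift 1 (@ord0 0) = @ord0 1 /\ rshift 1 (@ord0 0) = @ord_max 1 by [].
by split; apply: val_inj.
Qed.
Lemma dset_eq {X} {cX : coded S X} : dset (fun p : X * X => p.1 = p.2).
Proof.
have hh i : dset (fun z : pt S (cdim X + cdim X) => z (lshift (cdim X) i) = z (rshift (cdim X) i)).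
  exact: Def_diag.
apply: Def_ext (dset_forall_ord hh) => z /=; split=> [h|h i].
  by congr dec; apply: functional_extensionality.
by move: (congr1 (fun g => enc g i) h); rewrite !decK.
Qed.
Lemma dset_const1 (a : M) : dset (fun x => x = a).
Proof. exact: Def_const. Qed.
Lemma dset_point {X} {cX : coded S X} (c : X) : dset (fun x => x = c).
Proof.
have hh i : dset (fun x : pt S (cdim X) => x i = enc c i).
  exact: dset_cmap (cmap_coord i) (dset_const1 (enc c i)).
apply: Def_ext (dset_forall_ord hh) => z /=; split=> [h|<- i]; last by rewrite decK.
by rewrite -[c]encK; congr dec; apply: functional_extensionality.
Qed.

Lemma dmap_cmap {X Y} {cX : coded S X} {cY : coded S Y} (g : X -> Y) : cmap g -> dmap g.
Proof.
move=> hg; apply: (dset_cmap (g := fun p : X * Y => (p.2, g p.1)) _ dset_eq).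
apply: cmap_pair; first exact: cmap_snd.
exact: cmap_comp cmap_fst hg.
Qed.
Lemma dmap_const {X Y} {cX : coded S X} {cY : coded S Y} (c : Y) : dmap (fun _ : X => c).
Proof. exact: dset_cmap cmap_snd (dset_point c). Qed.
Lemma dmap_id {X} {cX : coded S X} : dmap (fun x : X => x).
Proof. exact: dmap_cmap cmap_id. Qed.

Lemma dset_comp {X Y} {cX : coded S X} {cY : coded S Y} (g : X -> Y) P :
  dset P -> dmap g -> dset (fun x => P (g x)).
Proof.
move=> dP dg; apply: dset_iff (dset_ex (P := fun x y => y = g x /\ P y) _) => [x|].
  by split=> [[y [->]]|h] //; exists (g x).
apply: dset_and => //; exact: dset_cmap cmap_snd dP.
Qed.
Lemma dset_compon {X Y} {cX : coded S X} {cY : coded S Y} D (g : X -> Y) P :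
  dset P -> dmapon D g -> dset (fun x => D x /\ P (g x)).
Proof.
move=> dP dg; apply: dset_iff (dset_ex (P := fun x y => (D x /\ y = g x) /\ P y) _) => [x|].
  by split=> [[y [[? ->]]]|[? h]] //; exists (g x).
apply: dset_and => //; exact: dset_cmap cmap_snd dP.
Qed.
Lemma dmap_comp {X Y Z} {cX : coded S X} {cY : coded S Y} {cZ : coded S Z}
  (h : Y -> Z) (g : X -> Y) : dmap h -> dmap g -> dmap (fun x => h (g x)).
Proof.
move=> dh dg.
apply: dset_iff (dset_ex (P := fun (p : X * Z) y => y = g p.1 /\ p.2 = h y) _) => [[x z]|] /=.
  by split=> [[y [-> ->]]|->] //; exists (g x).
apply: dset_and.
  by apply: (dset_cmap (g := fun p : X * Z * Y => (p.1.1, p.2)) _ dg);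
   apply: cmap_pair; [apply: cmap_comp cmap_fst cmap_fst|apply: cmap_snd].
by apply: (dset_cmap (g := fun p : X * Z * Y => (p.2, p.1.2)) _ dh);
 apply: cmap_pair; [apply: cmap_snd|apply: cmap_comp cmap_fst cmap_snd].
Qed.
Lemma dmap_pair {X Y Z} {cX : coded S X} {cY : coded S Y} {cZ : coded S Z}
  (g : X -> Y) (h : X -> Z) : dmap g -> dmap h -> dmap (fun x => (g x, h x)).
Proof.
move=> dg dh.
apply: dset_iff (_ : dset (fun p : X * (Y * Z) => p.2.1 = g p.1 /\ p.2.2 = h p.1)) => [[x [y z]]|] /=.
  by split=> [[-> ->]|[-> ->]].
apply: dset_and.
  apply: (dset_cmap (g := fun p : X * (Y * Z) => (p.1, p.2.1)) _ dg).
  by apply: cmap_pair; [apply: cmap_fst|apply: cmap_comp cmap_snd cmap_fst].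
apply: (dset_cmap (g := fun p : X * (Y * Z) => (p.1, p.2.2)) _ dh).
by apply: cmap_pair; [apply: cmap_fst|apply: cmap_comp cmap_snd cmap_snd].
Qed.
Lemma dmap_fst {X Y Z} {cX : coded S X} {cY : coded S Y} {cZ : coded S Z} (g : X -> Y * Z) :
  dmap g -> dmap (fun x => (g x).1).
Proof. exact: (dmap_comp (dmap_cmap cmap_fst)). Qed.
Lemma dmap_snd {X Y Z} {cX : coded S X} {cY : coded S Y} {cZ : coded S Z} (g : X -> Y * Z) :
  dmap g -> dmap (fun x => (g x).2).
Proof. exact: (dmap_comp (dmap_cmap cmap_snd)). Qed.
Lemma dmap_coord {X} {cX : coded S X} n (i : 'I_n) (g : X -> pt S n) :
  dmap g -> dmap (fun x => g x i).
Proof. exact: (dmap_comp (dmap_cmap (cmap_coord i))). Qed.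
Lemma dset_comp2 {X Y Z} {cX : coded S X} {cY : coded S Y} {cZ : coded S Z}
  (P : Y -> Z -> Prop) (g : X -> Y) (h : X -> Z) :
  dset (fun p : Y * Z => P p.1 p.2) -> dmap g -> dmap h -> dset (fun x => P (g x) (h x)).
Proof. by move=> dP dg dh; apply: (dset_comp (g := fun x => (g x, h x)) dP); apply: dmap_pair. Qed.
End DefinablePredicates.

Class dlo (T : Type) (R : T -> T -> Prop) := Dlo {
  dlo_irr : forall a, ~ R a a;
  dlo_trans : forall a b c, R a b -> R b c -> R a c;
  dlo_total : forall a b, R a b \/ a = b \/ R b a;
  dlo_dense : forall a b, R a b -> exists c, R a c /\ R c b;
  dlo_unbounded : forall a, exists b c, R b a /\ R a c }.
Definition le {T : Type} (R : T -> T -> Prop) a b := R a b \/ a = b.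
(** The order or its reverse, so that a one-sided argument is written once and used on both
    sides. *)
Definition rlt {S : ostruct} (b : bool) (x y : carrier S) := if b then olt y x else olt x y.

Ltac dleaf := solve [assumption | eauto with dd nocore].

(** Definability of a map by recursion on its syntax; the leaves are hypotheses and the hints in
    [dd]. The last branch reads an application [u i] as a coordinate of a tuple. *)
Ltac ddm :=
  lazymatch goal with om : ominimal ?S |- _ =>
  lazymatch goal with
  | |- @dmap _ _ _ _ _ fst => apply (dmap_cmap om (@cmap_fst _ _ _ _ _))
  | |- @dmap _ _ _ _ _ snd => apply (dmap_cmap om (@cmap_snd _ _ _ _ _))
  | |- @dmap _ _ _ _ _ (fun x => x) => apply (dmap_id om)
  | |- @dmap _ _ _ _ _ (fun x => (@?a x, @?b x)) => apply (dmap_pair om (g := a) (h := b)); ddm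
  | |- @dmap _ _ _ _ _ (fun x => fst (@?a x)) => apply (dmap_fst om (g := a)); ddm
  | |- @dmap _ _ _ _ _ (fun x => snd (@?a x)) => apply (dmap_snd om (g := a)); ddm
  | |- _ => first
    [ dleaf
    | apply (dmap_const om)
    | lazymatch goal with |- @dmap _ _ _ _ _ (fun x => ?g (@?a x)) =>
        apply (dmap_comp om (h := g) (g := a)); [dleaf | ddm] end
    | lazymatch goal with |- @dmap _ _ _ _ _ (fun x => ?g (@?a x) (@?b x)) =>
        apply (dmap_comp om (h := fun p => g p.1 p.2) (g := fun x => (a x, b x))); [dleaf | ddm] end
    | lazymatch goal with |- @dmap _ _ _ _ _ (fun x => ?g (@?a x) (@?b x) (@?c x)) =>
        apply (dmap_comp om (h := fun p => g p.1.1 p.1.2 p.2) (g := fun x => (a x, b x, c x))); [dleaf | ddm] end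
    | lazymatch goal with |- @dmap _ ?X _ _ _ ?h =>
        let g := constr:(fun x : X => ltac:(let b := eval cbv beta in (h x) in
                   lazymatch b with ?u ?i => exact u end)) in
        let g := eval cbv beta in g in
        apply (@dmap_coord _ om _ _ _ _ g); ddm end ]
  end end.

(** Definability of a formula by recursion on its syntax. Quantifiers over ordinals are finite and
    are tried before those over coded types; [dset_prop] catches bodies that do not mention the
    variable. *)
Ltac dd :=
  cbv beta; first [assumption |
  lazymatch goal with om : ominimal ?S |- _ =>
  lazymatch goal with
  | |- @dset _ _ _ (fun x => True) => apply (dset_true om)
  | |- @dset _ _ _ (fun x => False) => apply (dset_false om)
  | |- @dset _ _ _ (fun x => @?A x /\ @?B x) => apply (dset_and om (P := A) (Q := B)); dd
  | |- @dset _ _ _ (fun x => @?A x \/ @?B x) => apply (dset_or om (P := A) (Q := B)); dd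
  | |- @dset _ _ _ (fun x => ~ (@?A x)) => apply (dset_not om (P := A)); dd
  | |- @dset _ _ _ (fun x => exists i : 'I_?n, @?P x i) =>
      apply (dset_exists_ord om (P := fun i x => P x i)); intro; dd
  | |- @dset _ _ _ (fun x => exists y : ?T, @?P x y) => apply (dset_ex om (P := P)); dd
  | |- @dset _ _ _ (fun x => forall i : 'I_?n, @?P x i) =>
      apply (dset_forall_ord om (P := fun i x => P x i)); intro; dd
  | |- @dset _ _ _ (fun x => (@?a x) = (@?b x)) =>
      apply (dset_comp2 om (P := fun u v => u = v) (g := a) (h := b)); [apply (dset_eq om) | ddm | ddm]
  | |- @dset _ _ _ (fun x => olt (@?a x) (@?b x)) =>
      apply (dset_comp2 om (P := fun u v => olt u v) (g := a) (h := b)); [apply (dset_lt om) | ddm | ddm]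
  | |- @dset _ _ _ (fun x => ole _ _) => unfold ole; dd
  | |- @dset _ _ _ (fun x => le _ _ _) => unfold le; dd
  | |- _ => first
    [ dleaf
    | apply (dset_prop om)
    | lazymatch goal with |- @dset _ _ _ (fun x => @?A x -> @?B x) => apply (dset_imp om (P := A) (Q := B)); dd end
    | lazymatch goal with |- @dset _ _ _ (fun x => forall y : ?T, @?P x y) => apply (dset_all om (P := P)); dd end
    | lazymatch goal with |- @dset _ _ _ (fun x => ?R (@?a x)) =>
        apply (dset_comp om (g := a) (P := R)); [dleaf | ddm] end
    | lazymatch goal with |- @dset _ _ _ (fun x => ?R (@?a x) (@?b x)) =>
        apply (dset_comp om (g := fun x => (a x, b x)) (P := fun p => R p.1 p.2)); [dleaf | ddm] end
    | lazymatch goal with |- @dset _ _ _ (fun x => ?R (@?a x) (@?b x) (@?c x)) =>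
        apply (dset_comp om (g := fun x => (a x, b x, c x)) (P := fun p => R p.1.1 p.1.2 p.2)); [dleaf | ddm] end
    | lazymatch goal with |- @dset _ _ _ (fun x => ?R (@?a x) (@?b x) (@?c x) (@?d x)) =>
        apply (dset_comp om (g := fun x => (a x, b x, c x, d x))
           (P := fun p => R p.1.1.1 p.1.1.2 p.1.2 p.2)); [dleaf | ddm] end ]
  end end ].

Section PartialMaps.
Variable S : ostruct.
Hypothesis omin : ominimal S.
Local Notation M := (carrier S).
Context {X Y : Type} {cX : coded S X} {cY : coded S Y}.

(** A default value outside [D] turns a map definable on [D] into a total definable map, which [ddm]
    can compose. *)
Definition ext_by (D : X -> Prop) (g : X -> Y) (d : Y) x :=
  if excluded_middle_informative (D x) then g x else d.
Lemma ext_in (D : X -> Prop) (g : X -> Y) d x : D x -> ext_by D g d x = g x.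
Proof. by rewrite /ext_by; case: excluded_middle_informative. Qed.
Lemma ext_out (D : X -> Prop) (g : X -> Y) d x : ~ D x -> ext_by D g d x = d.
Proof. by rewrite /ext_by; case: excluded_middle_informative. Qed.
Lemma dmap_ext (D : X -> Prop) (g : X -> Y) d : dset D -> dmapon D g -> dmap (ext_by D g d).
Proof.
move=> dD dg; rewrite /dmapon in dg.
apply: (@dset_iff _ _ _ (fun p : X * Y => (D p.1 /\ p.2 = g p.1) \/ (~ D p.1 /\ p.2 = d))); last by dd.
move=> [x y] /=; case: (classic (D x)) => h; first by rewrite ext_in //; tauto.
by rewrite ext_out //; tauto.
Qed.
Lemma dmapon_dom (D : X -> Prop) (g : X -> Y) : dmapon D g -> dset D.
Proof.
move=> dg; rewrite /dmapon in dg.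
apply: (@dset_iff _ _ _ (fun x => exists y, D x /\ y = g x)) => [x|].
  by split=> [[y []]|h] //; exists (g x).
by apply: dset_ex.
Qed.
Lemma dmapon_sub (D D' : X -> Prop) (g : X -> Y) :
  dmapon D g -> dset D' -> (forall x, D' x -> D x) -> dmapon D' g.
Proof.
move=> dg dD' sub; rewrite /dmapon in dg.
apply: (@dset_iff _ _ _ (fun p : X * Y => D' p.1 /\ (D p.1 /\ p.2 = g p.1))); last by dd.
by move=> [x y] /=; split; [tauto|move=> [h ->]; split; auto].
Qed.
Lemma dmapon_dmap (D : X -> Prop) (g : X -> Y) : dset D -> dmap g -> dmapon D g.
Proof. by move=> dD dg; rewrite /dmapon /dmap in dg *; dd. Qed.
Lemma dmap_on (g : X -> Y) : dmapon (fun _ => True) g -> dmap g.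
Proof. by apply: dset_iff => -[x y] /=; tauto. Qed.
End PartialMaps.

Lemma dmapon_comp (S : ostruct) (omin : ominimal S) {X Y Z} {cX : coded S X} {cY : coded S Y} {cZ : coded S Z}
  (D : X -> Prop) (E : Y -> Prop) (g : X -> Y) (h : Y -> Z) :
  dmapon E h -> dmapon D g -> (forall x, D x -> E (g x)) -> dmapon D (fun x => h (g x)).
Proof.
move=> dh dg DE; rewrite /dmapon in dh dg.
apply: (@dset_iff _ _ _ (fun p : X * Z => exists y, (D p.1 /\ y = g p.1) /\ (E y /\ p.2 = h y))) => [[x z]|] /=.
  by split=> [[y [[? ->] [? ->]]]|[? ->]] //; exists (g x); auto.
apply: (dset_ex omin (P := fun (p : X * Z) y => (D p.1 /\ y = g p.1) /\ (E y /\ p.2 = h y))).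
apply: dset_and => //.
  by apply: (dset_comp omin (g := fun p : X * Z * Y => (p.1.1, p.2)) dg); ddm.
by apply: (dset_comp omin (g := fun p : X * Z * Y => (p.2, p.1.2)) dh); ddm.
Qed.

Lemma defmapP (S : ostruct) (omin : ominimal S) m n (A : pt S m -> Prop) (f : pt S m -> pt S n) :
  defmap A f <-> dmapon A f.
Proof.
split; apply: Def_ext => z /=.
  by split=> [[x [h ->]]|[h e]]; [rewrite lptK rptK|exists (lpt z); rewrite -e ptcatK].
by split=> [[h e]|[x [h ->]]]; [exists (lpt z); rewrite -e ptcatK|rewrite lptK rptK].
Qed.

(** * Saturation *)

Section Saturation.
Variables (S : ostruct) (K : Type).
Hypothesis omin : ominimal S.
Hypotheses (uncK : uncountable K) (sat : saturated S K).
Context {X : Type} {cX : coded S X}.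

(** No finite list exhausts [K], so picking a new element again and again embeds [nat]. Hence
    saturation applies to countable families. *)
Lemma card_lt_nat : card_lt K nat.
Proof.
have step (l : list K) : exists x, ~ List.In x l.
  apply: NNPP => h; apply: uncK.
  have hin x : List.In x l by apply: NNPP => h'; apply: h; exists x.
  have hn x : exists i, List.nth_error l i = Some x by apply: List.In_nth_error.
  exists (fun x => proj1_sig (constructive_indefinite_description _ (hn x))) => x y.
  case: constructive_indefinite_description => i /= hi.
  by case: constructive_indefinite_description => j /= hj e; move: hi; rewrite e hj => -[].
pose nx l := proj1_sig (constructive_indefinite_description _ (step l)).
have nxP l : ~ List.In (nx l) l by rewrite /nx; case: constructive_indefinite_description.
pose fix ls n := match n with 0 => nil | n'.+1 => cons (nx (ls n')) (ls n') end.
have lsP n m : n < m -> List.In (nx (ls n)) (ls m).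
  elim: m => [|m IH] //; rewrite ltnS leq_eqVlt => /orP [/eqP ->|/IH]; first by left.
  by right.
split; last by case=> g gi; apply: uncK; exists g.
exists (fun n => nx (ls n)) => n m e; apply/eqP; rewrite eqn_leq; apply/andP; split.
  by rewrite leqNgt; apply/negP => /lsP; rewrite -e; apply: nxP.
by rewrite leqNgt; apply/negP => /lsP; rewrite e; apply: nxP.
Qed.

Lemma sat_fip (I : Type) (F : I -> X -> Prop) : card_lt K I -> (forall i, dset (F i)) ->
  (forall k (h : 'I_k -> I), exists x, forall j, F (h j) x) -> exists x, forall i, F i x.
Proof.
move=> cI dF fip; have [|z hz] := sat cI dF; last by exists (dec z).
by move=> k h; have [x hx] := fip k h; exists (enc x) => j; rewrite encK.
Qed.
Lemma sat_fip_nat (F : nat -> X -> Prop) : (forall i, dset (F i)) ->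
  (forall n, exists x, forall k, k < n -> F k x) -> exists x, forall i, F i x.
Proof.
move=> dF fip; apply: sat_fip => // [|k h]; first exact: card_lt_nat.
have [x hx] := fip (\max_(j < k) (h j)).+1.
by exists x => j; apply: hx; rewrite ltnS; apply: (@leq_bigmax _ (fun j => h j)).
Qed.
(** Compactness: otherwise the sets [D] minus [E i] have the finite intersection property, and
    saturation yields an uncovered point of [D]. *)
Lemma sat_cover (I : Type) (D : X -> Prop) (E : I -> X -> Prop) :
  card_lt K I -> dset D -> (forall i, dset (E i)) -> (forall x, D x -> exists i, E i x) ->
  exists k (h : 'I_k -> I), forall x, D x -> exists j, E (h j) x.
Proof.
move=> cI dD dE cov; apply: NNPP => h.
have ex k (g : 'I_k -> I) : exists x, D x /\ forall j, ~ E (g j) x.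
  apply: NNPP => h'; apply: h; exists k, g => x Dx; apply: NNPP => h2; apply: h'.
  by exists x; split=> // j Ej; apply: h2; exists j.
have [x0 [D0 _]] := ex 0 (fun i : 'I_0 => match i with Ordinal _ l => False_rect _ (notF l) end).
have [||x hx] := @sat_fip I (fun i x => D x /\ ~ E i x) cI.
- by move=> i; apply: dset_and => //; apply: dset_not.
- by move=> k g; have [x [Dx hx]] := ex k g; exists x.
(* That [x] lies in [D] is only part of the conditions indexed by [I], so an index is needed;
   covering [x0] supplies one. *)
have [i0 _] := cov _ D0; have [Dx _] := hx i0; have [i Ei] := cov _ Dx.
by case: (hx i).
Qed.
Lemma sat_cover_nat (D : X -> Prop) (E : nat -> X -> Prop) :
  dset D -> (forall i, dset (E i)) -> (forall x, D x -> exists i, E i x) ->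
  exists n, forall x, D x -> exists i, i < n /\ E i x.
Proof.
move=> dD dE cov; have [k [h hh]] := sat_cover card_lt_nat dD dE cov.
exists (\max_(j < k) (h j)).+1 => x /hh [j Ej]; exists (h j); split=> //.
by rewrite ltnS; apply: (@leq_bigmax _ (fun j => h j)).
Qed.
(** The form that gives uniform bounds, on the number of steps of a subdivision and on the size of
    finite fibres. *)
Lemma sat_cover_incr (D : X -> Prop) (E : nat -> X -> Prop) :
  dset D -> (forall i, dset (E i)) -> (forall i x, E i x -> E i.+1 x) ->
  (forall x, D x -> exists i, E i x) -> exists n, forall x, D x -> E n x.
Proof.
move=> dD dE inc cov; have [n hn] := sat_cover_nat dD dE cov.
exists n => x /hn [i [hi Ei]]; elim: n hi {hn} => [|n IH] //.
by rewrite ltnS leq_eqVlt => /orP [/eqP <-|/IH]; [apply: inc|apply: inc].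
Qed.
End Saturation.

(** * Dense orders and definable subsets of the line *)

Section DenseOrder.
Context {T : Type} {R : T -> T -> Prop} {H : dlo R}.
Lemma dlo_ltP a b : (le R b a -> False) -> R a b.
Proof. by move=> h; case: (dlo_total a b) => [|[e|e]] //; case: h; [right|left]. Qed.
Lemma dlo_leP a b : (R b a -> False) -> le R a b.
Proof. by move=> h; case: (dlo_total a b) => [|[e|e]] //; [left|right]. Qed.
Lemma dlo_eqP a b : (R a b -> False) -> (R b a -> False) -> a = b.
Proof. by move=> h h'; case: (dlo_total a b) => [|[e|e]]. Qed.
Lemma dlo_Nlt a b : ~ R a b -> le R b a.
Proof. by move=> h; apply: dlo_leP. Qed.
Lemma dlo_Nle a b : ~ le R a b -> R b a.
Proof. by move=> h; apply: dlo_ltP. Qed.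
Lemma dlo_lelt a b c : le R a b -> R b c -> R a c.
Proof. by move=> [h|->] //; apply: dlo_trans. Qed.
Lemma dlo_ltle a b c : R a b -> le R b c -> R a c.
Proof. by move=> h [h'|<-] //; apply: dlo_trans h h'. Qed.
Lemma dlo_lele a b c : le R a b -> le R b c -> le R a c.
Proof. by move=> [h|->] // h'; left; apply: dlo_ltle h h'. Qed.
Lemma dlo_eqle a b : a = b -> le R a b /\ le R b a.
Proof. by move=> ->; split; right. Qed.
Lemma dlo_above a : exists b, R a b.
Proof. by have [b [c []]] := dlo_unbounded a; exists c. Qed.
Lemma dlo_below a : exists b, R b a.
Proof. by have [b [c []]] := dlo_unbounded a; exists b. Qed.
Lemma dlo_min a b : exists c, [/\ le R c a, le R c b & c = a \/ c = b].
Proof.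
case: (classic (R a b)) => h; first by exists a; split; [right|left|left].
by exists b; split; [apply: dlo_Nlt|right|right].
Qed.
Lemma dlo_max a b : exists c, [/\ le R a c, le R b c & c = a \/ c = b].
Proof.
case: (classic (R a b)) => h; first by exists b; split; [left|right|right].
by exists a; split; [right|apply: dlo_Nlt|left].
Qed.
End DenseOrder.

(* Decides the order statements that follow from the order hypotheses in the context, by closing
   these under transitivity. *)
Ltac dlo_close R :=
  repeat match goal with
  | h : R ?a ?a |- _ => exfalso; exact (dlo_irr h)
  | h : R ?a ?b, h' : R ?b ?a |- _ => exfalso; exact (dlo_irr (dlo_trans h h'))
  | h : R ?a ?b, h' : le R ?b ?a |- _ => exfalso; exact (dlo_irr (dlo_ltle h h'))
  | h : R ?a ?b, h' : R ?b ?c |- _ =>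
      lazymatch goal with _ : R a c |- _ => fail | _ => pose proof (dlo_trans h h') end
  | h : le R ?a ?b, h' : R ?b ?c |- _ =>
      lazymatch goal with _ : R a c |- _ => fail | _ => pose proof (dlo_lelt h h') end
  | h : R ?a ?b, h' : le R ?b ?c |- _ =>
      lazymatch goal with _ : R a c |- _ => fail | _ => pose proof (dlo_ltle h h') end
  | h : le R ?a ?b, h' : le R ?b ?c |- _ =>
      lazymatch goal with _ : le R a c |- _ => fail | _ : R a c |- _ => fail
      | _ => tryif constr_eq a c then fail else pose proof (dlo_lele h h') end
  end.
Ltac dlo_with R :=
  repeat match goal with h : _ /\ _ |- _ => destruct h end;
  repeat match goal with |- _ /\ _ => split end;
  repeat match goal with
  | h : @rlt ?S false ?a ?b |- _ => change (@olt S a b) in h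
  | |- @rlt ?S false ?a ?b => change (@olt S a b)
  | h : @rlt ?S true ?a ?b |- _ => change (@olt S b a) in h
  | |- @rlt ?S true ?a ?b => change (@olt S b a)
  | h : @ole ?S ?a ?b |- _ => change (le (@olt S) a b) in h
  | h : ~ @ole ?S ?a ?b |- _ => change (~ le (@olt S) a b) in h
  | |- @ole ?S ?a ?b => change (le (@olt S) a b)
  end;
  first [ assumption |
  repeat match goal with
  | |- R _ _ => apply dlo_ltP; intro
  | |- le R _ _ => apply dlo_leP; intro
  | |- ~ _ => intro
  | |- _ = _ => apply (@dlo_eqP _ R _); intro
  end;
  repeat match goal with
  | h : ~ R ?a ?b |- _ => apply dlo_Nlt in h
  | h : ~ le R ?a ?b |- _ => apply dlo_Nle in h
  | h : @eq ?T ?a ?b |- _ => apply (@dlo_eqle T R _) in h; destruct h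
  end;
  solve [dlo_close R] ].
Ltac dlo := cbv beta in *; match goal with
  | |- ?R ?a ?b => lazymatch R with @rlt ?S false => dlo_with (@olt S) | @rlt ?S true => dlo_with (@olt S) | @rlt ?S ?b => dlo_with (@rlt S b) | @olt ?S => dlo_with (@olt S) | le ?R' => dlo_with R' | @ole ?S => dlo_with (@olt S) end
  | h : @rlt ?S false _ _ |- _ => dlo_with (@olt S)
  | h : @rlt ?S true _ _ |- _ => dlo_with (@olt S)
  | h : @rlt ?S ?b _ _ |- _ => dlo_with (@rlt S b)
  | h : @olt ?S _ _ |- _ => dlo_with (@olt S)
  | h : @ole ?S _ _ |- _ => dlo_with (@olt S)
  | h : ~ @ole ?S _ _ |- _ => dlo_with (@olt S)
  | h : le ?R _ _ |- _ => dlo_with R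
  end.

Section Line.
Variable S : ostruct.
Hypothesis omin : ominimal S.
Local Notation M := (carrier S).

#[export] Instance dlo_olt : dlo (@olt S).
Proof. by have [_ [[h1 [h2 h3]] [[h4 h5] _]]] := omin; split. Qed.
#[export] Instance dlo_rlt b : dlo (@rlt S b).
Proof.
case: b; last exact: dlo_olt.
have [h1 h2 h3 h4 h5] := dlo_olt; split=> [a|a b c|a b|a b|a] /=; rewrite /rlt.
- exact: h1.
- by move=> h h'; apply: h2 h' h.
- by case: (h3 a b); tauto.
- by move=> /h4 [c []]; exists c.
- by have [x [y []]] := h5 a; exists y, x.
Qed.
Lemma dset_rlt b : dset (fun p : M * M => rlt b p.1 p.2).
Proof. by rewrite /rlt; case: b; dd. Qed.

(** O-minimality as an induction over finite unions of points and intervals. For the reversed order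
    the two endpoints trade places. *)
Lemma tame_ind b (P : (M -> Prop) -> Prop) :
  P (fun _ => False) -> (forall a, P (fun x => x = a)) ->
  (forall lo hi : option M, P (fun x =>
      (if lo is Some a then rlt b a x else True) /\ (if hi is Some c then rlt b x c else True))) ->
  (forall A B, P A -> P B -> P (fun x => A x \/ B x)) ->
  forall A, dset A -> P A.
Proof.
move=> P0 P1 PI PU A dA.
have PE A' B' : (forall x, A' x <-> B' x) -> P A' -> P B'.
  move=> E; suff -> : A' = B' by [].
  by apply: functional_extensionality => x; apply: propositional_extensionality.
have Pf k (F : 'I_k -> M -> Prop) : (forall i, P (F i)) -> P (fun x => exists i, F i x).
  elim: k F => [|k IH] F PF; first by apply: PE P0 => x; split=> // -[[]].
  apply: PE (PU _ _ (PF ord0) (IH _ (fun i => PF (lift ord0 i)))) => x; split.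
    by case=> [h|[i h]]; [exists ord0|exists (lift ord0 i)].
  by case=> i; case: (unliftP ord0 i) => [j ->|->] h; [right; exists j|left].
have [_ [_ [_ [_ [_ [_ [_ h]]]]]]] := omin.
have [k [p [l [lo [hi E]]]]] := h (fun z => A (z ord0)) dA.
apply: (PE) (PU _ _ (Pf k (fun i x => x = p i) (fun i => P1 _)) (Pf l (fun j x =>
  lo_ok (lo j) x /\ hi_ok x (hi j)) _)) => [x|j]; first by rewrite -(E (pt1 x)).
by case: b PI => PI; [apply: PE (PI (hi j) (lo j))|apply: PE (PI (lo j) (hi j))];
  move=> x; case: (lo j); case: (hi j) => *; rewrite /= /rlt; tauto.
Qed.

Definition int b p q (t : M) := rlt b p t /\ rlt b t q.

Section Decides.
Variables (I : Type) (ok : I -> Prop) (B : I -> M -> Prop) (i0 : I).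
Definition decides i (A : M -> Prop) := (forall t, B i t -> A t) \/ (forall t, B i t -> ~ A t).
Hypothesis ok0 : ok i0.
Hypothesis dir : forall i j, ok i -> ok j -> exists k, ok k /\ forall t, B k t -> B i t /\ B j t.
Hypothesis side : forall a, exists i, ok i /\ ((forall t, B i t -> olt t a) \/ (forall t, B i t -> olt a t)).

Lemma decides_both A1 A2 : (exists i, ok i /\ decides i A1) -> (exists i, ok i /\ decides i A2) ->
  exists i, ok i /\ (decides i A1 /\ decides i A2).
Proof.
move=> [i [oi h]] [j [oj h']]; have [k [k1 k2]] := dir oi oj; exists k; split=> //; split.
  by case: h => h; [left|right] => t /k2 [/h].
by case: h' => h'; [left|right] => t /k2 [_ /h'].
Qed.
(** [B] is a filter base that settles on one side of every point. This is enough, since points and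
    intervals are described by finitely many endpoints. It is used for the one-sided germ at a point
    and around a gap of the order. *)
Lemma decides_dset A : dset A -> exists i, ok i /\ decides i A.
Proof.
move=> dA; elim/(tame_ind (b := false)): A / dA => [|a|lo hi|A1 A2 h1 h2].
- by exists i0; split=> //; right=> t _ [].
- have [i [oi h]] := side a; exists i; split=> //; right=> t Bt e.
  by rewrite e in Bt; case: h => /(_ _ Bt); apply: dlo_irr.
- have ray (c : option M) (R : M -> M -> Prop) : (forall a, R a = olt a \/ R a = fun t => olt t a) ->
    exists i, ok i /\ decides i (fun t => if c is Some a then R a t else True).
    move=> hR; case: c => [a|]; last by exists i0; split=> //; left.
    have [i [oi h]] := side a; exists i; split=> //.
    by case: (hR a) => ->; case: h => h; [right|left|left|right] => t /h // *; dlo.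
  have [||i [oi [h1 h2]]] := decides_both (ray lo (fun a => olt a) _) (ray hi (fun a t => olt t a) _).
  + by left.
  + by right.
  exists i; split=> //; case: h1 => h1; last by right=> t /h1; tauto.
  by case: h2 => h2; [left=> t Bt; split; [apply: h1|apply: h2]|right=> t /h2; tauto].
- have [i [oi [{}h1 {}h2]]] := decides_both h1 h2; exists i; split=> //.
  case: h1 => h1; first by left=> t /h1; left.
  case: h2 => h2; first by left=> t /h2; right.
  by right=> t Bt []; [apply: h1|apply: h2].
Qed.
Lemma decides_family k (A : 'I_k -> M -> Prop) : (forall j, dset (A j)) ->
  exists i, ok i /\ forall j, decides i (A j).
Proof.
elim: k A => [|k IH] A dA; first by exists i0; split=> // -[].
have [i1 [o1 h1]] := decides_dset (dA ord0); have [i2 [o2 h2]] := IH _ (fun j => dA (lift ord0 j)).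
have [i [oi hi]] := dir o1 o2; exists i; split=> // j; case: (unliftP ord0 j) => [j' ->|->].
  by case: (h2 j') => h; [left|right] => t /hi [_ /h].
by case: h1 => h; [left|right] => t /hi [/h].
Qed.
End Decides.

Lemma germ b (A : M -> Prop) a : dset A ->
  exists e, rlt b a e /\ ((forall t, int b a e t -> A t) \/ (forall t, int b a e t -> ~ A t)).
Proof.
move=> dA; have [e ae] := dlo_above (R := rlt b) a.
apply: (decides_dset (ok := rlt b a) (B := int b a) (i0 := e)) => [//|i j ai aj|c|//].
  have [m [m1 m2 m3]] := dlo_min (R := rlt b) i j; exists m; split; first by case: m3 => ->.
  by move=> t [? ?]; split; split; dlo.
case: (classic (rlt b a c)) => h; [exists c|exists e]; split=> //.
  by case: (b) h => h; [right|left] => t [] //.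
by case: (b) h; rewrite /rlt => h; [left|right] => t [h1 h2]; rewrite /rlt in h1 h2; dlo.
Qed.

(** Definable completeness, put as a trichotomy (empty, unbounded, least upper bound) that passes to
    unions in [tame_ind]. *)
Definition sup_spec b (A : M -> Prop) :=
  [\/ forall x, ~ A x, forall a, exists x, A x /\ rlt b a x |
      exists s, (forall x, A x -> le (rlt b) x s) /\ forall u, rlt b u s -> exists x, A x /\ rlt b u x].
Lemma has_sup b (A : M -> Prop) : dset A -> sup_spec b A.
Proof.
move=> dA; elim/(tame_ind (b := b)): A / dA => [|c|lo hi|A B].
- by constructor 1 => x.
- by constructor 3; exists c; split=> [x ->|u h]; [right|exists c].
- set A := (fun x : M => _); rewrite /sup_spec.
  case: (classic (exists x, A x)) => [[x Ax]|h]; last by constructor 1 => x Ax; apply: h; exists x.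
  case: hi @A Ax => [c|] A [h1 h2].
    constructor 3; exists c; split=> [y [_ h]|u hu]; first by left.
    have [m [m1 m2 m3]] := dlo_max (R := rlt b) u x.
    have [y [hy1 hy2]] : exists y, rlt b m y /\ rlt b y c by apply: dlo_dense; case: m3 => ->.
    exists y; split; last by dlo.
    by split=> //; move: h1; case: (lo) => // l h1; dlo.
  constructor 2 => a; have [m [m1 m2 m3]] := dlo_max (R := rlt b) a x.
  have [y hy] := dlo_above (R := rlt b) m; exists y; split; last by dlo.
  by split=> //; move: h1; case: (lo) => // l h1; dlo.
- case=> [h1|h1|[s [h1 h2]]].
  + case=> [h2|h2|[s [h2 h3]]].
    * by constructor 1 => x []; [apply: h1|apply: h2].
    * by constructor 2 => a; have [x []] := h2 a; exists x; split=> //; right.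
    * constructor 3; exists s; split=> [x [/h1|/h2]|u /h3 [x []]] //.
      by exists x; split=> //; right.
  + by move=> _; constructor 2 => a; have [x []] := h1 a; exists x; split=> //; left.
  + case=> [h3|h3|[s' [h3 h4]]].
    * constructor 3; exists s; split=> [x [/h1|/h3]|u /h2 [x []]] //.
      by exists x; split=> //; left.
    * by constructor 2 => a; have [x []] := h3 a; exists x; split=> //; right.
    * have [m [m1 m2 m3]] := dlo_max (R := rlt b) s s'.
      constructor 3; exists m; split=> [x [/h1|/h3] h|u]; [dlo|dlo|].
      by case: m3 => -> => [/h2|/h4] [x []]; exists x; split=> //; [left|right].
Qed.

(** For definable sets, containing an interval is the same as being infinite, by
    [finite_or_infinite], and it is a first-order condition. *)
Definition infinite (A : M -> Prop) := exists p q, olt p q /\ forall t, olt p t -> olt t q -> A t.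

Lemma infiniteE b A : infinite A <-> exists p q, rlt b p q /\ forall t, int b p q t -> A t.
Proof.
by case: b; split=> -[p [q [h1 h2]]]; [exists q, p|exists q, p|exists p, q|exists p, q];
  split=> // t; rewrite /int /rlt /= => *; apply: h2 => //; tauto.
Qed.

Lemma finite_or_infinite (A : M -> Prop) : dset A -> infinite A \/ exists l : list M, forall x, A x -> List.In x l.
Proof.
move=> dA; elim/(tame_ind (b := false)): A / dA => [|c|lo hi|A B].
- by right; exists nil.
- by right; exists (cons c nil) => x ->; left.
- set A := (fun x : M => _).
  case: (classic (exists x, A x)) => [[x [h1 h2]]|h]; last by right; exists nil => x Ax; case: h; exists x.
  left; exists x; case: hi @A h2 => [c|] A h2.
    by exists c; split=> // t ht1 ht2; split=> //; move: h1; case: (lo) => // l h1; rewrite /rlt in h1 *; dlo.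
  have [c hc] := dlo_above (R := @olt S) x; exists c; split=> // t h3 h4.
  by split=> //; move: h1; case: (lo) => // l h1; rewrite /rlt in h1 *; dlo.
- case=> [[p [q [h h1]]]|[l hl]]; first by left; exists p, q; split=> // t *; left; apply: h1.
  case=> [[p [q [h h1]]]|[l' hl']]; first by left; exists p, q; split=> // t *; right; apply: h1.
  by right; exists (List.app l l') => x [/hl|/hl'] h; apply/List.in_app_iff; [left|right].
Qed.
End Line.
#[export] Hint Resolve dset_rlt : dd.
#[export] Hint Extern 0 (dlo (rlt _)) => (eapply dlo_rlt; eassumption) : typeclass_instances.
#[export] Hint Extern 0 (dlo (@olt _)) => (eapply dlo_olt; eassumption) : typeclass_instances.

(** * Connectedness of intervals and uniformity on the line *)

Section LineConsequences.
Variable S : ostruct.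
Hypothesis omin : ominimal S.
Local Notation M := (carrier S).

Lemma sup_exists b (A : M -> Prop) (x0 u0 : M) : dset A -> A x0 -> (forall x, A x -> le (rlt b) x u0) ->
  exists s, (forall x, A x -> le (rlt b) x s) /\ forall u, rlt b u s -> exists x, A x /\ rlt b u x.
Proof.
move=> dA A0 bd; case: (has_sup omin b dA) => [h|h|//]; first by case: (h x0).
by have [x [/bd h1 h2]] := h u0; exfalso; dlo.
Qed.

(** Connectedness of a closed interval, for definable [Q]: at the supremum of the points up to which
    [Q] holds throughout, the local condition pushes [Q] further. *)
Lemma interval_ind (a b : M) (Q : M -> Prop) : dset Q -> Q a ->
  (forall t, ole a t -> ole t b -> exists p q, [/\ olt p t, olt t q &
     forall u, olt p u -> olt u q -> ole a u -> ole u b -> (Q u <-> Q t)]) ->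
  forall t, ole a t -> ole t b -> Q t.
Proof.
move=> dQ Qa loc t0 at0 t0b; apply: NNPP => nQ.
pose A u := (ole a u /\ ole u t0) /\ forall v, ole a v -> ole v u -> Q v.
have dA : dset A by rewrite /A; dd.
have Aa : A a by split=> [|v h h']; [split=> //; right|suff -> : v = a by []; dlo].
have [|s [hs hs']] := @sup_exists false A a t0 dA Aa; first by move=> x [[_ h] _].
change (forall x, A x -> ole x s) in hs.
change (forall u, olt u s -> exists x, A x /\ olt u x) in hs'.
have as_ : ole a s by apply: hs.
have st : ole s t0 by apply: dlo_leP => h; have [x [[[_ h1] _] h2]] := hs' _ h; dlo.
have [|p [q [ps sq hpq]]] := loc s as_; first by dlo.
have Qv v : ole a v -> olt v s -> Q v.
  by move=> av vs; have [x [[_ hx] h]] := hs' _ vs; apply: hx => //; dlo.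
have Qs : Q s.
  case: (as_) => [as'|<- //]; have [m [m1 m2 m3]] := dlo_max (R := @olt S) a p.
  have [u [u1 u2]] : exists u, olt m u /\ olt u s by apply: dlo_dense; case: m3 => ->; dlo.
  by apply/(hpq u); [dlo|dlo|dlo|dlo|apply: Qv; dlo].
have st' : olt s t0 by case: st => // e; case: nQ; rewrite -e.
have [m [m1 m2 m3]] := dlo_min (R := @olt S) q t0.
have [w [w1 w2]] : exists w, olt s w /\ olt w m by apply: dlo_dense; case: m3 => ->; dlo.
suff /hs : A w by move=> h; dlo.
split=> [|v h1 h2]; first by split; dlo.
case: (dlo_total (R := @olt S) v s) => [h|[->|h]] //; first exact: Qv.
by apply/(hpq v) => //; dlo.
Qed.

Lemma injective_not_in_list (T : Type) (s : nat -> T) (l : list T) :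
  injective s -> ~ forall i, List.In (s i) l.
Proof.
move=> inj h.
have nd : List.NoDup (List.map s (List.seq 0 (length l).+1)).
  apply: FinFun.Injective_map_NoDup; last exact: List.seq_NoDup.
  by move=> x y; apply: inj.
have /(List.NoDup_incl_length nd) : List.incl (List.map s (List.seq 0 (length l).+1)) l.
  by move=> x /List.in_map_iff [i [<- _]].
by rewrite List.length_map List.length_seq => /leP; rewrite ltnn.
Qed.

(** The partner of saturation in all uniformity lemmas: a parameter that works along a sequence
    works on an interval. *)
Lemma infinite_of_seq (A : M -> Prop) (s : nat -> M) :
  dset A -> injective s -> (forall i, A (s i)) -> infinite A.
Proof.
move=> dA inj h; case: (finite_or_infinite omin dA) => // -[l hl].
by case: (@injective_not_in_list _ s l inj) => i; apply: hl.
Qed.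
Lemma rlt_seq b (p q : M) : rlt b p q -> exists s : nat -> M,
  (forall n m, n < m -> rlt b (s n) (s m)) /\ forall n, int b p q (s n).
Proof.
move=> pq.
have step (x : {x | int b p q x}) : {y : {y | int b p q y} | rlt b (sval x) (sval y)}.
  case: x => x [x1 x2]; have [y [y1 y2]] := constructive_indefinite_description _ (dlo_dense x2).
  have py : int b p q y by split; dlo.
  by exists (exist _ y py).
have [x0 hx0] := dlo_dense pq.
pose s := fix s n := match n with 0 => exist _ x0 hx0 | n'.+1 => sval (step (s n')) end.
exists (fun n => sval (s n)); split=> [n m|n]; last exact: svalP.
elim: m => [|m IH] //; rewrite ltnS leq_eqVlt => /orP [/eqP ->|/IH h'].
  exact: (svalP (step (s m))).
exact: dlo_trans h' (svalP (step (s m))).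
Qed.
Lemma rlt_seq_inj b (s : nat -> M) : (forall n m, n < m -> rlt b (s n) (s m)) -> injective s.
Proof.
move=> inc n m e; apply/eqP; rewrite eqn_leq; apply/andP; split; rewrite leqNgt; apply/negP => /inc;
  rewrite e => h'; exact: dlo_irr h'.
Qed.
Lemma infinite_not_list (A : M -> Prop) (l : list M) : infinite A -> ~ forall x, A x -> List.In x l.
Proof.
move=> [p [q [pq h]]] hl; have [s [inc hs]] := @rlt_seq false p q pq.
apply: (injective_not_in_list (rlt_seq_inj inc)) => i; apply: hl; have [h1 h2] := hs i; exact: h.
Qed.
Lemma infinite_sub (A B : M -> Prop) : (forall x, A x -> B x) -> infinite A -> infinite B.
Proof. by move=> sub [p [q [pq h]]]; exists p, q; split=> // t h1 h2; apply: sub; apply: h. Qed.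
Lemma infinite_or (A B : M -> Prop) : dset A -> dset B ->
  infinite (fun x => A x \/ B x) -> infinite A \/ infinite B.
Proof.
move=> dA dB iAB; case: (finite_or_infinite omin dA) => [|[l hl]]; first by left.
case: (finite_or_infinite omin dB) => [|[l' hl']]; first by right.
case: (@infinite_not_list _ (List.app l l') iAB) => x [/hl|/hl'] h; apply/List.in_app_iff; tauto.
Qed.
Lemma infinite_ex_ord k (A : 'I_k -> M -> Prop) : (forall i, dset (A i)) ->
  infinite (fun x => exists i, A i x) -> exists i, infinite (A i).
Proof.
elim: k A => [|k IH] A dA iA; first by have [p [q [pq h]]] := iA; have [c [h1 h2]] := dlo_dense pq; case: (h c h1 h2) => -[].
have : infinite (fun x => A ord0 x \/ exists i, A (lift ord0 i) x).
  apply: infinite_sub iA => x [i]; case: (unliftP ord0 i) => [j ->|->] h; [right; exists j|left] => //.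
have dE : dset (fun x => exists i, A (lift ord0 i) x) by apply: dset_exists_ord.
move/(infinite_or (dA ord0) dE) => [h|]; first by exists ord0.
by move/(IH _ (fun i => dA (lift ord0 i))) => [i h]; exists (lift ord0 i).
Qed.
Lemma infinite_int b (p q : M) : rlt b p q -> infinite (int b p q).
Proof. by move=> h; apply/(@infiniteE _ b); exists p, q; split. Qed.

Lemma finite_dset_min (A : M -> Prop) x0 : dset A -> ~ infinite A -> A x0 ->
  exists m, A m /\ forall x, A x -> ole m x.
Proof.
move=> dA nA A0; case: (finite_or_infinite omin dA) => // -[l hl].
suff [m [Am hm]] : exists m, A m /\ forall x, List.In x (cons x0 l) -> A x -> ole m x.
  by exists m; split=> // x Ax; apply: hm => //; right; apply: hl.
elim: l {hl} => [|a l [m [Am hm]]]; first by exists x0; split=> // x [->|[]] _; right.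
have hm0 : ole m x0 by apply: hm => //; left.
case: (classic (A a)) => Aa; last first.
  exists m; split=> // x [<-|[<- //|h]] Ax //; apply: hm => //; by right.
have [c [c1 c2 c3]] := dlo_min (R := @olt S) a m.
exists c; split; first by case: c3 => ->.
move=> x [<-|[<-|h]] Ax; [dlo|dlo|].
have mx : ole m x by apply: hm => //; right.
dlo.
Qed.

(** [a] is the last point outside [A] on the way from [y] to [x0]; as [A] is open, this supremum
    stays outside. *)
Lemma open_end (A : M -> Prop) x0 y : dset A ->
  (forall t, A t -> exists u v, (olt u t /\ olt t v) /\ forall s, olt u s -> olt s v -> A s) ->
  A x0 -> ~ A y ->
  exists b a, [/\ ~ A a, rlt b a x0 & forall t, rlt b a t -> le (rlt b) t x0 -> A t].
Proof.
move=> dA Aopen A0 nAy.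
have [b yx] : exists b, rlt b y x0.
  case: (dlo_total (R := @olt S) y x0) => [h|[h|h]]; [by exists false|by rewrite h in nAy|by exists true].
pose B t := ~ A t /\ rlt b t x0.
have dB : dset B by rewrite /B; dd.
have [||s [hs hs']] := @sup_exists b B y x0 dB; [by []|by move=> x [_ h]; left|].
have sx : le (rlt b) s x0.
  by apply: dlo_leP => h; have [x [[_ h1] h2]] := hs' _ h; dlo.
have nAs : ~ A s.
  move=> /Aopen [u [v [[h1 h2] h3]]].
  have [u' us hu'] : exists2 u', rlt b u' s & forall w, rlt b u' w -> le (rlt b) w s -> olt u w /\ olt w v.
    case: (b).
      by exists v => // w wv [sw|->]; split; dlo.
    by exists u => // w uw [ws|->]; split; dlo.
  have [x [[h4 h5] h6]] := hs' _ us; apply: (h4).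
  have [h7 h8] := hu' x h6 (hs x (conj h4 h5)).
  exact: h3.
exists b, s; split=> //; first by case: sx => // e; rewrite e in nAs.
by move=> t h1 [h2|->] //; apply: NNPP => h3; have h4 := hs t (conj h3 h2); dlo.
Qed.

Variable K : Type.
Hypotheses (uncK : uncountable K) (sat : saturated S K).

(* By saturation some member contains a whole infinite sequence. *)
Lemma directed_uniform (Y : Type) (cY : coded S Y) (X : Y -> M -> Prop) (I : M -> Prop) :
  dset (fun p : Y * M => X p.1 p.2) -> dset I ->
  (forall r r', exists r'', forall t, X r t \/ X r' t -> X r'' t) ->
  infinite I -> (forall t, I t -> exists r, X r t) ->
  exists r, infinite (fun t => I t /\ X r t).
Proof.
move=> dX dI dir [p [q [pq hI]]] cov.
have [s [inc hs]] := @rlt_seq false p q pq.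
have Is n : I (s n) by case: (hs n); apply: hI.
have [||r hr] := sat_fip_nat uncK sat (F := fun n r => X r (s n)).
- by move=> i; dd.
- elim=> [|n [r hr]]; first by have [r _] := cov _ (Is 0); exists r.
  have [r' hr'] := cov _ (Is n); have [r'' h] := dir r r'; exists r'' => k.
  by rewrite ltnS leq_eqVlt => /orP [/eqP ->|/hr h2]; apply: h; [right|left].
exists r; apply: (infinite_of_seq (s := s)); [|exact: rlt_seq_inj inc|by split].
by dd.
Qed.

(** Nested intervals: choose [t 0], [t 1], ... increasing below decreasing bounds [m 0], [m 1], ...
    with [Av (t n)] valid up to [m n]. Saturation gives a [y] between all [t n] and all [m n]. The
    set of points whose germ condition holds up to [y] is definable and contains every [t n], hence
    an interval. *)
Lemma germ_uniform b (Av : M -> M -> Prop) (p q : M) :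
  dset (fun z : M * M => Av z.1 z.2) -> rlt b p q ->
  (forall t, int b p q t -> exists e, rlt b t e /\ forall t', int b t e t' -> Av t t') ->
  exists p' q', [/\ le (rlt b) p p', rlt b p' q', le (rlt b) q' q &
    forall t t', rlt b p' t -> rlt b t t' -> rlt b t' q' -> Av t t'].
Proof.
move=> dAv pq hg.
pose ok (x : M * M) := [/\ rlt b p x.1, rlt b x.1 x.2, le (rlt b) x.2 q &
   forall t', int b x.1 x.2 t' -> Av x.1 t'].
have mk t m : rlt b p t -> rlt b t m -> le (rlt b) m q -> exists m', [/\ ok (t, m') , le (rlt b) m' m & rlt b t m'].
  move=> pt tm mq; have [|e [te he]] := hg t; first by split; dlo.
  have [c [c1 c2 c3]] := dlo_min (R := rlt b) m e; exists c.
  have tc : rlt b t c by case: c3 => ->.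
  by split=> //; split=> //= [|t' [h1 h2]]; [dlo|apply: he; split; dlo].
have step (x : {x | ok x}) : {y : {y | ok y} | rlt b (sval x).1 (sval y).1 /\ le (rlt b) (sval y).2 (sval x).2}.
  case: x => -[t m] [/= h1 h2 h3 h4]; apply: constructive_indefinite_description.
  have [t' [t1 t2]] := dlo_dense h2.
  have [||//|m' [o o1 o2]] := mk t' m; [by dlo|by []|].
  by exists (exist _ (t', m') o).
have [t0 [h1 h2]] := dlo_dense pq.
have [//|//||m0 [o0 _ _]] := mk t0 q; first by right.
pose s := fix s n := match n with 0 => exist _ (t0, m0) o0 | n'.+1 => sval (step (s n')) end.
pose t n := (sval (s n)).1; pose m n := (sval (s n)).2.
have okn n : ok (t n, m n) by rewrite /t /m; case: (s n) => -[].
have inc i j : i < j -> rlt b (t i) (t j) /\ le (rlt b) (m j) (m i).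
  elim: j => [|j IH] //; have [s1 s2] := svalP (step (s j)).
  rewrite ltnS leq_eqVlt => /orP [/eqP ->|/IH [h3 h4]]; first by split.
  by split; [apply: dlo_trans h3 s1|apply: dlo_lele s2 h4].
have tm i j : rlt b (t i) (m j).
  have [_ /= hi _ _] := okn i; have [_ /= hj _ _] := okn j.
  case: (ltngtP i j) => [/inc [? ?]|/inc [? ?]|e]; [dlo|dlo|by rewrite e].
have [||y hy] := sat_fip_nat uncK sat (F := fun n y => rlt b (t n) y /\ rlt b y (m n)).
- by move=> i; dd.
- move=> n; have [y [y1 y2]] := dlo_dense (tm n n); exists y => k kn.
  by have [? ?] := inc _ _ kn; split; dlo.
have : infinite (fun x => (rlt b p x /\ rlt b x y) /\ (rlt b y q /\ forall t', rlt b x t' -> rlt b t' y -> Av x t')).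
  apply: (infinite_of_seq (s := t)); first by dd.
    by apply: (@rlt_seq_inj b) => i j /inc [].
  move=> i; have [/= o1 o2 o3 o4] := okn i; have [y1 y2] := hy i; split; split=> //; first by dlo.
  by move=> t' h3 h4; apply: o4; split=> //=; dlo.
case/(@infiniteE _ b) => [p' [q' [pq' h']]]; exists p', q'.
split=> //.
- apply: dlo_leP => hh; have [m1 [m2 m3 m4]] := dlo_min (R := rlt b) p q'.
  have [z [z1 z2]] : exists z, rlt b p' z /\ rlt b z m1 by apply: dlo_dense; case: m4 => ->.
  by have [|[z3 _] _] := h' z; [split; dlo|dlo].
- apply: dlo_leP => hh; have [m1 [m2 m3 m4]] := dlo_max (R := rlt b) p' q.
  have [z [z1 z2]] : exists z, rlt b m1 z /\ rlt b z q' by apply: dlo_dense; case: m4 => ->.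
  by have [|[_ z3] [z4 _]] := h' z; [split; dlo|dlo].
move=> u u' h3 h4 h5; have [|[_ _] [_ h6]] := h' u; first by split; dlo.
have [|[_ h7] _] := h' u'; first by split; dlo.
exact: h6.
Qed.
End LineConsequences.

(** * Locally definable groups and their paths *)

Section GroupAlgebra.
Context {S : ostruct} {N : nat} (G : ldgroup S N).
Local Notation "x ** y" := (gmul G x y) (at level 40, left associativity).
(** The increment from [x] to [y]: it is invariant under left translations, and successive
    increments multiply. *)
Definition ldiv x y := gmul G (ginv G x) y.
Implicit Types x y z : pt S N.

Lemma ldiv_in x y : gset G x -> gset G y -> gset G (ldiv x y).
Proof. by move=> hx hy; apply: gmul_in => //; apply: ginv_in. Qed.
Local Hint Resolve gmul_in ginv_in gone_in ldiv_in : core.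
Lemma gmulVr x : gset G x -> x ** ginv G x = gone G.
Proof.
move=> hx; rewrite -[LHS](gmul1 (l := G)); auto.
rewrite -{1}(@gmulV _ _ G (ginv G x)); auto.
rewrite -gmulA; auto.
by rewrite (@gmulA _ _ G (ginv G x)) ?gmulV ?gmul1 ?gmulV; auto.
Qed.
Lemma gmulr1 x : gset G x -> x ** gone G = x.
Proof. by move=> hx; rewrite -{1}(gmulV hx) gmulA ?gmulVr ?gmul1; auto. Qed.
Lemma gmulK x y : gset G x -> gset G y -> ldiv x (x ** y) = y.
Proof. by move=> hx hy; rewrite /ldiv gmulA ?gmulV ?gmul1; auto. Qed.
Lemma ldivK x y : gset G x -> gset G y -> x ** ldiv x y = y.
Proof. by move=> hx hy; rewrite /ldiv gmulA ?gmulVr ?gmul1; auto. Qed.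
Lemma gmul_inj x y z : gset G x -> gset G y -> gset G z -> x ** y = x ** z -> y = z.
Proof. by move=> hx hy hz e; rewrite -(gmulK hx hy) e gmulK. Qed.
Lemma ldivxx x : gset G x -> ldiv x x = gone G.
Proof. exact: gmulV. Qed.
Lemma ldiv1x x : gset G x -> ldiv (gone G) x = x.
Proof. by move=> hx; rewrite -{2}(gmul1 hx) -[RHS](gmulK (gone_in G)) ?gmul1; auto. Qed.
Lemma gidem x : gset G x -> x ** x = x -> x = gone G.
Proof. by move=> hx e; apply: (@gmul_inj x) => //; rewrite gmulr1. Qed.
Lemma gmulKV x y : gset G x -> gset G y -> x ** y ** ginv G y = x.
Proof. by move=> hx hy; rewrite -gmulA ?gmulVr ?gmulr1; auto. Qed.
Lemma gmul_injr x y z : gset G x -> gset G y -> gset G z -> x ** z = y ** z -> x = y.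
Proof. by move=> hx hy hz e; rewrite -(gmulKV hx hz) e gmulKV. Qed.
Lemma ldiv_trans x y z : gset G x -> gset G y -> gset G z -> ldiv x y ** ldiv y z = ldiv x z.
Proof. by move=> hx hy hz; rewrite -gmulA ?ldivK; auto. Qed.
Lemma ldiv_eq x y z : gset G x -> gset G y -> gset G z -> x ** z = y -> ldiv x y = z.
Proof. by move=> hx hy hz <-; rewrite gmulK. Qed.
Lemma ldiv_mull g x y : gset G g -> gset G x -> gset G y -> ldiv (g ** x) (g ** y) = ldiv x y.
Proof. by move=> hg hx hy; apply: ldiv_eq; auto; rewrite -gmulA ?ldivK; auto. Qed.
Lemma ldiv_eq1 x y : gset G x -> gset G y -> ldiv x y = gone G -> x = y.
Proof. by move=> hx hy e; rewrite -[RHS](ldivK hx hy) e gmulr1. Qed.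
End GroupAlgebra.

Lemma ptcat_inj (S : ostruct) m n (x x' : pt S m) (y y' : pt S n) :
  ptcat x y = ptcat x' y' -> x = x' /\ y = y'.
Proof.
move=> e; split; first by rewrite -(lptK x y) e lptK.
by rewrite -(rptK x y) e rptK.
Qed.

Section GroupDefinability.
Variables (S : ostruct) (K : Type) (N : nat) (G : ldgroup S N).
Hypothesis omin : ominimal S.
Hypotheses (uncK : uncountable K) (sat : saturated S K).
Context {X : Type} {cX : coded S X}.

Lemma gmul_pieces : exists P : nat -> pt S N * pt S N * pt S N -> Prop,
  [/\ forall k, dset (P k),
      forall x y, gset G x -> gset G y -> exists k, P k (x, y, gmul G x y) &
      forall k x y z, P k (x, y, z) -> [/\ gset G x, gset G y & z = gmul G x y]].
Proof.
have [D [dD hD]] := gmul_ld G.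
exists (fun k p => D k (ptcat (ptcat p.1.1 p.1.2) p.2)); split.
- by move=> k; apply: Def_ext (dD k) => z /=; rewrite !ptcatK.
- by move=> x y hx hy; apply/hD; exists x, y.
- move=> k x y z /= h; have /hD [x' [y' [hx [hy]]]] : exists k, D k (ptcat (ptcat x y) z) by exists k.
  by move=> /ptcat_inj [/ptcat_inj [-> ->] ->].
Qed.

(** The graph of multiplication is only a countable union of definable sets; by saturation finitely
    many of them suffice over a definable domain. *)
Lemma gmul_dmapon (D : X -> Prop) (g h : X -> pt S N) : dmapon D g -> dmapon D h ->
  (forall x, D x -> gset G (g x)) -> (forall x, D x -> gset G (h x)) ->
  dmapon D (fun x => gmul G (g x) (h x)).
Proof.
move=> dg dh Gg Gh; have [P [dP P1 P2]] := gmul_pieces.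
have dD := dmapon_dom omin dg.
have dg' := dmap_ext omin (gone G) dD dg; have dh' := dmap_ext omin (gone G) dD dh.
set g' := ext_by _ _ _ in dg'; set h' := ext_by _ _ _ in dh'.
have cov x : D x -> exists k, (fun k x => exists z, P k (g' x, h' x, z)) k x.
  move=> Dx; have [k hk] := P1 _ _ (Gg _ Dx) (Gh _ Dx); exists k, (gmul G (g x) (h x)).
  by rewrite /g' /h' !ext_in.
have [|n hn] := sat_cover_nat omin uncK sat dD _ cov; first by move=> k; dd.
apply: (@dset_iff _ _ _ (fun p : X * pt S N => D p.1 /\ exists k, k < n /\ P k (g' p.1, h' p.1, p.2))).
  move=> [x z] /=; split=> [[Dx [k [kn]]]|[Dx ->]].
    by rewrite /g' /h' !ext_in // => /P2 [].
  split=> //; have [k [kn [z']]] := hn _ Dx; rewrite /g' /h' !ext_in // => hk; exists k.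
  by have [_ _ <-] := P2 _ _ _ _ hk.
apply: dset_and => //; first by dd.
apply: (dset_exists_lt omin n (P := fun k (p : X * pt S N) => P k (g' p.1, h' p.1, p.2))) => k.
by have dPk := dP k; dd.
Qed.

(** The inverse of [g x] is read off the graph of multiplication, as the solution [z] of
    [z ** g x = gone G]. *)
Lemma ginv_dmapon (D : X -> Prop) (g : X -> pt S N) : dmapon D g ->
  (forall x, D x -> gset G (g x)) -> dmapon D (fun x => ginv G (g x)).
Proof.
move=> dg Gg; have [P [dP P1 P2]] := gmul_pieces.
have dD := dmapon_dom omin dg.
have dg' := dmap_ext omin (gone G) dD dg.
set g' := ext_by _ _ _ in dg'.
have cov x : D x -> exists k, (fun k x => exists z, P k (z, g' x, gone G)) k x.
  move=> Dx; have [k hk] := P1 _ _ (ginv_in (Gg _ Dx)) (Gg _ Dx); exists k, (ginv G (g x)).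
  by rewrite /g' !ext_in // -(gmulV (Gg _ Dx)).
have [|n hn] := sat_cover_nat omin uncK sat dD _ cov; first by move=> k; dd.
have uniq k x z : D x -> P k (z, g x, gone G) -> z = ginv G (g x).
  move=> Dx /P2 [hz hx e]; apply: (@gmul_injr _ _ G _ _ (g x)) => //; first exact: ginv_in.
  by rewrite -e gmulV.
apply: (@dset_iff _ _ _ (fun p : X * pt S N => D p.1 /\ exists k, k < n /\ P k (p.2, g' p.1, gone G))).
  move=> [x z] /=; split=> [[Dx [k [kn]]]|[Dx ->]].
    by rewrite /g' !ext_in // => /uniq ->.
  split=> //; have [k [kn [z']]] := hn _ Dx; rewrite /g' !ext_in // => hk; exists k.
  by rewrite -(uniq _ _ _ Dx hk).
apply: dset_and => //; first by dd.
apply: (dset_exists_lt omin n (P := fun k (p : X * pt S N) => P k (p.2, g' p.1, gone G))) => k.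
by have dPk := dP k; dd.
Qed.
Lemma ldiv_dmapon (D : X -> Prop) (g h : X -> pt S N) : dmapon D g -> dmapon D h ->
  (forall x, D x -> gset G (g x)) -> (forall x, D x -> gset G (h x)) ->
  dmapon D (fun x => ldiv G (g x) (h x)).
Proof.
move=> dg dh Gg Gh; apply: gmul_dmapon => //; first exact: ginv_dmapon.
by move=> x /Gg; apply: ginv_in.
Qed.
End GroupDefinability.

Section Cuts.
Variable S : ostruct.
Hypothesis omin : ominimal S.
Local Notation M := (carrier S).

(** [Q] is a gap and need not be definable, so there is no supremum to look at. The intervals from a
    point of [Q] to a point outside still form a filter base as in [decides_family]. *)
Lemma cut_constant (Q : M -> Prop) x0 x1 : Q x0 -> ~ Q x1 ->
  (forall t u, Q t -> olt u t -> Q u) ->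
  (forall t, Q t -> exists u, olt t u /\ Q u) ->
  (forall t, ~ Q t -> exists u, olt u t /\ ~ Q u) ->
  forall k (A : 'I_k -> M -> Prop), (forall j, dset (A j)) -> exists q c, [/\ Q q, ~ Q c &
    forall j, (forall t, int false q c t -> A j t) \/ (forall t, int false q c t -> ~ A j t)].
Proof.
move=> Q0 Q1 dn nomax nomin k A dA.
have [|||[q c] [[h1 h2] h3]] := decides_family omin (ok := fun p => Q p.1 /\ ~ Q p.2)
  (B := fun p => int false p.1 p.2) (i0 := (x0, x1)) _ _ _ dA; last by exists q, c.
- by [].
- move=> [q1 c1] [q2 c2] [/= a1 b1] [a2 b2].
  have [q [m1 m2 m3]] := dlo_max (R := @olt S) q1 q2.
  have [c [l1 l2 l3]] := dlo_min (R := @olt S) c1 c2.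
  exists (q, c); split; first by split; [case: m3 => ->|case: l3 => ->].
  by move=> t [/= h h']; rewrite /int /rlt in h h' *; split; split; dlo.
move=> a; case: (classic (Q a)) => h.
  have [u [au Qu]] := nomax _ h; exists (u, x1); split=> //; right=> t [h1 _]; rewrite /rlt in h1; dlo.
have [u [au Qu]] := nomin _ h; exists (x0, u); split=> //; left=> t [_ h1]; rewrite /rlt /= in h1; dlo.
Qed.
End Cuts.

Section Paths.
Variables (S : ostruct) (N : nat) (G : ldgroup S N) (T : (pt S N -> Prop) -> Prop).
Hypothesis omin : ominimal S.
Hypothesis tau : is_tau_topology G T.
Local Notation M := (carrier S).
Local Notation "x ** y" := (gmul G x y) (at level 40, left associativity).
Local Hint Resolve gmul_in ginv_in gone_in ldiv_in : core.

Lemma open_setI O1 O2 : T O1 -> T O2 -> T (fun x => O1 x /\ O2 x).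
Proof. by case: tau => -[_ _ _ _ h] _ _ _; apply: h. Qed.
Lemma open_bigcup (F : (pt S N -> Prop) -> Prop) : (forall O, F O -> T O) -> T (fun x => exists O, F O /\ O x).
Proof. by case: tau => -[_ _ _ h _] _ _ _; apply: h. Qed.
Lemma open_gmul O x y : T O -> gset G x -> gset G y -> O (x ** y) ->
  exists O1 O2, [/\ T O1, T O2, O1 x, O2 y & forall u v, O1 u -> O2 v -> O (u ** v)].
Proof. by case: tau => _ h _ _; apply: h. Qed.
Lemma open_ginv O x : T O -> gset G x -> O (ginv G x) ->
  exists O', [/\ T O', O' x & forall u, O' u -> O (ginv G u)].
Proof. by case: tau => _ _ h _; apply: h. Qed.
Lemma open_ldiv O x y : T O -> gset G x -> gset G y -> O (ldiv G x y) ->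
  exists O1 O2, [/\ T O1, T O2, O1 x, O2 y & forall u v, O1 u -> O2 v -> O (ldiv G u v)].
Proof.
move=> hO hx hy h; have [O1 [O2 [h1 h2 h3 h4 h5]]] := open_gmul hO (ginv_in hx) hy h.
have [O' [k1 k2 k3]] := open_ginv h1 hx h3.
by exists O', O2; split=> // u v hu hv; apply: h5 => //; apply: k3.
Qed.
Lemma open_ldivxx O x : T O -> O (gone G) -> gset G x ->
  exists O', [/\ T O', O' x & forall u v, O' u -> O' v -> O (ldiv G u v)].
Proof.
move=> hO Oe hx; have [||||O1 [O2 [h1 h2 h3 h4 h5]]] := @open_ldiv O x x => //; first by rewrite ldivxx.
exists (fun u => O1 u /\ O2 u); split=> [||u v [hu _] [_ hv]] //; first exact: open_setI.
exact: h5.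
Qed.
Lemma open_transl O g x : T O -> gset G g -> gset G x -> O (g ** x) ->
  exists O', [/\ T O', O' x & forall u, O' u -> O (g ** u)].
Proof.
move=> hO hg hx h; have [O1 [O2 [h1 h2 h3 h4 h5]]] := open_gmul hO hg hx h.
by exists O2; split=> // u; apply: h5.
Qed.

Definition cont_on (a b : M) (g : M -> pt S N) :=
  forall t, ole a t -> ole t b -> forall O, T O -> O (g t) ->
    exists p q, [/\ olt p t, olt t q & forall u, olt p u -> olt u q -> ole a u -> ole u b -> O (g u)].
Definition gpath (a b : M) (g : M -> pt S N) :=
  [/\ olt a b, dmapon (fun t => ole a t /\ ole t b) g,
      (forall t, ole a t -> ole t b -> gset G (g t)) & cont_on a b g].

Lemma dset_ival (a b : M) : dset (fun t => ole a t /\ ole t b).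
Proof. by dd. Qed.

Lemma path_of_ldpath a b gam : ldpath G T a b gam -> gpath a b (fun t => gam (pt1 t)).
Proof.
move=> [ab ld hG hc]; split=> //.
- have dI : Def S (ival a b) by apply: Def_ext (dset_ival a b).
  have /(defmapP omin) h := ld _ dI (fun x h => h).
  apply: (dmapon_comp omin h (g := @pt1 S) (D := fun t => ole a t /\ ole t b)) => //.
  apply: (dmapon_dmap omin (dset_ival a b)).
  apply: dset_iff (_ : dset (fun p : M * pt S 1 => p.2 ord0 = p.1)) => [[t x]|]; last by dd.
  by split=> /= [<-|->] //; rewrite /pt1; symmetry; apply: (pt1K x).
- by move=> t h1 h2; apply: hG; split.
- move=> t h1 h2 O TO Ot; have [p [q [hpq h]]] := hc (pt1 t) (conj h1 h2) O TO Ot.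
  exists (p ord0), (q ord0); case: (hpq ord0) => h3 h4; split=> // u h5 h6 h7 h8.
  by apply: h; [split|move=> i; rewrite (ord1 i)].
Qed.
Lemma ldpath_of_path a b g : gpath a b g -> ldpath G T a b (fun x => g (x ord0)).
Proof.
move=> [ab dg hG hc]; split=> //.
- move=> D dD sub; apply/(defmapP omin).
  apply: (dmapon_comp omin dg (g := fun x : pt S 1 => x ord0)) => [|x /sub [] //].
  by apply: dmapon_dmap => //; ddm.
- by move=> t [h1 h2]; apply: hG.
- move=> x [h1 h2] O TO Ox; have [p [q [h3 h4 h5]]] := hc _ h1 h2 O TO Ox.
  exists (pt1 p), (pt1 q); split=> [i|y [h6 h7] hy]; first by rewrite (ord1 i).
  by apply: h5 => //; case: (hy ord0).
Qed.
Lemma path_const a b x : olt a b -> gset G x -> gpath a b (fun _ => x).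
Proof.
move=> ab hx; split=> //; first by apply: dmapon_dmap; [|exact: dset_ival|ddm].
move=> t _ _ O TO Ox; have [p hp] := dlo_below (R := @olt S) t; have [q hq] := dlo_above (R := @olt S) t.
by exists p, q.
Qed.
End Paths.

(** * Dimension *)

Section Insertion.
Variable S : ostruct.
Local Notation M := (carrier S).

Definition ins k (i : 'I_k.+1) (t : M) (w : pt S k) : pt S k.+1 :=
  fun j => if unlift i j is Some j' then w j' else t.
Definition del k (i : 'I_k.+1) (x : pt S k.+1) : pt S k := fun j => x (lift i j).
Lemma ins_at k i t (w : pt S k) : ins i t w i = t.
Proof. by rewrite /ins unlift_none. Qed.
Lemma ins_lift k i t (w : pt S k) j : ins i t w (lift i j) = w j.
Proof. by rewrite /ins liftK. Qed.
Lemma insK k (i : 'I_k.+1) x : ins i (x i) (del i x) = x.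
Proof.
apply: functional_extensionality => j; rewrite /ins.
by case: unliftP => [j' ->|->].
Qed.
Lemma del_ins k i t (w : pt S k) : del i (ins i t w) = w.
Proof. by apply: functional_extensionality => j; rewrite /del ins_lift. Qed.
Lemma ins_inj k i t t' (w w' : pt S k) : ins i t w = ins i t' w' -> t = t' /\ w = w'.
Proof.
move=> e; split; first by rewrite -(ins_at i t w) e ins_at.
by rewrite -(del_ins i t w) e del_ins.
Qed.
Lemma pt0_eq (x y : pt S 0) : x = y.
Proof. by apply: functional_extensionality => -[]. Qed.

Hypothesis omin : ominimal S.
Lemma dmap_ins k (i : 'I_k.+1) : dmap (fun p : M * pt S k => ins i p.1 p.2).
Proof.
apply: (dmap_cmap omin).
exists (fun j => if unlift i j is Some j' then rshift 1 j' else lshift k ord0) => -[t w] j /=.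
by rewrite /ins; case: unliftP => [j' _|_]; rewrite ?(ptcatr (m := 1)) ?(ptcatl (m := 1)).
Qed.
Definition subpt m n (s : 'I_m -> 'I_n) (x : pt S n) : pt S m := fun j => x (s j).
Lemma dmap_subpt m n (s : 'I_m -> 'I_n) : dmap (@subpt m n s).
Proof. by apply: (dmap_cmap omin); exists s. Qed.
Lemma dmap_del k (i : 'I_k.+1) : dmap (@del k i).
Proof. exact: (dmap_subpt (lift i)). Qed.
Lemma dset_box k : dset (fun p : pt S k * pt S k * pt S k => box p.1.1 p.1.2 p.2).
Proof. by rewrite /box; dd. Qed.
End Insertion.
#[export] Hint Resolve dmap_ins dmap_del dset_box : dd.

(** Full dimension in [M^k]; for [k = 0] it means nonempty. *)
Definition has_int {S : ostruct} {k} (P : pt S k -> Prop) :=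
  exists a b : pt S k, (forall i, olt (a i) (b i)) /\ forall y, box a b y -> P y.

(** * Sets with nonempty interior *)

Section Interior.
Variables (S : ostruct) (K : Type).
Hypothesis omin : ominimal S.
Hypotheses (uncK : uncountable K) (sat : saturated S K).
Local Notation M := (carrier S).

Lemma dset_has_int (X : Type) (cX : coded S X) k (P : X -> pt S k -> Prop) :
  dset (fun p : X * pt S k => P p.1 p.2) -> dset (fun x => has_int (P x)).
Proof. by move=> dP; rewrite /has_int; dd. Qed.
Lemma has_int_sub k (P Q : pt S k -> Prop) : (forall x, P x -> Q x) -> has_int P -> has_int Q.
Proof. by move=> sub [a [b [h1 h2]]]; exists a, b; split=> // y /h2; apply: sub. Qed.

Lemma dset_in_list (T : Type) (B : T -> M -> Prop) (l : list T) :
  (forall z, dset (B z)) -> dset (fun x => exists z, List.In z l /\ B z x).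
Proof.
move=> dB; elim: l => [|z l IH].
  by apply: (@dset_iff _ _ _ (fun _ : M => False)) => [x|]; [split=> // -[z []]|dd].
have dz := dB z.
apply: (@dset_iff _ _ _ (fun x => B z x \/ exists z, List.In z l /\ B z x)); last by dd.
move=> x; split=> [[h|[z' [h1 h2]]]|[z' [[<-|h1] h2]]].
- by exists z; split=> //; left.
- by exists z'; split=> //; right.
- by left.
- by right; exists z'.
Qed.
Lemma infinite_cover_list (T : Type) (B : T -> M -> Prop) (l : list T) (A : M -> Prop) :
  (forall z, dset (B z)) -> infinite A -> (forall x, A x -> exists z, List.In z l /\ B z x) ->
  exists z, List.In z l /\ infinite (B z).
Proof.
move=> dB iA cov.
have {iA cov} : infinite (fun x => exists z, List.In z l /\ B z x) by exact: infinite_sub cov iA.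
elim: l => [|z l IH] h.
  by have [p [q [pq h']]] := h; have [c [h1 h2]] := dlo_dense pq; have [z [[]]] := h' c h1 h2.
have h' : infinite (fun x => B z x \/ exists z, List.In z l /\ B z x).
  apply: infinite_sub h => x [z' [[<-|h1] h2]]; [by left|by right; exists z'].
case: (infinite_or omin (dB z) (dset_in_list l dB) h') => [iz|/IH [z' [h1 h2]]].
  by exists z; split=> //; left.
by exists z'; split=> //; right.
Qed.

(* If no point is an endpoint of infinitely many fibres, sending an endpoint to the least fibre it
   belongs to gives a finite-to-one function to which [germ_uniform] applies. *)
Lemma common_interval (X : M -> M -> Prop) (I : M -> Prop) :
  dset (fun p : M * M => X p.1 p.2) -> dset I -> infinite I -> (forall z, I z -> infinite (X z)) ->
  exists p q, olt p q /\ infinite (fun z => I z /\ forall t, int false p q t -> X z t).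
Proof.
move=> dX dI iI iX.
pose Xo z t := exists u v, (olt u t /\ olt t v) /\ forall w, olt u w -> olt w v -> X z w.
have dXo : dset (fun p : M * M => Xo p.1 p.2) by rewrite /Xo; dd.
have XoX z t : Xo z t -> X z t by move=> [u [v [[h1 h2] h]]]; apply: h.
(* [a] is an endpoint, on the side [b], of the interior of the fibre over [z]. *)
pose E b z a := ~ Xo z a /\ exists e, rlt b a e /\ forall t, rlt b a t -> rlt b t e -> Xo z t.
have dE b : dset (fun p : M * M => E b p.1 p.2) by rewrite /E; dd.
have alt z : I z -> (forall t, Xo z t) \/ ((exists a, E false z a) \/ exists a, E true z a).
  move=> Iz; have [p [q [pq hX]]] := iX z Iz; have [x0 [px0 x0q]] := dlo_dense pq.
  have X0 : Xo z x0 by exists p, q.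
  apply: NNPP => hn; case: (classic (exists y, ~ Xo z y)) => [[y ny]|]; last first.
    by move=> h; apply: hn; left=> t; apply: NNPP => ht; apply: h; exists t.
  have dXz : dset (Xo z) by apply: (dset_comp omin (g := fun t => (z, t)) dXo); ddm.
  have opn t : Xo z t -> exists u v, (olt u t /\ olt t v) /\ forall s, olt u s -> olt s v -> Xo z s.
    by move=> [u [v [uv h]]]; exists u, v; split=> // s h1 h2; exists u, v.
  have [b [a [na ax hax]]] := open_end omin dXz opn X0 ny.
  suff Ea : E b z a by apply: hn; right; case: b {ax hax} Ea => Ea; [right|left]; exists a.
  by split=> //; exists x0; split=> // t h1 h2; apply: hax => //; left.
have iAlt : infinite (fun z => (I z /\ forall t, Xo z t) \/ ((I z /\ exists a, E false z a) \/ (I z /\ exists a, E true z a))).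
  by apply: infinite_sub iI => z Iz; case: (alt z Iz) => [?|[?|?]]; tauto.
have dE0 := dE false; have dE1 := dE true.
case/(infinite_or omin) : iAlt; [by dd|by dd| |].
  move=> ii; have [d _] := omin; case: d => p; have [q pq] := dlo_above (R := @olt S) p.
  exists p, q; split=> //; apply: infinite_sub ii => z [Iz hz]; split=> // t _; exact: XoX.
move=> ii.
have {ii} [b iE] : exists b, infinite (fun z => I z /\ exists a, E b z a).
  by case/(infinite_or omin) : ii; [dd|dd|exists false|exists true].
have dEb := dE b.
have finE z : ~ infinite (E b z).
  move=> /(@infiniteE _ b) [u [v [uv h]]]; have [a [ua av]] := dlo_dense uv.
  have [|_ [e [ae he]]] := h a; first by split.
  have [m [m1 m2 m3]] := dlo_min (R := rlt b) e v.
  have [t [at_ tm]] : exists t, rlt b a t /\ rlt b t m by apply: dlo_dense; case: m3 => ->.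
  have [|nt _] := h t; first by split; dlo.
  by apply: nt; apply: he => //; dlo.
suff [p [q [pq ii]]] : exists p q, rlt b p q /\ infinite (fun z => I z /\ forall t, int b p q t -> X z t).
  by case: b {dEb finE iE} pq ii => pq ii; [exists q, p|exists p, q]; split=> //;
   apply: infinite_sub ii => z [Iz h]; split=> // t [h1 h2]; apply: h; split.
(* If infinitely many fibres share the endpoint [a], only the other end varies, and shrinking it
   gives a directed family. *)
case: (classic (exists a, infinite (fun z => I z /\ E b z a))) => [[a ia]|nall].
  have [||||e ie] := @directed_uniform _ omin _ uncK sat M _
    (fun e z => rlt b a e /\ forall t, rlt b a t -> rlt b t e -> X z t) (fun z => I z /\ E b z a) _ _ _ ia.
  - by dd.
  - by dd.
  - move=> r r'; case: (classic (rlt b a r)) => ar; last by exists r' => t [[]|].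
    case: (classic (rlt b a r')) => ar'; last by exists r => t [|[]].
    have [m [m1 m2 m3]] := dlo_min (R := rlt b) r r'; exists m => t h; split; first by case: m3 => ->.
    by move=> t' h1 h2; case: h => -[_ h]; apply: h => //; dlo.
  - by move=> z [_ [_ [e [ae he]]]]; exists e; split=> // t *; apply: XoX; apply: he.
  have [z0 z1] := ie; exists a, e; split.
    have [q' [pq h]] := z1; have [c [h1 h2]] := dlo_dense pq; by have [_ []] := h c h1 h2.
  by apply: infinite_sub ie => z [[Iz _] [_ h]]; split=> // t [h1 h2]; apply: h.
pose A a := exists z, I z /\ E b z a.
have dA : dset A by rewrite /A; dd.
have iA : infinite A.
  case: (finite_or_infinite omin dA) => // -[l hl].
  have [||a [_ ia]] := @infinite_cover_list M (fun a z => I z /\ E b z a) l _ _ iE.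
  - by move=> a; dd.
  - by move=> z [Iz [a Ea]]; exists a; split=> //; apply: hl; exists z.
  by case: nall; exists a.
pose Zt a z := (I z /\ E b z a) /\ forall z', I z' /\ E b z' a -> ole z z'.
have dZt : dset (fun p : M * M => Zt p.1 p.2) by rewrite /Zt; dd.
have Ztex a : A a -> exists z, Zt a z.
  move=> [z hz]; have [||m [hm1 hm2]] := @finite_dset_min _ omin (fun z => I z /\ E b z a) z _ _ hz.
  - by dd.
  - by move=> ii; apply: nall; exists a.
  by exists m.
have [p [q [pq hA]]] := (@infiniteE _ b A).1 iA.
have [||p' [q' [pp pq' qq hAv]]] := @germ_uniform _ omin _ uncK sat b (fun a t => exists z, Zt a z /\ X z t) p q _ pq.
- by dd.
- move=> a ia; have [z hz] := Ztex a (hA a ia); have [[_ [_ [e [ae he]]]] _] := hz.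
  by exists e; split=> // t [h1 h2]; exists z; split=> //; apply: XoX; apply: he.
(* Every [a] before [m] is an endpoint of some fibre that contains the interval from [m] to [q']. If
   only finitely many fibres contained it, one of them would have infinitely many endpoints. *)
have [m [pm mq]] := dlo_dense pq'.
exists m, q'; split=> //.
have dZ2 : dset (fun z => I z /\ forall t, int b m q' t -> X z t) by rewrite /int; dd.
case: (finite_or_infinite omin dZ2) => // -[l hl].
have im : infinite (int b p' m) by exact: infinite_int.
have [||z [_ iz]] := @infinite_cover_list M (fun z a => E b z a) l _ _ im.
- by move=> z; dd.
- move=> a [pa am]; have [|z hz] := Ztex a; first by apply: hA; split; dlo.
  exists z; split; last by case: hz => -[].
  apply: hl; split=> [|t [h1 h2]]; first by case: hz => -[].
  have lt_at : rlt b a t by dlo.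
  have [z' [hz' Xz']] := hAv a t pa lt_at h2.
  suff -> : z = z' by [].
  case: hz hz' => h3 h4 [h5 h6]; have h7 := h4 _ h5; have h8 := h6 _ h3; dlo.
by case: (finE z).
Qed.

(** The ends are made uniform in turn. For each [z] the admissible left ends contain an interval, so
    [common_interval] fixes [p]; the right ends for this [p] then form a directed family. *)
Lemma uniform_interval (E : M -> M -> M -> Prop) (I : M -> Prop) :
  dset (fun p : M * M * M => E p.1.1 p.1.2 p.2) -> dset I -> infinite I ->
  (forall z p q p' q', E z p q -> ole p p' -> olt p' q' -> ole q' q -> E z p' q') ->
  (forall z, I z -> exists p q, olt p q /\ E z p q) ->
  exists p q, olt p q /\ infinite (fun z => I z /\ E z p q).
Proof.
move=> dE dI iI mono ex.
have [||p1 [p2 [p12 i1]]] := @common_interval (fun z p => exists q, olt p q /\ E z p q) I _ dI iI.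
- by dd.
- move=> z /ex [p [q [pq h]]]; exists p, q; split=> // t pt tq; exists q; split=> //.
  by apply: mono h _ _ _ => //; [left|right].
have [p [h1 h2]] := dlo_dense p12.
have [||||q iq] := @directed_uniform _ omin _ uncK sat M _ (fun q z => olt p q /\ E z p q)
   (fun z => I z /\ forall t, int false p1 p2 t -> exists q, olt t q /\ E z t q) _ _ _ i1.
- by dd.
- by rewrite /int; dd.
- move=> r r'; case: (classic (olt p r)) => ar; last by exists r' => t [[]|].
  case: (classic (olt p r')) => ar'; last by exists r => t [|[]].
  have [m [m1 m2 m3]] := dlo_min (R := @olt S) r r'.
  have pm : olt p m by case: m3 => ->.
  exists m => t h; split=> //.
  by case: h => -[_ h]; apply: mono h _ _ _ => //; right.
- by move=> z [_ h]; apply: h; split.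
exists p, q; split; last by apply: infinite_sub iq => z [[Iz _] [_ h]].
by have [u [v [uv h]]] := iq; have [c [h3 h4]] := dlo_dense uv; have [_ []] := h c h3 h4.
Qed.

Lemma box_ins k (i : 'I_k.+1) p q t (a b w : pt S k) :
  box (ins i p a) (ins i q b) (ins i t w) <-> (olt p t /\ olt t q) /\ box a b w.
Proof.
split=> [h|[h1 h2] j].
  by split=> [|j]; [have := h i; rewrite !ins_at|have := h (lift i j); rewrite !ins_lift].
by case: (unliftP i j) => [j' ->|->]; rewrite ?ins_lift ?ins_at //; apply: h2.
Qed.
Lemma lt_ins k (i : 'I_k.+1) p q (a b : pt S k) : olt p q -> (forall j, olt (a j) (b j)) ->
  forall j, olt (ins i p a j) (ins i q b j).
Proof.
by move=> h1 h2 j; case: (unliftP i j) => [j' ->|->]; rewrite ?ins_lift ?ins_at.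
Qed.

(** Induction on [k]: [uniform_interval] fixes the side along the first coordinate, with the
    remaining coordinates hidden in [has_int], and the induction hypothesis fixes the other
    sides. *)
Lemma uniform_box k (X : M -> pt S k -> Prop) (I : M -> Prop) :
  dset (fun p : M * pt S k => X p.1 p.2) -> dset I -> infinite I ->
  (forall z, I z -> has_int (X z)) ->
  exists a b, (forall i, olt (a i) (b i)) /\ infinite (fun z => I z /\ forall y, box a b y -> X z y).
Proof.
elim: k X I => [|k IH] X I dX dI iI hX.
  have [z0 _] := iI; exists (fun _ => z0), (fun _ => z0); split=> [[]|] //.
  apply: infinite_sub iI => z Iz; split=> // y _; have [a [b [_ h]]] := hX z Iz.
  by apply: h => -[].
have dX1 : dset (fun q : M * M * M * pt S k => forall t, olt q.1.1.2 t -> olt t q.1.2 -> X q.1.1.1 (ins ord0 t q.2)) by dd.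
have dX2 := dset_has_int (P := fun (q : M * M * M) w => forall t, olt q.1.2 t -> olt t q.2 -> X q.1.1 (ins ord0 t w)) dX1.
have [||p [q [pq ipq]]] := @uniform_interval
   (fun z p q => has_int (fun w => forall t, olt p t -> olt t q -> X z (ins ord0 t w))) I dX2 dI iI.
- move=> z p q p' q' h1 h2 h3 h4; apply: has_int_sub h1 => w h t h5 h6; apply: h; dlo.
- move=> z /hX [a [b [h1 h2]]]; exists (a ord0), (b ord0); split=> //.
  exists (del ord0 a), (del ord0 b); split=> [i|w hw t h3 h4]; first exact: h1.
  by apply: h2; rewrite -(insK ord0 a) -(insK ord0 b); apply/box_ins.
have [|||a [b [h1 h2]]] := IH (fun z w => forall t, olt p t -> olt t q -> X z (ins ord0 t w)) _ _ _ ipq.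
- by dd.
- apply: dset_and => //; apply: (dset_comp omin (g := fun z : M => (z, p, q)) dX2); ddm.
- by move=> z [].
exists (ins ord0 p a), (ins ord0 q b); split; first exact: lt_ins.
apply: infinite_sub h2 => z [[Iz _] h]; split=> // y; rewrite -(insK ord0 y) => /box_ins [[h3 h4] h5].
exact: h.
Qed.

(** A Fubini principle: the nontrivial direction needs one box common to infinitely many slices,
    from [uniform_box]. It carries facts about the line to [M^k] by induction. *)
Lemma has_int_fibre k (P : pt S k.+1 -> Prop) : dset P ->
  infinite (fun t => has_int (fun w => P (ins ord0 t w))) <-> has_int P.
Proof.
move=> dP.
have dP1 : dset (fun q : M * pt S k => P (ins ord0 q.1 q.2)) by dd.
split=> [h|[a [b [h1 h2]]]].
  have [a [b [h1 h2]]] := uniform_box dP1 (dset_has_int (P := fun t w => P (ins ord0 t w)) dP1) h (fun z h => h).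
  have [p [q [pq h3]]] := h2; exists (ins ord0 p a), (ins ord0 q b); split; first exact: lt_ins.
  by move=> y; rewrite -(insK ord0 y) => /box_ins [[h4 h5] h6]; apply: (h3 _ h4 h5).2.
exists (a ord0), (b ord0); split=> // t h3 h4; exists (del ord0 a), (del ord0 b); split=> [i|w hw].
  exact: h1.
by apply: h2; rewrite -(insK ord0 a) -(insK ord0 b); apply/box_ins.
Qed.

Lemma has_int_or k (P Q : pt S k -> Prop) : dset P -> dset Q ->
  has_int (fun x => P x \/ Q x) -> has_int P \/ has_int Q.
Proof.
elim: k P Q => [|k IH] P Q dP dQ.
  move=> [a [b [h1 h2]]]; have [] := h2 a; first by case.
    by left; exists a, b; split=> // y _; rewrite (pt0_eq y a).
  by right; exists a, b; split=> // y _; rewrite (pt0_eq y a).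
have dP1 : dset (fun q : M * pt S k => P (ins ord0 q.1 q.2)) by dd.
have dQ1 : dset (fun q : M * pt S k => Q (ins ord0 q.1 q.2)) by dd.
move/(has_int_fibre (dset_or omin dP dQ)) => h.
have h' : infinite (fun t => has_int (fun w => P (ins ord0 t w)) \/ has_int (fun w => Q (ins ord0 t w))).
  apply: infinite_sub h => t; apply: IH; dd.
case: (infinite_or omin (dset_has_int (P := fun t w => P (ins ord0 t w)) dP1) (dset_has_int (P := fun t w => Q (ins ord0 t w)) dQ1) h').
  by left; apply/has_int_fibre.
by right; apply/has_int_fibre.
Qed.
Lemma has_int_forall k n (P : pt S k -> Prop) (Q : 'I_n -> pt S k -> Prop) : dset P -> (forall i, dset (Q i)) ->
  has_int P -> (forall i, ~ has_int (fun x => P x /\ ~ Q i x)) -> has_int (fun x => P x /\ forall i, Q i x).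
Proof.
elim: n Q => [|n IH] Q dP dQ hP hQ; first by apply: has_int_sub hP => x Px; split=> // -[].
have {}IH := IH (fun i => Q (lift ord0 i)) dP (fun i => dQ (lift ord0 i)) hP (fun i => hQ (lift ord0 i)).
have dQ0 := dQ ord0.
have dQ1 i : dset (Q (lift ord0 i)) by exact: dQ.
have h : has_int (fun x => ((P x /\ forall i, Q (lift ord0 i) x) /\ Q ord0 x) \/ (P x /\ ~ Q ord0 x)).
  by apply: has_int_sub IH => x [h1 h2]; case: (classic (Q ord0 x)) => h3; [left|right].
case/has_int_or: h.
- by apply: dset_and => //; apply: dset_and => //; apply: dset_forall_ord.
- by dd.
- by apply: has_int_sub => x [[h1 h2] h3]; split=> // i; case: (unliftP ord0 i) => [j ->|->].
by move/hQ.
Qed.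

(** Counterpart of [uniform_box]: here the parameter has [k] coordinates and the fibres lie on the
    line. *)
Lemma uniform_fibre_interval k (P : pt S k -> M -> Prop) (W : pt S k -> Prop) :
  dset (fun p : pt S k * M => P p.1 p.2) -> dset W -> has_int W -> (forall w, W w -> infinite (P w)) ->
  exists p q, olt p q /\ has_int (fun w => W w /\ forall c, olt p c -> olt c q -> P w c).
Proof.
elim: k P W => [|k IH] P W dP dW hW iP.
  have [a [b [h1 h2]]] := hW; have [|p [q [pq h]]] := iP a; first by apply: h2 => -[].
  exists p, q; split=> //; exists a, b; split=> // y _; rewrite (pt0_eq y a); split=> //.
  by apply: h2 => -[].
have dW1 : dset (fun q : M * pt S k => W (ins ord0 q.1 q.2)) by dd.
have dI := dset_has_int (P := fun t w => W (ins ord0 t w)) dW1.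
have dX1 : dset (fun q : M * M * M * pt S k => W (ins ord0 q.1.1.1 q.2) /\ forall c, olt q.1.1.2 c -> olt c q.1.2 -> P (ins ord0 q.1.1.1 q.2) c) by dd.
have dX2 := dset_has_int (P := fun (q : M * M * M) w => W (ins ord0 q.1.1 w) /\ forall c, olt q.1.2 c -> olt c q.2 -> P (ins ord0 q.1.1 w) c) dX1.
have [|||p [q [pq ipq]]] := @uniform_interval
   (fun z p q => has_int (fun w => W (ins ord0 z w) /\ forall c, olt p c -> olt c q -> P (ins ord0 z w) c)) _ dX2 dI.
- exact/has_int_fibre.
- move=> z p q p' q' h1 h2 h3 h4; apply: has_int_sub h1 => w [hw h]; split=> // t h5 h6; apply: h; dlo.
- move=> z hz; apply: (IH (fun w c => P (ins ord0 z w) c) (fun w => W (ins ord0 z w))) => //.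
  + by dd.
  + by dd.
  + by move=> w; apply: iP.
exists p, q; split=> //; apply/has_int_fibre; first by dd.
by apply: infinite_sub ipq => z [].
Qed.
End Interior.

(** * Injective definable maps do not lower dimension *)

Section Dimension.
Variables (S : ostruct) (K : Type).
Hypothesis omin : ominimal S.
Hypotheses (uncK : uncountable K) (sat : saturated S K).
Local Notation M := (carrier S).

Lemma infinite_ex_fin (F : finType) (B : F -> M -> Prop) : (forall s, dset (B s)) ->
  infinite (fun x => exists s, B s x) -> exists s, infinite (B s).
Proof.
move=> dB h.
have [i hi] : exists i : 'I_#|F|, infinite (B (enum_val i)).
  apply: (infinite_ex_ord omin) => [i|]; first exact: dB.
  by apply: infinite_sub h => x [s Bs]; exists (enum_rank s); rewrite enum_rankK.
by exists (enum_val i).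
Qed.

Lemma infinite_of_all_fibres (P : M -> M -> Prop) p q : dset (fun z : M * M => P z.1 z.2) -> olt p q ->
  (forall c, ~ infinite (fun t => P t c)) -> (forall t, olt p t -> olt t q -> exists c, P t c) ->
  infinite (fun c => exists t, (olt p t /\ olt t q) /\ P t c).
Proof.
move=> dP pq nf ex.
have dA : dset (fun c => exists t, (olt p t /\ olt t q) /\ P t c) by dd.
case: (finite_or_infinite omin dA) => // -[l hl].
have im : infinite (int false p q) by exact: infinite_int.
have [||c [_ ic]] := @infinite_cover_list _ omin M (fun c t => P t c) l _ _ im.
- by move=> c; dd.
- move=> t [h1 h2]; have [c hc] := ex t h1 h2; exists c; split=> //; apply: hl; exists t; split=> //.
by case: (nf c).
Qed.

(** The coordinates of [x] are replaced by those of [y] one at a time, and every intermediate point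
    stays in the box. *)
Lemma box_ind k (P : pt S k -> Prop) a b x y :
  (forall z i s, box a b z -> olt (a i) s -> olt s (b i) -> P z -> P (fun j => if j == i then s else z j)) ->
  box a b x -> box a b y -> P x -> P y.
Proof.
move=> step hx hy Px; pose hyb n : pt S k := fun j => if (j : nat) < n then y j else x j.
have -> : y = hyb k by apply: functional_extensionality => j; rewrite /hyb ltn_ord.
have : k <= k by []; move: {-2}k; elim=> [|n IH] nk //.
have [h1 h2] := hy (Ordinal nk).
have -> : hyb n.+1 = fun j => if j == Ordinal nk then y (Ordinal nk) else hyb n j.
  apply: functional_extensionality => j; rewrite /hyb ltnS leq_eqVlt -[j == Ordinal nk]val_eqE /=.
  by case: eqP => // e; congr y; apply: val_inj.
apply: step (IH (ltnW nk)) => // j; rewrite /hyb; case: ifP => _; [exact: hy|exact: hx].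
Qed.

Lemma constant_on_box k (th : pt S k -> M) a b : dmap th ->
  (forall x, box a b x -> forall i, exists u v, (olt u (x i) /\ olt (x i) v) /\
     forall y, (forall j, j != i -> y j = x j) -> olt u (y i) -> olt (y i) v -> th y = th x) ->
  forall x y, box a b x -> box a b y -> th x = th y.
Proof.
move=> dth loc x y hx hy; symmetry.
apply: (box_ind (P := fun z => th z = th x)) hx hy _ => // z i s hz as_ sb <-.
pose W t : pt S k := fun j => if j == i then t else z j.
have Wbox t : olt (a i) t -> olt t (b i) -> box a b (W t).
  by move=> h1 h2 j; rewrite /W; case: eqP => [->|_] //; apply: hz.
have dW : dmap W.
  apply: (@dset_iff _ _ _ (fun p : M * pt S k => p.2 i = p.1 /\ forall j, j != i -> p.2 j = z j)).
    move=> [t v] /=; split=> [[h1 h2]|->]; last by split; [rewrite /W eqxx|move=> j /negPf h; rewrite /W h].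
    by apply: functional_extensionality => j; rewrite /W; case: eqP => [->|/eqP /h2].
  apply: dset_and => //; first by dd.
  apply: dset_forall_ord => // j; case: (j != i); last by apply: dset_iff (dset_true omin) => p.
  by apply: (@dset_iff _ _ _ (fun p : M * pt S k => p.2 j = z j)) => [p|]; [split=> // h; apply: h|dd].
have Wz : W (z i) = z by apply: functional_extensionality => j; rewrite /W; case: eqP => [->|].
have [hz1 hz2] := hz i.
have [m [m1 m2 m3]] := dlo_min (R := @olt S) s (z i).
have [m' [l1 l2 l3]] := dlo_max (R := @olt S) s (z i).
have am : olt (a i) m by case: m3 => ->.
have mb : olt m' (b i) by case: l3 => ->.
have dQ : dset (fun t => th (W t) = th (W m)) by dd.
have key : forall t, ole m t -> ole t m' -> th (W t) = th (W m).
  apply: (interval_ind omin dQ) => // t h1 h2.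
  have at_ : olt (a i) t by dlo.
  have tb : olt t (b i) by dlo.
  have [u [v [[h3 h4] h5]]] := loc _ (Wbox t at_ tb) i.
  rewrite /W eqxx in h3 h4; exists u, v; split=> // t' h6 h7 _ _.
  rewrite (h5 (W t')) //; last by rewrite /W eqxx. by move=> j /negPf h; rewrite /W h.
  by rewrite /W eqxx.
by rewrite -[LHS]/(th (W s)) (key s) // -(key (z i)) // Wz.
Qed.

(* Induction on N, slicing the image along its first coordinate. *)
Lemma injection_projection N k (B : pt S k -> Prop) (Th : pt S k -> pt S N) (D : pt S N -> Prop) :
  dset B -> dmap Th -> dset D -> has_int B ->
  (forall x y, B x -> B y -> Th x = Th y -> x = y) -> (forall x, B x -> D (Th x)) ->
  exists s : 'I_k -> 'I_N, injective s /\ has_int (fun y => exists x, D x /\ y = (fun i => x (s i))).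
Proof.
elim: N k B Th D => [|N IH] k B Th D dB dTh dD hB inj BD.
  have [a [b [h1 h2]]] := hB.
  case: k B Th dB dTh hB inj BD a b h1 h2 => [|k] B Th dB dTh hB inj BD a b h1 h2.
    exists id; split=> //; exists a, b; split=> // y _.
    by exists (Th a); split; [apply: BD; apply: h2 => -[]|apply: pt0_eq].
  (* [M^0] is a single point, so an injective map to it cannot have two points [f] and [f'] in its
     domain. *)
  have [f hf] : exists f : 'I_k.+1 -> M, forall i, olt (a i) (f i) /\ olt (f i) (b i).
    exists (fun i => proj1_sig (constructive_indefinite_description _ (dlo_dense (h1 i)))) => i.
    by case: constructive_indefinite_description.
  have [c [c1 c2]] := dlo_dense (hf ord0).2.
  pose f' : pt S k.+1 := ins ord0 c (del ord0 f).
  have hf' : box a b f'.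
    move=> j; rewrite /f'; case: (unliftP ord0 j) => [j' ->|->]; rewrite ?ins_lift ?ins_at /del //.
    by have [? ?] := hf ord0; split; dlo.
  have e : f = f' by apply: inj; [apply: h2|apply: h2|apply: pt0_eq].
  have : f ord0 = c by rewrite e /f' ins_at.
  by move=> e'; rewrite e' in c1; dlo.
pose th x := Th x ord0; pose Th' x := del ord0 (Th x).
have dth : dmap th by rewrite /th; ddm.
have dTh' : dmap Th' by rewrite /Th'; ddm.
have ThE x : Th x = ins ord0 (th x) (Th' x) by rewrite insK.
have dDc c : dset (fun w => D (ins ord0 c w)) by dd.
(* If the first coordinate [th] of the map is constant on a set with interior, the slice at that
   value already accounts for all [k] coordinates. *)
case: (classic (exists c, has_int (fun x => B x /\ th x = c))) => [[c hc]|nc].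
  have [||||||s [si hs]] := IH k (fun x => B x /\ th x = c) Th' (fun w => D (ins ord0 c w)) => //.
  - by dd.
  - by move=> x y [Bx xc] [By yc] e; apply: inj => //; rewrite !ThE xc yc e.
  - by move=> x [Bx <-]; rewrite -ThE; apply: BD.
  exists (fun i => lift ord0 (s i)); split=> [i j /lift_inj /si //|].
  apply: has_int_sub hs => y [w [Dw ->]]; exists (ins ord0 c w); split=> //.
  by apply: functional_extensionality => i; rewrite ins_lift.
have [a [b [ab hab]]] := hB.
have dbox : dset (fun x => box a b x) by have h := dset_box omin k; dd.
have bbox : has_int (box a b) by exists a, b.
case: k B Th dB dTh hB inj BD th Th' dth dTh' ThE nc a b ab hab dbox bbox =>
  [|k] B Th dB dTh hB inj BD th Th' dth dTh' ThE nc a b ab hab dbox bbox.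
  case: nc; exists (th a), a, b; split=> // y _; rewrite (pt0_eq y a); split=> //.
  by apply: hab => -[].
pose Sing (i : 'I_k.+1) (x : pt S k.+1) := exists u v, (olt u (x i) /\ olt (x i) v) /\
   forall t, olt u t -> olt t v -> th (ins i t (del i x)) = th x.
have dSing i : dset (Sing i) by rewrite /Sing; dd.
(* Otherwise [th] would be locally constant in every direction on some box, hence constant there,
   against [nc]. *)
have [i hi] : exists i, has_int (fun x => box a b x /\ ~ Sing i x).
  apply: NNPP => h; apply: nc.
  have [|a' [b' [ab' h']]] := has_int_forall omin uncK sat dbox dSing bbox; first by move=> i hi; apply: h; exists i.
  have [f hf] : exists f : 'I_k.+1 -> M, forall i, olt (a' i) (f i) /\ olt (f i) (b' i).
    exists (fun i => proj1_sig (constructive_indefinite_description _ (dlo_dense (ab' i)))) => i.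
    by case: constructive_indefinite_description.
  exists (th f), a', b'; split=> // y hy; split; first by apply: hab; case: (h' y hy).
  apply: (@constant_on_box _ th a' b') => // x hx i.
  have [_ /(_ i) [u [v [h1 h2]]]] := h' x hx; exists u, v; split=> // z hz1 hz2 hz3.
  rewrite -(insK i z) -(h2 _ hz2 hz3); congr (th (ins _ _ _)).
  by apply: functional_extensionality => j; apply: hz1; rewrite eq_sym neq_lift.
have [a' [b' [ab' h']]] := hi.
pose W := box (del i a') (del i b').
have dW : dset (fun x => W x) by have h := dset_box omin k; rewrite /W; dd.
have hW : has_int W by exists (del i a'), (del i b'); split=> // j; apply: ab'.
have inbox t w : olt (a' i) t -> olt t (b' i) -> W w -> box a' b' (ins i t w).
  by move=> h1 h2 h3; rewrite -(insK i a') -(insK i b'); apply/box_ins.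
have fin w c : W w -> ~ infinite (fun t => (olt (a' i) t /\ olt t (b' i)) /\ th (ins i t w) = c).
  move=> Ww [u [v [uv h]]]; have [t [ut tv]] := dlo_dense uv.
  have [[h1 h2] h3] := h t ut tv; have [_ ns] := h' _ (inbox t w h1 h2 Ww); apply: ns.
  exists u, v; rewrite ins_at del_ins; split=> // t' h4 h5; rewrite h3.
  by case: (h t' h4 h5).
(* Along direction [i] the map [th] is finite-to-one, so on each line it takes infinitely many
   values; one interval of values is common to a set of lines with interior. *)
have [||p [q [pq hpq]]] := @uniform_fibre_interval _ _ omin uncK sat k
  (fun w c => exists t, (olt (a' i) t /\ olt t (b' i)) /\ ((olt (a' i) t /\ olt t (b' i)) /\ th (ins i t w) = c)) W _ dW hW.
- by dd.
- move=> w Ww; apply: (@infinite_of_all_fibres (fun t c => (olt (a' i) t /\ olt t (b' i)) /\ th (ins i t w) = c)).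
  + by dd.
  + exact: ab'.
  + by move=> c; apply: fin.
  + by move=> t h1 h2; exists (th (ins i t w)).
pose proj (s : {ffun 'I_k -> 'I_N}) c (y : pt S k) := exists x, D (ins ord0 c x) /\ y = subpt s x.
have dproj s : dset (fun z : M * pt S k => proj s z.1 z.2).
  by have h := dmap_subpt omin s; rewrite /proj; dd.
have dproj' s := dset_has_int omin (P := fun c y => proj s c y) (dproj s).
(* On each of these lines [th] takes the value [c]; its least solution [mu w] depends definably on
   [w], which embeds a set with interior in [M^k] into the slice of [D] at [c]. *)
have key c : olt p c -> olt c q -> exists s : {ffun 'I_k -> 'I_N}, injective s /\ has_int (proj s c).
  move=> pc cq.
  pose mt w t := ((olt (a' i) t /\ olt t (b' i)) /\ th (ins i t w) = c) /\
    forall t', (olt (a' i) t' /\ olt t' (b' i)) /\ th (ins i t' w) = c -> ole t t'.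
  pose C w := W w /\ forall c, olt p c -> olt c q ->
    exists t, (olt (a' i) t /\ olt t (b' i)) /\ ((olt (a' i) t /\ olt t (b' i)) /\ th (ins i t w) = c).
  have dC : dset C by rewrite /C; dd.
  have ex w : C w -> exists t, mt w t.
    move=> [Ww h]; have [t [_ ht]] := h c pc cq.
    have dA : dset (fun t => (olt (a' i) t /\ olt t (b' i)) /\ th (ins i t w) = c) by dd.
    by have [m [h1 h2]] := finite_dset_min omin dA (fin w c Ww) ht; exists m.
  pose mu w := epsilon (inhabits p) (mt w).
  have muP w : C w -> mt w (mu w) by move=> Cw; apply: epsilon_spec; apply: ex.
  have dmu : dmapon C mu.
    have dmt : dset (fun z : pt S k * M => mt z.1 z.2) by rewrite /mt; dd.
    apply: (@dset_iff _ _ _ (fun z : pt S k * M => C z.1 /\ mt z.1 z.2)); last by dd.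
    move=> [w t] /=; split=> [[Cw h]|[Cw ->]]; split=> //; last exact: muP.
    have [h1 h2] := muP w Cw; case: h => h3 h4; have h5 := h2 _ h3; have h6 := h4 _ h1; dlo.
  have dmu' := dmap_ext omin p dC dmu; set mu' := ext_by _ _ _ in dmu'.
  have [||||||s [si hs]] := IH k C (fun w => Th' (ins i (mu' w) w)) (fun w => D (ins ord0 c w)) => //.
  - by ddm.
  - move=> w w' Cw Cw' e.
    have [[[h1 h2] h3] _] := muP w Cw; have [[[h4 h5] h6] _] := muP w' Cw'.
    rewrite /mu' !ext_in // in e.
    suff /ins_inj [_ ->] : ins i (mu w) w = ins i (mu w') w' by [].
    have [Ww Ww'] := (Cw.1, Cw'.1).
    apply: inj; [| |by rewrite !ThE h3 h6 e].
      by apply: hab; apply: (h' _ (inbox _ _ h1 h2 Ww)).1.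
    by apply: hab; apply: (h' _ (inbox _ _ h4 h5 Ww')).1.
  - move=> w Cw; have [[[h1 h2] h3] _] := muP w Cw.
    rewrite /mu' ext_in // -h3 -ThE; apply: BD; apply: hab; exact: (h' _ (inbox _ _ h1 h2 Cw.1)).1.
  exists (finfun s); split; first by move=> x y; rewrite !ffunE => /si.
  apply: has_int_sub hs => y [x [Dx ->]]; exists x; split=> //.
  by apply: functional_extensionality => j; rewrite /subpt ffunE.
(* The projection depends on [c], but there are finitely many; as finite functions they form a
   [finType], and one of them serves infinitely many [c]. *)
have [s is_] : exists s : {ffun 'I_k -> 'I_N}, infinite (fun c => injective s /\ has_int (proj s c)).
  apply: infinite_ex_fin => [s|]; first by have h := dproj' s; apply: dset_and => //; apply: dset_prop.
  by exists p, q.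
have si : injective s by have [u [v [uv h]]] := is_; have [c [h1 h2]] := dlo_dense uv; case: (h c h1 h2).
exists (fun j => if unlift ord0 j is Some j' then lift ord0 (s j') else ord0); split.
  move=> j1 j2; case: (unliftP ord0 j1) => [j1' ->|->]; case: (unliftP ord0 j2) => [j2' ->|->] //.
  by move/lift_inj/si => ->.
apply/(has_int_fibre omin uncK sat).
  pose s' (j : 'I_k.+1) := if unlift ord0 j is Some j' then lift ord0 (s j') else (ord0 : 'I_N.+1).
  have h := dmap_subpt omin s'.
  change (dset (fun y => exists x, D x /\ y = subpt s' x)).
  by dd.
apply: infinite_sub is_ => c [_]; apply: has_int_sub => y [x [Dx ->]]; exists (ins ord0 c x); split=> //.
apply: functional_extensionality => j; case: (unliftP ord0 j) => [j' ->|->]; rewrite ?ins_lift ?ins_at ?liftK ?unlift_none ?ins_lift ?ins_at //.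
Qed.
End Dimension.

(** * Charts *)

(** [psi] is the inverse of a chart at the identity. Elsewhere the topology is read through it by
    left translation. *)
Record chart (S : ostruct) (N : nat) (G : ldgroup S N) (T : (pt S N -> Prop) -> Prop)
    (n : nat) (psi : pt S n -> pt S N) (z0 : pt S n) : Prop := Chart {
  chart_dmap : dmap psi;
  chart_in : forall z, gset G (psi z);
  chart_one : psi z0 = gone G;
  chart_inj : injective psi;
  chart_cont : forall z O, T O -> O (psi z) ->
     exists a b, box a b z /\ forall z', box a b z' -> O (psi z');
  chart_open : forall z a b, box a b z ->
     exists O, [/\ T O, O (psi z) & forall z', O (psi z') -> box a b z'];
  chart_nbhd : exists O, [/\ T O, O (gone G) & forall y, O y -> exists z, psi z = y] }.

Section Charts.
Variables (S : ostruct) (K : Type) (N : nat) (G : ldgroup S N) (T : (pt S N -> Prop) -> Prop).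
Hypothesis omin : ominimal S.
Hypotheses (uncK : uncountable K) (sat : saturated S K).
Hypothesis tau : is_tau_topology G T.
Local Notation M := (carrier S).
Local Notation "x ** y" := (gmul G x y) (at level 40, left associativity).
Local Notation gpath := (gpath G T).
Local Hint Resolve gmul_in ginv_in gone_in ldiv_in : core.

Lemma chart_at_one : exists n (psi : pt S n -> pt S N) z0,
  has_dim (gset G) n /\ chart G T psi z0.
Proof.
have [_ _ _ [n [dimG hch]]] := tau.
have [W [phi [[dW WG nW dphi inj] [surj phic phio]]]] := hch _ (gone_in G).
pose psi z := proj1_sig (constructive_indefinite_description _ (surj z)).
have psiP z : W (psi z) /\ phi (psi z) = z by rewrite /psi; case: constructive_indefinite_description.
have psiE x : W x -> psi (phi x) = x.
  by move=> Wx; have [h1 h2] := psiP (phi x); apply: inj.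
have [O [TO [Oe OW]]] := nW.
have We : W (gone G) by apply: OW.
have hz0 : psi (phi (gone G)) = gone G by exact: psiE.
exists n, psi, (phi (gone G)); split=> //; split=> //.
- have /(defmapP omin) d := dphi; rewrite /dmapon in d.
  apply: (@dset_iff _ _ _ (fun p : pt S n * pt S N => W p.2 /\ p.1 = phi p.2)).
    by move=> [z x] /=; split=> [[Wx ->]|->]; [rewrite psiE|have [? ->] := psiP z].
  by apply: (dset_comp omin (g := fun p : pt S n * pt S N => (p.2, p.1)) d); ddm.
- by move=> z; apply: WG; case: (psiP z).
- by move=> z z' e; have [_ <-] := psiP z; have [_ <-] := psiP z'; rewrite e.
- move=> z O' TO' Oz; have [Wz ez] := psiP z; have [a [b [h1 h2]]] := phio _ Wz O' TO' Oz.
  by exists a, b; rewrite ez in h1; split=> // z' hz'; have [Wz' ez'] := psiP z'; apply: h2; rewrite ?ez'.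
- move=> z a b hb; have [Wz ez] := psiP z; rewrite -ez in hb.
  have [O' [TO' Oz h]] := phic _ Wz a b hb; exists O'; split=> // z' Oz'.
  by have [Wz' ez'] := psiP z'; rewrite -ez'; apply: h.
- by exists O; split=> // y /OW Wy; exists (phi y); apply: psiE.
Qed.

Variables (n : nat) (psi : pt S n -> pt S N) (z0 : pt S n).
Hypothesis ch : chart G T psi z0.
Let dpsi := chart_dmap ch.
Let psiG := chart_in ch.
Let psi1 := chart_one ch.

Lemma chart_box_nbhd a b : box a b z0 ->
  exists O, [/\ T O, O (gone G) & forall y, O y -> exists z, box a b z /\ psi z = y].
Proof.
move=> hb; have [O1 [T1 e1 h1]] := chart_open ch hb; have [O2 [T2 e2 h2]] := chart_nbhd ch.
rewrite psi1 in e1.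
exists (fun x => O1 x /\ O2 x); split=> // [|y [y1 y2]]; first exact: open_setI tau _ _ _ _.
by have [z hz] := h2 _ y2; exists z; split=> //; apply: h1; rewrite hz.
Qed.

Lemma ins_cont k (i : 'I_k.+1) (z : pt S k.+1) a b : box a b z ->
  forall t, olt (a i) t -> olt t (b i) -> box a b (ins i t (del i z)).
Proof.
move=> hb t h1 h2 j; case: (unliftP i j) => [j' ->|->]; rewrite ?ins_lift ?ins_at //.
Qed.

Section Agreement.
Variables (U A : pt S N -> Prop).
Hypothesis nU : nbhd T U (gone G).
Hypothesis Apath : forall a b gam, gpath a b gam -> (forall t, ole a t -> ole t b -> U (gam t)) ->
  (A (gam a) <-> A (gam b)).

(** In the chart, a small box is joined to its centre by moving one coordinate at a time, and each
    move is a path inside [U]. *)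
Lemma invariant_near_one : A (gone G) -> exists O, [/\ T O, O (gone G) & forall y, O y -> A y].
Proof.
move=> A1; have [O [TO [Oe OU]]] := nU.
rewrite -psi1 in Oe; have [a [b [hb hab]]] := chart_cont ch TO Oe.
have [O' [TO' Oe' hO']] := chart_box_nbhd hb.
exists O'; split=> // y /hO' [z [hz <-]].
have line k (psi' : pt S k -> pt S N) (a' b' : pt S k) (i : 'I_k) z' s :
   dmap psi' -> (forall z, gset G (psi' z)) -> (forall z O, T O -> O (psi' z) ->
     exists a b, box a b z /\ forall z', box a b z' -> O (psi' z')) ->
   (forall z, box a' b' z -> U (psi' z)) -> box a' b' z' -> olt (a' i) s -> olt s (b' i) ->
   A (psi' z') <-> A (psi' (fun j => if j == i then s else z' j)).
  case: k psi' a' b' i z' => [|k] psi' a' b' i z'; first by case: i.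
  move=> dpsi' psiG' cont' hU hz' as_ sb.
  have -> : (fun j => if j == i then s else z' j) = ins i s (del i z').
    apply: functional_extensionality => j; case: (unliftP i j) => [j' ->|->]; rewrite ?ins_lift ?ins_at ?eqxx //.
    by rewrite eq_sym (negPf (neq_lift i j')).
  rewrite -{1}(insK i z'); have [zi1 zi2] := hz' i.
  have pth u v : olt (a' i) u -> olt u v -> olt v (b' i) -> gpath u v (fun t => psi' (ins i t (del i z'))) /\
     forall t, ole u t -> ole t v -> U (psi' (ins i t (del i z'))).
    move=> au uv vb; split; last by move=> t h1 h2; apply: hU; apply: ins_cont => //; dlo.
    split=> //.
    - by apply: dmapon_dmap => //; [exact: dset_ival|have d := dmap_ins omin i; ddm].
    move=> t h1 h2 O1 T1 Ot; have [c [d [h3 h4]]] := cont' _ _ T1 Ot; have [h5 h6] := h3 i.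
    rewrite ins_at in h5 h6; exists (c i), (d i); split=> // w h7 h8 _ _; apply: h4.
    by rewrite -(del_ins i t (del i z')); apply: ins_cont.
  case: (dlo_total (R := @olt S) (z' i) s) => [h|[->|h]] //.
    by have [h1 h2] := pth _ _ zi1 h sb; apply: (Apath h1 h2).
  by have [h1 h2] := pth _ _ as_ h zi2; symmetry; apply: (Apath h1 h2).
apply: (box_ind (P := fun z => A (psi z)) _ hb hz); last by rewrite psi1.
by move=> z' i s hz' as_ sb; rewrite -(line n psi a b i z' s) //; [exact: chart_cont ch|move=> w /hab /OU].
Qed.
End Agreement.

(* Continuity at t for the group topology, expressed definably through the chart. *)
Definition contat (F : M -> pt S N) t := forall a b, box a b z0 ->
  exists u v, (olt u t /\ olt t v) /\ forall s, olt u s -> olt s v ->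
    exists z, box a b z /\ ldiv G (F t) (F s) = psi z.

Lemma path_of_contat F p q : olt p q -> dmap F -> (forall t, ole p t -> ole t q -> gset G (F t)) ->
  (forall t, ole p t -> ole t q -> contat F t) -> gpath p q F.
Proof.
move=> pq dF FG Fc; split=> //; first by apply: dmapon_dmap => //; exact: dset_ival.
move=> t h1 h2 O TO Ot; have gt := FG _ h1 h2.
have e : F t ** gone G = F t by rewrite gmulr1.
have [O' [TO' Oe' hO']] := open_transl tau TO gt (gone_in G) (eq_ind_r O Ot e).
rewrite -psi1 in Oe'; have [a [b [hb hab]]] := chart_cont ch TO' Oe'.
have [u [v [[h3 h4] h5]]] := Fc t h1 h2 a b hb.
exists u, v; split=> // s us sv ps sq; have [z [hz ez]] := h5 s us sv.
rewrite -(ldivK gt (FG _ ps sq)) ez; apply: hO'; exact: hab.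
Qed.

Definition inbox (a b : pt S n) y := exists z, box a b z /\ y = psi z.
Lemma dset_inbox : dset (fun p : pt S n * pt S n * pt S N => inbox p.1.1 p.1.2 p.2).
Proof. by have h := dset_box omin n; rewrite /inbox; dd. Qed.

Lemma box_inter (a b a' b' : pt S n) : box a b z0 -> box a' b' z0 -> exists c d, box c d z0 /\
  forall z, box c d z -> box a b z /\ box a' b' z.
Proof.
move=> h1 h2; have I : dlo (@olt S) by exact: dlo_olt.
pose c : pt S n := fun i => proj1_sig (constructive_indefinite_description _ (@dlo_max M (@olt S) I (a i) (a' i))).
pose d : pt S n := fun i => proj1_sig (constructive_indefinite_description _ (@dlo_min M (@olt S) I (b i) (b' i))).
have cP i : [/\ ole (a i) (c i), ole (a' i) (c i) & c i = a i \/ c i = a' i].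
  by rewrite /c; case: constructive_indefinite_description.
have dP i : [/\ ole (d i) (b i), ole (d i) (b' i) & d i = b i \/ d i = b' i].
  by rewrite /d; case: constructive_indefinite_description.
exists c, d; split=> [i|z hz].
  have [_ _ e1] := cP i; have [_ _ e2] := dP i; have [? ?] := h1 i; have [? ?] := h2 i.
  by split; [case: e1 => ->|case: e2 => ->].
by split=> i; have [? ?] := hz i; have [? ? _] := cP i; have [? ? _] := dP i; split; dlo.
Qed.

Hypothesis dimG : has_dim (gset G) n.

(* Otherwise, after uniformizing, F(t) * (small box) for t in an interval are pairwise disjoint
   and fill up a set of dimension n + 1 in G. *)
Lemma finite_discontinuities F p q : dmap F -> (forall t, olt p t -> olt t q -> gset G (F t)) ->
  ~ infinite (fun t => (olt p t /\ olt t q) /\ ~ contat F t).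
Proof.
move=> dF FG iD; have [p1 [q1 [pq1 hD]]] := iD.
have din := dset_inbox; have dbx := dset_box omin n.
have sub1 t : olt p1 t -> olt t q1 -> gset G (F t) by move=> h1 h2; have [[h3 h4] _] := hD t h1 h2; apply: FG.
pose J t := olt p1 t /\ olt t q1.
have dJ : dset J by rewrite /J; dd.
pose J2 (w : M * M) := J w.1 /\ J w.2.
have dJ2 : dset J2 by rewrite /J2; dd.
have ddl : dmapon J2 (fun w => ldiv G (F w.1) (F w.2)).
  by apply: (ldiv_dmapon omin uncK sat); [apply: dmapon_dmap => //; ddm|apply: dmapon_dmap => //; ddm| |];
   move=> w [[? ?] [? ?]]; apply: sub1.
pose dl := ext_by J2 (fun w => ldiv G (F w.1) (F w.2)) (gone G).
have ddl' : dmap dl by apply: dmap_ext.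
pose Av (r : pt S n * pt S n) t s := J s /\ ~ inbox r.1 r.2 (dl (t, s)).
have dAv : dset (fun w : pt S n * pt S n * M * M => Av w.1.1 w.1.2 w.2) by rewrite /Av; dd.
pose X b (r : pt S n * pt S n) t := box r.1 r.2 z0 /\ exists e, rlt b t e /\ forall s, rlt b t s -> rlt b s e -> Av r t s.
have dX b : dset (fun w : pt S n * pt S n * M => X b w.1 w.2) by rewrite /X; dd.
(* The germ of [F] on each side of [t] either stays in [F t] times a given box or avoids it; were no
   box avoided on either side, [F] would be continuous at [t]. *)
have cov t : J t -> (exists r, X false r t) \/ (exists r, X true r t).
  move=> [h1 h2]; have [_ nc] := hD t h1 h2; apply: NNPP => nX; apply: nc => a b hb.
  pose B s := inbox a b (dl (t, s)).
  have dB : dset B by rewrite /B; dd.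
  have side c : exists e, rlt c t e /\ forall s, int c t e s -> J s /\ B s.
    have [m [tm mJ]] : exists m, rlt c t m /\ forall s, int c t m s -> J s.
      by case: (c); [exists p1|exists q1]; split=> // s [h3 h4]; split; dlo.
    have [e [te he]] := germ omin c t dB.
    have [m' [k1 k2 k3]] := dlo_min (R := rlt c) m e.
    have tm' : rlt c t m' by case: k3 => ->.
    exists m'; split=> // s [s1 s2]; have Js : J s by apply: mJ; split; dlo.
    split=> //; case: he => he; first by apply: he; split; dlo.
    exfalso; have Xc : exists r, X c r t.
      exists (a, b); split=> //; exists m'; split=> // s' h3 h4; split; first by apply: mJ; split; dlo.
      by apply: he; split; dlo.
    by apply: nX; case: (c) Xc => h; [right|left].
  have [v [tv hv]] := side false; have [u [ut hu]] := side true.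
  exists u, v; split=> // s us sv.
  have E s' : J s' -> B s' -> exists z, box a b z /\ ldiv G (F t) (F s') = psi z.
    by move=> Js' [z [hz ez]]; exists z; split=> //; rewrite -ez /dl ext_in.
  case: (dlo_total (R := @olt S) t s) => [h|[<-|h]].
  - by have [k1 k2] := hv s (conj h sv); apply: E.
  - by exists z0; split=> //; rewrite psi1 ldivxx //; apply: sub1.
  - by have [k1 k2] := hu s (conj h us); apply: E.
have iJ : infinite (fun t => (J t /\ exists r, X false r t) \/ (J t /\ exists r, X true r t)).
  by exists p1, q1; split=> // t h1 h2; case: (cov t (conj h1 h2)) => h; [left|right].
have [c iJc] : exists c, infinite (fun t => J t /\ exists r, X c r t).
  have dX0 := dX false; have dX1 := dX true.
  by case/(infinite_or omin): iJ; [dd|dd|exists false|exists true].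
have dXc := dX c.
(* What avoids a box avoids every smaller one, so the family is directed and one box [r] serves an
   interval of points. *)
have [||||r ir] := @directed_uniform _ omin _ uncK sat _ _ (X c) (fun t => J t /\ exists r, X c r t) _ _ _ iJc.
- by [].
- by dd.
- move=> [a b] [a' b']; case: (classic (box a b z0)) => h1; last by exists (a', b') => t [[]|].
  case: (classic (box a' b' z0)) => h2; last by exists (a, b) => t [|[]].
  have [a1 [b1 [h3 h4]]] := box_inter h1 h2; exists (a1, b1) => t h; split=> //.
  case: h => -[_ [e [te he]]]; exists e; split=> // s s1 s2; have [Js nb] := he s s1 s2; split=> // -[z [hz ez]];
   by apply: nb; exists z; split=> //; case: (h4 z hz).
- by move=> t [].
have [p2 [q2 [pq2 h2]]] := (@infiniteE _ c _).1 ir.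
have hbox : box r.1 r.2 z0.
  by have [t [t1 t2]] := dlo_dense pq2; case: (h2 t (conj t1 t2)) => _ [].
have [||p3 [q3 [pp3 pq3 qq3 hAv]]] := @germ_uniform _ omin _ uncK sat c (Av r) p2 q2 _ pq2.
- by dd.
- by move=> t ht; have [_ [_ [e [te he]]]] := h2 t ht; exists e; split=> // s [s1 s2]; apply: he.
have inJ t : int c p3 q3 t -> J t by move=> [h3 h4]; have [|[]] := h2 t; first by split; dlo.
have [O [TO Oe hO]] := chart_box_nbhd hbox.
(* The new box is so small that quotients of its elements stay in the box [r]. An equality
   [F t ** psi z = F s ** psi z'] with distinct [t] and [s] would then put the increment of [F] into
   the box that it avoids. *)
have Oe1 : O (gone G ** ginv G (gone G)) by rewrite gmulVr.
have [O1 [O2 [T1 T2 e1 e2 h12]]] := open_gmul tau TO (gone_in G) (ginv_in (gone_in G)) Oe1.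
have [O3 [T3 e3 h3]] := open_ginv tau T2 (gone_in G) e2.
have T13 := open_setI tau T1 T3.
have e13 : O1 (psi z0) /\ O3 (psi z0) by rewrite psi1.
have [a [b [hb hab]]] := chart_cont ch T13 e13.
have small z z' : box a b z -> box a b z' -> inbox r.1 r.2 (psi z ** ginv G (psi z')).
  move=> /hab [k1 _] /hab [_ k2]; have /hO [w [hw ew]] : O (psi z ** ginv G (psi z')) by apply: h12 => //; apply: h3.
  by exists w.
have [p4 [q4 [pq4 h4]]] : exists p4 q4, olt p4 q4 /\ forall t, olt p4 t -> olt t q4 -> int c p3 q3 t.
  by case: (c) pq3; [exists q3, p3|exists p3, q3].
pose B (x : pt S n.+1) := (olt p4 (x ord0) /\ olt (x ord0) q4) /\ box a b (del ord0 x).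
have dB : dset B by have hdel := dmap_del omin (@ord0 n); rewrite /B; dd.
have hB : has_int B.
  exists (ins ord0 p4 a), (ins ord0 q4 b); split.
    by apply: lt_ins => // j; have [? ?] := hb j; dlo.
  by move=> y; rewrite -{1}(insK ord0 y) => /box_ins.
pose Th (x : pt S n.+1) := F (x ord0) ** psi (del ord0 x).
have BF x : B x -> gset G (F (x ord0)).
  by move=> [[k1 k2] _]; have [k3 k4] := inJ _ (h4 _ k1 k2); apply: sub1.
have dTh : dmapon B Th.
  have hdel := dmap_del omin (@ord0 n).
  apply: (gmul_dmapon omin uncK sat); [| |exact: BF|by []].
    by apply: dmapon_dmap => //; ddm.
  by apply: dmapon_dmap => //; ddm.
have dTh' := dmap_ext omin (gone G) dB dTh; set Th' := ext_by _ _ _ in dTh'.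
pose D y := exists x, B x /\ y = Th' x.
have dD : dset D by rewrite /D; dd.
have ordered x y : B x -> B y -> rlt c (x ord0) (y ord0) -> Th x = Th y -> False.
  move=> Bx By lt_ e; have [gx gy] := (BF x Bx, BF y By).
  have [[x1 x2] x3] := Bx; have [[y1 y2] y3] := By.
  have ix := h4 _ x1 x2; have iy := h4 _ y1 y2.
  have [|||_ nb] := hAv (x ord0) (y ord0); [by case: ix|by []|by case: iy|].
  apply: nb; rewrite /dl ext_in; last by split; apply: inJ.
  rewrite /=; have -> : ldiv G (F (x ord0)) (F (y ord0)) = psi (del ord0 x) ** ginv G (psi (del ord0 y)).
    apply: ldiv_eq; auto; rewrite gmulA; auto.
    by rewrite -/(Th x) e /Th gmulKV.
  exact: small.
have [||s [si hs]] := @injection_projection _ _ omin uncK sat N n.+1 B Th' D dB dTh' dD hB.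
- move=> x y Bx By; rewrite /Th' !ext_in // => e.
  have e0 : x ord0 = y ord0.
    by case: (dlo_total (R := rlt c) (x ord0) (y ord0)) => [h|[//|h]]; [case: (ordered x y)|case: (ordered y x)].
  rewrite -(insK ord0 x) -(insK ord0 y) e0; congr ins; apply: (chart_inj ch).
  have [gx gy] := (BF x Bx, BF y By).
  by apply: (@gmul_inj _ _ G (F (x ord0))) => //; rewrite {2}e0.
- by move=> x Bx; exists x.
have DG x : D x -> gset G x by move=> [y [By ->]]; rewrite /Th' ext_in //; apply: gmul_in; [apply: BF|].
have [_ hmax] := dimG.
by have := hmax n.+1 D s dD DG si hs; rewrite ltnn.
Qed.
End Charts.

(** * Definable choice *)

Section DefinableExtrema.
Variable S : ostruct.
Hypothesis omin : ominimal S.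
Local Notation M := (carrier S).
Context {X : Type} {cX : coded S X}.

(** Least upper bounds are unique and therefore depend definably on the parameter. *)
Lemma sup_function b (D : X -> Prop) (C : X -> M -> Prop) :
  dset D -> dset (fun p : X * M => C p.1 p.2) ->
  (forall x, D x -> (exists t, C x t) /\ exists u, forall t, C x t -> le (rlt b) t u) ->
  exists s : X -> M, dmapon D s /\ forall x, D x ->
    (forall t, C x t -> le (rlt b) t (s x)) /\ forall u, rlt b u (s x) -> exists t, C x t /\ rlt b u t.
Proof.
move=> dD dC hC; have [[m0] _] := omin.
pose P x s := (forall t, C x t -> le (rlt b) t s) /\ forall u, rlt b u s -> exists t, C x t /\ rlt b u t.
have Pex x : D x -> exists s, P x s.
  move=> /hC [[t Ct] [u hu]]; have dCx : dset (C x) by apply: (dset_comp omin (g := fun t => (x, t)) dC); ddm.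
  by have [s hs] := sup_exists omin dCx Ct hu; exists s.
pose s x := epsilon (inhabits m0) (P x).
have sP x : D x -> P x (s x) by move=> Dx; apply: epsilon_spec; apply: Pex.
have dP : dset (fun p : X * M => P p.1 p.2) by rewrite /P; dd.
exists s; split=> //.
apply: (@dset_iff _ _ _ (fun p : X * M => D p.1 /\ P p.1 p.2)); last by dd.
move=> [x t] /=; split=> [[Dx [h1 h2]]|[Dx ->]]; split=> //; last exact: sP.
have [h3 h4] := sP x Dx.
case: (dlo_total (R := rlt b) t (s x)) => [h|[//|h]]; exfalso.
  by have [t' [/h1 ? ?]] := h4 _ h; dlo.
by have [t' [/h3 ? ?]] := h2 _ h; dlo.
Qed.
Lemma inf_function b (D : X -> Prop) (C : X -> M -> Prop) :
  dset D -> dset (fun p : X * M => C p.1 p.2) ->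
  (forall x, D x -> (exists t, C x t) /\ exists u, forall t, C x t -> le (rlt b) u t) ->
  exists s : X -> M, dmapon D s /\ forall x, D x ->
    (forall t, C x t -> le (rlt b) (s x) t) /\ forall u, rlt b (s x) u -> exists t, C x t /\ rlt b t u.
Proof.
have flip (x y : M) : le (rlt (~~ b)) x y <-> le (rlt b) y x.
  by case: b; rewrite /le /rlt /=; split=> -[h|->]; [left|right|left|right|left|right|left|right].
have flip' (x y : M) : rlt (~~ b) x y <-> rlt b y x by case: (b).
move=> dD dC hC; have [|s [ds hs]] := @sup_function (~~ b) D C dD dC.
  by move=> x /hC [h1 [u hu]]; split=> //; exists u => t /hu; rewrite flip.
exists s; split=> // x Dx; have [h1 h2] := hs x Dx; split=> [t /h1|u]; first by rewrite flip.
by rewrite -flip' => /h2 [t [h3]]; rewrite flip' => h4; exists t.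
Qed.
Lemma two_sided_nbhd b (t u v : M) (P : M -> Prop) : olt u t -> olt t v ->
  (forall s, olt u s -> olt s v -> P s) ->
  exists e1 e2, [/\ rlt b e1 t, rlt b t e2 & forall s, rlt b e1 s -> rlt b s e2 -> P s].
Proof.
move=> h1 h2 h; case: b; last by exists u, v.
by exists v, u; split=> // s h3 h4; apply: h.
Qed.
End DefinableExtrema.

Section DefinableChoice.
Variables (S : ostruct) (K : Type) (N : nat) (G : ldgroup S N) (T : (pt S N -> Prop) -> Prop).
Hypothesis omin : ominimal S.
Hypotheses (uncK : uncountable K) (sat : saturated S K).
Hypothesis tau : is_tau_topology G T.
Local Notation M := (carrier S).
Local Hint Resolve gmul_in ginv_in gone_in ldiv_in : core.
Variables (n : nat) (psi : pt S n.+1 -> pt S N) (z0 : pt S n.+1).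
Hypothesis ch : chart G T psi z0.
Let dpsi := chart_dmap ch.
Let psiG := chart_in ch.
Let psi1 := chart_one ch.

(** The coordinate line of the chart through the identity; the group acts on its points and so
    compares pieces of the line. *)
Definition axis (i : 'I_n.+1) t := psi (ins i t (del i z0)).
Lemma axis_dmap i : dmap (axis i).
Proof. by have d := dmap_ins omin i; have d' := dpsi; rewrite /axis; ddm. Qed.
Lemma axis_in i t : gset G (axis i t). Proof. exact: psiG. Qed.
Lemma axis_one i : axis i (z0 i) = gone G. Proof. by rewrite /axis insK psi1. Qed.
Lemma axis_inj i s t : axis i s = axis i t -> s = t.
Proof. by move/(chart_inj ch)/ins_inj => []. Qed.
Lemma axis_cont b i t O : T O -> O (axis i t) ->
  exists e1 e2, [/\ rlt b e1 t, rlt b t e2 & forall s, rlt b e1 s -> rlt b s e2 -> O (axis i s)].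
Proof.
move=> TO Ot; have [c [d [h1 h2]]] := chart_cont ch TO Ot.
have [h3 h4] := h1 i; rewrite ins_at in h3 h4.
apply: (two_sided_nbhd b h3 h4) => s h5 h6; apply: h2.
by rewrite -(del_ins i t (del i z0)); apply: ins_cont.
Qed.
Local Hint Resolve axis_in : core.
Definition shift i s t := ldiv G (axis i s) (axis i t).
Lemma shift_dmap i : dmap (fun p : M * M => shift i p.1 p.2).
Proof.
have d := axis_dmap i; apply: dmap_on.
by apply: (ldiv_dmapon omin uncK sat) => //; apply: dmapon_dmap => //; [dd|ddm|dd|ddm].
Qed.

Lemma coord_lt b i z m : rlt b (z i) m ->
  exists O, [/\ T O, O (psi z) & forall z', O (psi z') -> rlt b (z' i) m].
Proof.
move=> zm.
have [u [v [h1 h2 h3]]] : exists u v, [/\ olt u (z i), olt (z i) v & forall t, olt u t -> olt t v -> rlt b t m].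
  case: b zm => zm; last first.
    by have [u hu] := dlo_below (R := @olt S) (z i); exists u, m.
  by have [v hv] := dlo_above (R := @olt S) (z i); exists m, v.
have lo j : {c | olt c (z j)} by apply: constructive_indefinite_description; apply: dlo_below.
have hi j : {c | olt (z j) c} by apply: constructive_indefinite_description; apply: dlo_above.
pose c : pt S n.+1 := fun j => if j == i then u else sval (lo j).
pose d : pt S n.+1 := fun j => if j == i then v else sval (hi j).
have hb : box c d z.
  by move=> j; rewrite /c /d; case: eqP => [->|_] //; split; [exact: (svalP (lo j))|exact: (svalP (hi j))].
have [O [TO Oz hO]] := chart_open ch hb; exists O; split=> // z' /hO /(_ i).
by rewrite /c /d eqxx => -[? ?]; apply: h3.
Qed.
Lemma coord_gt b i z m : rlt b m (z i) ->
  exists O, [/\ T O, O (psi z) & forall z', O (psi z') -> rlt b m (z' i)].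
Proof.
move=> h; have [|O [TO Oz hO]] := @coord_lt (~~ b) i z m; first by case: b h.
by exists O; split=> // z' /hO; case: (b).
Qed.

Lemma shift_near_right b i t O : T O -> O (gone G) ->
  exists e1 e2, [/\ rlt b e1 t, rlt b t e2 & forall s s', rlt b e1 s -> rlt b s e2 -> rlt b e1 s' -> rlt b s' e2 -> O (shift i s s')].
Proof.
move=> TO Oe; have [O' [TO' O't hO']] := open_ldivxx tau TO Oe (axis_in i t).
have [e1 [e2 [h1 h2 h3]]] := axis_cont b TO' O't.
by exists e1, e2; split=> // *; apply: hO'; apply: h3.
Qed.

(* h(r) is the first r' past z0 i at which the increment from axis r' to axis r has gone
   below r' in the i-th coordinate: a group-theoretic substitute for a midpoint. *)
Lemma half_function b i : exists o1 (h : M -> M), [/\ rlt b (z0 i) o1,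
  dmapon (fun r => rlt b (z0 i) r /\ rlt b r o1) h &
  forall r, rlt b (z0 i) r -> rlt b r o1 -> rlt b (z0 i) (h r) /\ rlt b (h r) r].
Proof.
have [OW [TW eW hW]] := chart_nbhd ch.
have eW' : OW (axis i (z0 i)) by rewrite axis_one.
have [_ [o1 [_ oo1 _]]] := axis_cont b TW eW'.
pose E r r' := (rlt b (z0 i) r' /\ rlt b r' r) /\ exists z, psi z = shift i r' r /\ le (rlt b) (z i) r'.
have dE : dset (fun p : M * M => E p.1 p.2).
  by have d := shift_dmap i; have d' := dpsi; rewrite /E; dd.
pose D r := rlt b (z0 i) r /\ rlt b r o1.
have dD : dset D by rewrite /D; dd.
(* For [r'] near the centre the increment is near [axis i r], whose coordinate [r] lies beyond [r'];
   so the admissible [r'] stay away from the centre. *)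
have low r : D r -> exists m, [/\ rlt b (z0 i) m, rlt b m r & forall t, E r t -> le (rlt b) m t].
  move=> [h1 h2]; have [m [om mr]] := dlo_dense h1.
  have [|O [TO Or hO]] := @coord_gt b i (ins i r (del i z0)) m; first by rewrite ins_at.
  have Os : O (ldiv G (axis i (z0 i)) (axis i r)) by rewrite axis_one ldiv1x.
  have [O1 [O2 [T1 T2 e1 e2 h12]]] := open_ldiv tau TO (axis_in i _) (axis_in i _) Os.
  have [u [v [h3 h4 h5]]] := axis_cont b T1 e1.
  have [m' [l1 l2 l3]] := dlo_min (R := rlt b) m v; exists m'.
  split; [by case: l3 => ->|dlo|] => t [[h6 h7] [z [ez zt]]].
  apply: dlo_leP => tm; have Oz : O (psi z) by rewrite ez; apply: h12 => //; apply: h5; dlo.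
  by have := hO _ Oz => h8; dlo.
(* For [r'] near [r] the increment is near the identity, so its coordinate has come back below
   [r']. *)
have ex r : D r -> exists t, E r t.
  move=> Dr; have [h1 h2] := Dr; have [m [om mr]] := dlo_dense h1.
  have [O [TO Oe hO]] := coord_lt om; rewrite psi1 in Oe.
  have [u [v [h3 h4 h5]]] := shift_near_right b i r (open_setI tau TO TW) (conj Oe eW).
  have [m' [l1 l2 l3]] := dlo_max (R := rlt b) m u.
  have [t [mt tr]] : exists t, rlt b m' t /\ rlt b t r by apply: dlo_dense; case: l3 => ->.
  have [||||k1 k2] := h5 t r => //; try dlo.
  have [z hz] := hW _ k2; exists t; split; first by split; dlo.
  by exists z; split=> //; rewrite -hz in k1; have := hO _ k1 => h6; dlo.
have [|h [dh hh]] := @inf_function _ omin _ _ b D E dD dE.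
  by move=> r Dr; split; [exact: ex|have [m [_ _ hm]] := low r Dr; exists m].
exists o1, h; split=> // r h1 h2; have Dr : D r by split.
have [k1 k2] := hh r Dr; have [m [om mr hm]] := low r Dr; have [t Et] := ex r Dr.
have mh : le (rlt b) m (h r) by apply: dlo_leP => hlt; have [t' [/hm ? ?]] := k2 _ hlt; dlo.
by have [[_ tr] _] := Et; have := k1 _ Et => ht; split; dlo.
Qed.

Section Families.
Context {X : Type} {cX : coded S X}.

(** The supremum [s x] of the good initial segments may itself violate [C x], so [h] moves it
    strictly inside. The bound [o2] makes the supremum exist and keeps it in the domain of [h]. *)
Lemma choose_scale b i (D : X -> Prop) (C : X -> M -> Prop) : dset D ->
  dset (fun p : X * M => C p.1 p.2) ->
  (forall x, D x -> exists e, rlt b (z0 i) e /\ forall t, rlt b (z0 i) t -> rlt b t e -> C x t) ->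
  exists c : X -> M, dmapon D c /\ forall x, D x -> C x (c x) /\ rlt b (z0 i) (c x).
Proof.
move=> dD dC hC; have [o1 [h [oo1 dh hh]]] := half_function b i.
have [o2 [oo2 o21]] := dlo_dense oo1.
pose E x r := (rlt b (z0 i) r /\ le (rlt b) r o2) /\ forall t, rlt b (z0 i) t -> rlt b t r -> C x t.
have dE : dset (fun p : X * M => E p.1 p.2) by rewrite /E; dd.
have Eex x : D x -> exists r, E x r.
  move=> /hC [e [oe he]]; have [m [m1 m2 m3]] := dlo_min (R := rlt b) e o2; exists m.
  by split; [split; [case: m3 => ->|]|move=> t h1 h2; apply: he => //; dlo].
have [|s [ds hs]] := @sup_function _ omin _ _ b D E dD dE.
  by move=> x Dx; split; [exact: Eex|exists o2 => t [[]]].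
have sP x : D x -> rlt b (z0 i) (s x) /\ rlt b (s x) o1.
  move=> Dx; have [k1 k2] := hs x Dx; have [r Er] := Eex x Dx; have h1 := k1 _ Er.
  have [[h2 h3] _] := Er; split; first by dlo.
  suff h4 : le (rlt b) (s x) o2 by dlo.
  by apply: dlo_leP => h4; have [t [[[_ h5] _] h6]] := k2 _ h4; dlo.
exists (fun x => h (s x)); split; first exact: (dmapon_comp omin dh ds).
move=> x Dx; have [h1 h2] := sP x Dx; have [h3 h4] := hh _ h1 h2; split=> //.
by have [_ k2] := hs x Dx; have [t [[_ h5] h6]] := k2 _ h4; apply: h5.
Qed.

Variable b : bool.
Variables (Y : X -> M -> Prop) (a : X -> M).
Hypothesis dY : dset (fun p : X * M => Y p.1 p.2).
Hypothesis da : dmap a.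
Definition chosen (x : X) (c : M) := rlt b (a x) c /\ forall t, rlt b (a x) t -> le (rlt b) t c -> Y x t.
Definition choosable (D : X -> Prop) := exists c : X -> M, dmapon D c /\ forall x, D x -> chosen x (c x).

Lemma choosable_sub (D D' : X -> Prop) : choosable D -> dset D' -> (forall x, D' x -> D x) -> choosable D'.
Proof.
move=> [c [dc hc]] dD' sub; exists c; split=> [|x /sub/hc //]; exact: dmapon_sub dc dD' sub.
Qed.
Lemma choosable_or (D D' : X -> Prop) : choosable D -> choosable D' -> choosable (fun x => D x \/ D' x).
Proof.
move=> [c [dc hc]] [c' [dc' hc']]; exists (fun x => if excluded_middle_informative (D x) then c x else c' x).
have dD := dmapon_dom omin dc; rewrite /dmapon in dc dc'.
split=> [|x].
  apply: (@dset_iff _ _ _ (fun p : X * M => (D p.1 /\ p.2 = c p.1) \/ (~ D p.1 /\ (D' p.1 /\ p.2 = c' p.1)))); last by dd.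
  by move=> [x t] /=; case: excluded_middle_informative => h /=; tauto.
by case: excluded_middle_informative => h /= [] //; auto.
Qed.
Lemma choosable_ex_ord k (D : 'I_k -> X -> Prop) : (forall i, choosable (D i)) -> choosable (fun x => exists i, D i x).
Proof.
elim: k D => [|k IH] D hD.
  exists a; split=> [|x [[]] //]; apply: dmapon_dmap => //.
  by apply: (@dset_iff _ _ _ (fun _ : X => False)) => [x|]; [split=> // -[[]]|dd].
have h := choosable_or (hD ord0) (IH _ (fun i => hD (lift ord0 i))).
have E x : (D ord0 x \/ exists i, D (lift ord0 i) x) <-> exists i, D i x.
  split=> [[h'|[i h']]|[i]]; [by exists ord0|by exists (lift ord0 i)|].
  by case: (unliftP ord0 i) => [j ->|->] h'; [right; exists j|left].
apply: choosable_sub h _ _ => [|x]; last by rewrite E.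
by apply: dset_exists_ord => // i; have [c [dc _]] := hD i; apply: dmapon_dom dc.
Qed.

(** Just past [a x], the increments along axis 0 move away from the identity in coordinate [j]
    towards the side [b']. *)
Definition leaves b' (j : 'I_n.+1) x := exists e, rlt b (a x) e /\ forall t, rlt b (a x) t -> rlt b t e ->
  Y x t /\ exists z, psi z = shift ord0 (a x) t /\ rlt b' (z0 j) (z j).
Lemma dset_leaves b' j : dset (leaves b' j).
Proof. by have d := shift_dmap ord0; have d' := dpsi; rewrite /leaves; dd. Qed.

(** [choose_scale] first selects a displacement [r x] in coordinate [j]. The chosen point is the
    infimum of the good [t] whose increment from [a x] reaches it; by continuity this lies strictly
    past [a x]. *)
Lemma choosable_leaves b' j : choosable (leaves b' j).
Proof.
have d := shift_dmap ord0; have d' := dpsi; have dl := dset_leaves b' j.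
pose Y' x t := rlt b (a x) t /\ forall t', rlt b (a x) t' -> le (rlt b) t' t ->
  Y x t' /\ exists z, psi z = shift ord0 (a x) t' /\ rlt b' (z0 j) (z j).
have dY' : dset (fun p : X * M => Y' p.1 p.2) by rewrite /Y'; dd.
pose C x r := rlt b' (z0 j) r /\ exists t, Y' x t /\ exists z, psi z = shift ord0 (a x) t /\ le (rlt b') r (z j).
have dC : dset (fun p : X * M => C p.1 p.2) by rewrite /C; dd.
have [|r [dr hr]] := choose_scale (b := b') (i := j) dl dC.
  move=> x [e [ae he]]; have [t [at_ te]] := dlo_dense ae.
  have Y't : Y' x t by split=> // t' h1 h2; apply: he => //; dlo.
  have [_ [z [ez zj]]] := he t at_ te; exists (z j); split=> // r h1 h2; split=> //.
  by exists t; split=> //; exists z; split=> //; left.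
pose E x t := Y' x t /\ exists z, psi z = shift ord0 (a x) t /\ le (rlt b') (r x) (z j).
have dr' := dmap_ext omin (z0 j) dl dr; set r' := ext_by _ _ _ in dr'.
pose E' x t := Y' x t /\ exists z, psi z = shift ord0 (a x) t /\ le (rlt b') (r' x) (z j).
have dE' : dset (fun p : X * M => E' p.1 p.2) by rewrite /E'; dd.
have EE x t : leaves b' j x -> E' x t <-> E x t by move=> h; rewrite /E' /r' ext_in.
have low x : leaves b' j x -> exists m, rlt b (a x) m /\ forall t, E' x t -> le (rlt b) m t.
  move=> lx; have [_ h1] := hr x lx; have [O [TO Oe hO]] := coord_lt h1; rewrite psi1 in Oe.
  have [u [v [h2 h3 h4]]] := shift_near_right b ord0 (a x) TO Oe.
  exists v; split=> // t /EE-/(_ lx) [[k1 k2] [z [ez k3]]]; apply: dlo_leP => tv.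
  have Oz : O (psi z) by rewrite ez; apply: h4 => //; dlo.
  by have := hO _ Oz => h5; dlo.
have ex x : leaves b' j x -> exists t, E' x t.
  by move=> lx; have [[_ [t [k1 k2]]] _] := hr x lx; exists t; apply/EE.
have [|s [ds hs]] := @inf_function _ omin _ _ b (leaves b' j) E' dl dE'.
  by move=> x lx; split; [exact: ex|have [m [_ hm]] := low x lx; exists m].
exists s; split=> // x lx; have [k1 k2] := hs x lx; have [m [am hm]] := low x lx; have [t Et] := ex x lx.
have ms : le (rlt b) m (s x) by apply: dlo_leP => hlt; have [t' [/hm ? ?]] := k2 _ hlt; dlo.
split=> [|t' h1 h2]; first by dlo.
have st := k1 _ Et; have [[_ h3] _] := Et.
by have [|h4 _] := h3 t' h1; first by dlo.
Qed.

(* There is no definable operation on M, so the group has to serve for definable choice: the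
   increments along axis 0 leave the identity in some coordinate of the chart, and [half_function]
   provides a definable scale in that coordinate. *)
Lemma choose_germ (D : X -> Prop) : dset D ->
  (forall x, D x -> exists e, rlt b (a x) e /\ forall t, rlt b (a x) t -> rlt b t e -> Y x t) -> choosable D.
Proof.
move=> dD hD.
have h : choosable (fun x => (exists j, leaves false j x) \/ exists j, leaves true j x).
  by apply: choosable_or; apply: choosable_ex_ord => j; apply: choosable_leaves.
apply: choosable_sub h dD _ => x /hD [e [ae he]].
have [OW [TW eW hW]] := chart_nbhd ch.
have [u [v [h2 h3 h4]]] := shift_near_right b ord0 (a x) TW eW.
have [m [m1 m2 m3]] := dlo_min (R := rlt b) e v.
have am : rlt b (a x) m by case: m3 => ->.
have hm t : rlt b (a x) t -> rlt b t m -> Y x t /\ exists z, psi z = shift ord0 (a x) t.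
  by move=> h5 h6; split; [apply: he => //; dlo|apply: hW; apply: h4 => //; dlo].
(* If no coordinate moved to either side, all coordinates of the increment would be those of [z0]
   just past [a x], and the injective axis would repeat a value. *)
apply: NNPP => nl.
have d := shift_dmap ord0; have d' := dpsi.
have out (b' : bool) (j : 'I_n.+1) : exists e, rlt b (a x) e /\ forall t, rlt b (a x) t -> rlt b t e ->
    ~ exists z, psi z = shift ord0 (a x) t /\ rlt b' (z0 j) (z j).
  have dB : dset (fun t => exists z, psi z = shift ord0 (a x) t /\ rlt b' (z0 j) (z j)) by dd.
  have [e' [ae' [hin|hout]]] := germ omin b (a x) dB; last first.
    by exists e'; split=> // t h5 h6; apply: hout; split.
  exfalso; apply: nl; have lx : leaves b' j x; last by case: b' lx {dB hin} => lx; [right|left]; exists j.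
  have [m' [l1 l2 l3]] := dlo_min (R := rlt b) e' m; exists m'; split; first by case: l3 => ->.
  move=> t h5 h6; split; first by apply: (hm t h5 _).1; dlo.
  by apply: hin; split; dlo.
have allout k (f : 'I_k -> bool * 'I_n.+1) : exists e, rlt b (a x) e /\ forall i t, rlt b (a x) t -> rlt b t e ->
    ~ exists z, psi z = shift ord0 (a x) t /\ rlt (f i).1 (z0 (f i).2) (z (f i).2).
  elim: k f => [|k IH] f; first by exists m; split=> // -[].
  have [e1 [h5 h6]] := out (f ord0).1 (f ord0).2; have [e2 [h7 h8]] := IH (fun i => f (lift ord0 i)).
  have [m' [l1 l2 l3]] := dlo_min (R := rlt b) e1 e2; exists m'; split; first by case: l3 => ->.
  by move=> i t h9 h10; case: (unliftP ord0 i) => [j ->|->]; [apply: h8|apply: h6] => //; dlo.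
have [e1 [h5 h6]] := allout _ (fun i : 'I_#|{: bool * 'I_n.+1}| => enum_val i).
have [m' [l1 l2 l3]] := dlo_min (R := rlt b) e1 m.
have [t [t1 t2]] : exists t, rlt b (a x) t /\ rlt b t m' by apply: dlo_dense; case: l3 => ->.
have [|_ [z hz]] := hm t t1; first by dlo.
have zE j : z j = z0 j.
  have te1 : rlt b t e1 by dlo.
  have nb b' : ~ rlt b' (z0 j) (z j).
    by move=> hlt; apply: (h6 (enum_rank (b', j)) t t1 te1); rewrite enum_rankK; exists z.
  have n1 := nb false; have n2 := nb true; case: (dlo_total (R := @olt S) (z0 j) (z j)) => [hlt|[//|hlt]].
    by case: n1.
  by case: n2.
have e0 : z = z0 by apply: functional_extensionality.
have /(ldiv_eq1 (axis_in _ _) (axis_in _ _))/axis_inj e2 : shift ord0 (a x) t = gone G by rewrite -hz e0.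
by rewrite -e2 in t1; exact: dlo_irr t1.
Qed.
End Families.
End DefinableChoice.

(** * Sets that are invariant along paths *)

Section PathInvariant.
Variables (S : ostruct) (K : Type) (N : nat) (G : ldgroup S N) (T : (pt S N -> Prop) -> Prop).
Hypothesis omin : ominimal S.
Hypotheses (uncK : uncountable K) (sat : saturated S K).
Hypothesis tau : is_tau_topology G T.
Local Notation M := (carrier S).
Local Notation gpath := (gpath G T).
Variables (n : nat) (psi : pt S n.+1 -> pt S N) (z0 : pt S n.+1).
Hypothesis ch : chart G T psi z0.
Hypothesis dimG : has_dim (gset G) n.+1.
Let dpsi := chart_dmap ch.
Variables (U A : pt S N -> Prop).
Hypothesis UG : forall x, U x -> gset G x.
Hypothesis Apath : forall a b gam, gpath a b gam -> (forall t, ole a t -> ole t b -> U (gam t)) ->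
  (A (gam a) <-> A (gam b)).

Definition inner (B : M -> Prop) t := exists u v, (olt u t /\ olt t v) /\ forall s, olt u s -> olt s v -> B s.
Lemma inner_open B t : inner B t -> exists u v, (olt u t /\ olt t v) /\ forall s, olt u s -> olt s v -> inner B s.
Proof. by move=> [u [v [uv h]]]; exists u, v; split=> // s h1 h2; exists u, v. Qed.
Lemma inner_sub B t : inner B t -> B t.
Proof. by move=> [u [v [[h1 h2] h]]]; apply: h. Qed.
Lemma finite_boundary B : ~ infinite (fun t => B t /\ ~ inner B t).
Proof.
move=> [p [q [pq h]]]; have [t [pt tq]] := dlo_dense pq; have [_ ni] := h t pt tq; apply: ni.
by exists p, q; split=> // s h1 h2; case: (h s h1 h2).
Qed.

(** Arbitrary definable maps [F] are allowed, not just slices of [U]: points chosen as functions of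
    the parameters then fit the induction on [k]. *)
Definition traceable k := forall (X : pt S k -> Prop) (F : pt S k -> pt S N), dset X -> dmap F ->
  (forall x, X x -> U (F x)) -> dset (fun x => X x /\ A (F x)).

Section Step.
Variable k : nat.
Hypothesis IH : traceable k.

Lemma traceable_finite_fibres (Y : pt S k * M -> Prop) (F : pt S k * M -> pt S N) : dset Y -> dmap F ->
  (forall p, Y p -> U (F p)) -> (forall w, ~ infinite (fun t => Y (w, t))) -> dset (fun p => Y p /\ A (F p)).
Proof.
move=> dY dF YU fin.
(* [Z i] is the fibre without its [i] smallest points. *)
pose Z := fix Z i (w : pt S k) t : Prop := match i with 0 => Y (w, t)
  | i'.+1 => Z i' w t /\ exists t', Z i' w t' /\ olt t' t end.
have dZ i : dset (fun p : pt S k * M => Z i p.1 p.2).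
  elim: i => [|i IHi] /=; first by apply: dset_iff dY => -[].
  by dd.
have ZY i w t : Z i w t -> Y (w, t) by elim: i => [|i IHi] //= [/IHi].
have finZ i w : ~ infinite (Z i w).
  by move=> h; apply: (fin w); apply: infinite_sub h => t; apply: ZY.
have dZw i w : dset (Z i w) by apply: (dset_comp omin (g := fun t => (w, t)) (dZ i)); ddm.
pose mn i w t := Z i w t /\ forall t', Z i w t' -> ole t t'.
have dmn i : dset (fun p : pt S k * M => mn i p.1 p.2) by have h := dZ i; rewrite /mn; dd.
have mnex i w t : Z i w t -> exists m, mn i w m by move=> h; exact: (finite_dset_min omin (dZw i w) (finZ i w) h).
have mnuniq i w s t : mn i w s -> mn i w t -> s = t.
  by move=> [h1 h2] [h3 h4]; have h5 := h2 _ h3; have h6 := h4 _ h1; dlo.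
(* The sizes of the fibres are bounded uniformly: a fibre outlasting every [i] would contain the
   increasing sequence of its successive minima. *)
have [m hm] : exists m, forall w : pt S k, True -> forall t, ~ Z m w t.
  apply: (sat_cover_incr omin uncK sat (dset_true omin)).
  - by move=> i; have h := dZ i; dd.
  - by move=> i w h t [/h].
  move=> w _; apply: NNPP => h.
  have ex i : exists t, mn i w t.
    have [t Zt] : exists t, Z i w t.
      by apply: NNPP => h'; apply: h; exists i => t Zt; apply: h'; exists t.
    exact: mnex Zt.
  have [[d0] _] := omin.
  pose s i := epsilon (inhabits d0) (mn i w).
  have sP i : mn i w (s i) by apply: epsilon_spec; apply: ex.
  have inc i j : i < j -> olt (s i) (s j).
    elim: j => [|j IHj] //; have [[Zj [t' [Zt' lt']]] _] := sP j.+1; have [_ hj] := sP j.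
    have h1 := hj _ Zt'; rewrite ltnS leq_eqVlt => /orP [/eqP ->|/IHj h2]; dlo.
  apply: (fin w); apply: (infinite_of_seq omin (s := s)).
  - by apply: (dset_comp omin (g := fun t => (w, t)) dY); ddm.
  - by apply: (@rlt_seq_inj _ omin false).
  - by move=> i; have [h1 _] := sP i; apply: ZY h1.
(* Downward induction: [Z i] is [Z i.+1] together with its minima, and these form the graph of a
   definable function of [w], to which [IH] applies. *)
have key : forall j, j <= m -> dset (fun p : pt S k * M => Z (m - j) p.1 p.2 /\ A (F p)); last first.
  by have := key m (leqnn m); rewrite subnn; apply: dset_iff => -[w t] /=.
elim=> [|j IHj] jm.
  apply: (@dset_iff _ _ _ (fun _ : pt S k * M => False)); last by dd.
  by move=> [w t] /=; split=> // -[]; rewrite subn0 => h _; exact: (hm w I t h).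
have {IHj} := IHj (ltnW jm).
have -> : m - j = (m - j.+1).+1 by rewrite subnSK.
set i := m - j.+1 => IHj.
have dZi := dZ i; have dmni := dmn i.
pose Xi w := exists t, mn i w t.
have dXi : dset Xi by rewrite /Xi; dd.
have [[d0] _] := omin.
pose s w := epsilon (inhabits d0) (mn i w).
have sP w : Xi w -> mn i w (s w) by move=> h; apply: epsilon_spec.
have ds : dmapon Xi s.
  apply: (@dset_iff _ _ _ (fun p : pt S k * M => mn i p.1 p.2)); last by dd.
  move=> [w t] /=; split=> [h|[h ->]]; last exact: sP.
  by have Xw : Xi w by [exists t]; split=> //; apply: mnuniq h (sP _ Xw).
have ds' := dmap_ext omin d0 dXi ds; set s' := ext_by _ _ _ in ds'.
have h := IH (X := Xi) (F := fun w => F (w, s' w)) dXi.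
have {}h : dset (fun w => Xi w /\ A (F (w, s' w))).
  apply: h; first by ddm.
  by move=> w Xw; apply: YU; rewrite /s' ext_in //; have [h1 _] := sP w Xw; apply: ZY h1.
apply: (@dset_iff _ _ _ (fun p : pt S k * M => (Z i.+1 p.1 p.2 /\ A (F p)) \/
   (mn i p.1 p.2 /\ (Xi p.1 /\ A (F (p.1, s' p.1)))))).
  move=> [w t] /=; split=> [[[[h1 _] h2]|[h1 [h2 h3]]]|[h1 h2]].
  - by split.
  - split; first by case: h1.
    by rewrite /s' ext_in // (mnuniq _ _ _ _ (sP _ h2) h1) in h3.
  case: (classic (exists t', Z i w t' /\ olt t' t)) => h3; first by left.
  have ht : mn i w t.
    by split=> // t' h4; apply: dlo_leP => h5; apply: h3; exists t'.
  right; split=> //; have Xw : Xi w by exists t.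
  by split=> //; rewrite /s' ext_in // (mnuniq _ _ _ _ (sP _ Xw) ht).
apply: dset_or => //; apply: dset_and => //.
by apply: (dset_comp omin (g := fst) h); ddm.
Qed.

Lemma traceable_step : traceable k.+1.
Proof.
move=> X F dX dF XU.
have dins := dmap_ins omin (@ord0 k).
pose H (p : pt S k * M) := F (ins ord0 p.2 p.1).
pose Y (p : pt S k * M) := X (ins ord0 p.2 p.1).
have dY : dset Y by rewrite /Y; dd.
have dH : dmap H by rewrite /H; ddm.
have YU p : Y p -> U (H p) by apply: XU.
have key : dset (fun p => Y p /\ A (H p)); last first.
  have ddel := dmap_del omin (@ord0 k).
  apply: (@dset_iff _ _ _ (fun x => Y (del ord0 x, x ord0) /\ A (H (del ord0 x, x ord0)))).
    by move=> x; rewrite /Y /H insK.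
  by apply: (dset_comp omin (g := fun x : pt S k.+1 => (del ord0 x, x ord0)) key); ddm.
have din := dset_inbox omin ch; have dbx := dset_box omin n.+1.
pose E (q : pt S k * M * M) := Y q.1 /\ Y (q.1.1, q.2).
have dE : dset E by rewrite /E; dd.
have ddl : dmapon E (fun q => ldiv G (H q.1) (H (q.1.1, q.2))).
  by apply: (ldiv_dmapon omin uncK sat); [apply: dmapon_dmap => //; ddm|apply: dmapon_dmap => //; ddm| |];
    move=> q [h1 h2]; apply: UG; apply: YU.
have ddl' := dmap_ext omin (gone G) dE ddl; set dl := ext_by _ _ _ in ddl'.
(* Interior points of the fibre at which [H] is continuous, written with the total map [dl] so as to
   be definable; [BP] translates to [contat]. *)
pose B (p : pt S k * M) := inner (fun t => Y (p.1, t)) p.2 /\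
  forall a b, box a b z0 -> exists u v, (olt u p.2 /\ olt p.2 v) /\ forall s, olt u s -> olt s v ->
    Y (p.1, s) /\ inbox psi a b (dl (p, s)).
have dB : dset B by rewrite /B /inner; dd.
have BP w t : B (w, t) <-> inner (fun t => Y (w, t)) t /\ contat G psi z0 (fun t => H (w, t)) t.
  split=> -[h1 h2]; have Yt := inner_sub h1; split=> // a b hb.
    have [u [v [uv h]]] := h2 a b hb; exists u, v; split=> // s us sv.
    by have [Ys [z [hz ez]]] := h s us sv; exists z; rewrite -ez /dl ext_in.
  have [u [v [uv h]]] := h2 a b hb; have [u' [v' [uv' h']]] := h1.
  have [p [m1 m2 m3]] := dlo_max (R := @olt S) u u'.
  have [q [l1 l2 l3]] := dlo_min (R := @olt S) v v'.
  exists p, q; split; first by case: uv uv' => ? ? [? ?]; split; [case: m3 => ->|case: l3 => ->].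
  move=> s ps sq; have Ys : Y (w, s) by apply: h'; dlo.
  have [||z [hz ez]] := h s _ _; [by dlo|by dlo|].
  by split=> //; exists z; rewrite -ez /dl ext_in.
pose Yo (p : pt S k * M) := inner (fun t => B (p.1, t)) p.2.
have dYo : dset Yo by rewrite /Yo /inner; dd.
have YoB p : Yo p -> B p by case: p => w t; apply: (@inner_sub (fun t => B (w, t))).
have YoY p : Yo p -> Y p by case: p => w t /YoB/BP [/inner_sub].
have Yopen w t : Yo (w, t) -> exists u v, (olt u t /\ olt t v) /\ forall s, olt u s -> olt s v -> Yo (w, s).
  exact: (@inner_open (fun t => B (w, t))).
have dYw w : dset (fun t => Y (w, t)) by dd.
have dYow w : dset (fun t => Yo (w, t)) by dd.
have dBw w : dset (fun t => B (w, t)) by dd.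
(* The points lost are boundary points of the fibre, discontinuities of [H], and boundary points of
   [B]: three finite sets. *)
have finYYo w : ~ infinite (fun t => Y (w, t) /\ ~ Yo (w, t)).
  move=> h.
  have dIw : dset (fun t => inner (fun t => Y (w, t)) t) by rewrite /inner; dd.
  have h' : infinite (fun t => (Y (w, t) /\ ~ inner (fun t => Y (w, t)) t) \/
     ((inner (fun t => Y (w, t)) t /\ ~ B (w, t)) \/ (B (w, t) /\ ~ Yo (w, t)))).
    by apply: infinite_sub h => t [h1 h2]; case: (classic (B (w, t))) => h3; [|case: (classic (inner (fun t => Y (w, t)) t)) => h4]; tauto.
  case/(infinite_or omin): h'; [by dd|by dd|exact: finite_boundary|].
  case/(infinite_or omin); [by dd|by dd| |exact: finite_boundary].
  move=> [p [q [pq hpq]]].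
  have dHw : dmap (fun t => H (w, t)) by ddm.
  apply: (@finite_discontinuities _ K _ G T omin uncK sat tau _ psi z0 ch dimG (fun t => H (w, t)) p q dHw).
    by move=> t h1 h2; apply: UG; apply: YU; have [h3 _] := hpq t h1 h2; apply: inner_sub h3.
  exists p, q; split=> // t h1 h2; split=> // hc; have [h3 nB] := hpq t h1 h2; apply: nB; exact/BP.
have comp w s t : ole s t -> (forall u, ole s u -> ole u t -> Yo (w, u)) -> A (H (w, s)) <-> A (H (w, t)).
  move=> [st|-> //] hst.
  have pg : gpath s t (fun u => H (w, u)).
    apply: (path_of_contat omin tau ch) => //; first by ddm.
      by move=> u h1 h2; apply: UG; apply: YU; apply: YoY; apply: hst.
    by move=> u h1 h2; have /YoB/BP [] := hst u h1 h2.
  by apply: (Apath pg) => u h1 h2; apply: YU; apply: YoY; apply: hst.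
have compb b w s t : le (rlt b) s t -> (forall u, le (rlt b) s u -> le (rlt b) u t -> Yo (w, u)) -> A (H (w, s)) <-> A (H (w, t)).
  case: b => st h; last exact: comp.
  have ts : ole t s by case: st => [st|->]; [left|right].
  symmetry; apply: comp => // u h1 h2; apply: h; first by case: h2 => [h2|->]; [left|right].
  by case: h1 => [h1|->]; [left|right].
pose Ends b (p : pt S k * M) := ~ Yo p /\ exists e, rlt b p.2 e /\ forall t, rlt b p.2 t -> rlt b t e -> Yo (p.1, t).
have dEnds b : dset (Ends b) by rewrite /Ends; dd.
have finEnds b w : ~ infinite (fun t => Ends b (w, t)).
  move=> /(@infiniteE _ b) [p [q [pq h]]]; have [a [pa aq]] := dlo_dense pq.
  have [|_ [e [ae he]]] := h a; first by split.
  have [m [m1 m2 m3]] := dlo_min (R := rlt b) e q.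
  have [t [at_ tm]] : exists t, rlt b a t /\ rlt b t m by apply: dlo_dense; case: m3 => ->.
  have [|nt _] := h t; first by split; dlo.
  by apply: nt; apply: he => //; dlo.
(* The endpoints form a set with finite fibres, so [traceable_finite_fibres] decides [A] at a point
   chosen just past each of them. *)
have endsA b : exists c : pt S k * M -> M, dmap c /\ (forall p, Ends b p -> chosen b (fun p t => Yo (p.1, t)) snd p (c p)) /\
   dset (fun p => Ends b p /\ A (H (p.1, c p))).
  have dEb := dEnds b.
  have [|||c [dc hc]] := @choose_germ _ K _ G T omin uncK sat tau n psi z0 ch (pt S k * M)%type _ b
    (fun p t => Yo (p.1, t)) snd _ _ (Ends b) dEb _.
  - by dd.
  - by ddm.
  - by move=> p [].
  have [[d0] _] := omin.
  have dc' := dmap_ext omin d0 dEb dc; exists (ext_by (Ends b) c d0); split=> //.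
  have hc' p : Ends b p -> chosen b (fun p t => Yo (p.1, t)) snd p (ext_by (Ends b) c d0 p).
    by move=> Ep; rewrite ext_in //; apply: hc.
  split=> //; apply: traceable_finite_fibres => //; first by ddm.
  move=> p Ep; have [h1 h2] := hc' p Ep; apply: YU; apply: YoY; apply: h2 => //; by right.
have [c0 [dc0 [hc0 dA0]]] := endsA false; have [c1 [dc1 [hc1 dA1]]] := endsA true.
have [[d0] _] := omin.
have dAd : dset (fun p : pt S k * M => Yo (p.1, d0) /\ A (H (p.1, d0))).
  have h := IH (X := fun w => Yo (w, d0)) (F := fun w => H (w, d0)).
  have {}h : dset (fun w => Yo (w, d0) /\ A (H (w, d0))).
    by apply: h; [dd|ddm|move=> w h; apply: YU; apply: YoY].
  by apply: (dset_comp omin (g := fst) h); ddm.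
(* [p] lies in the component that starts at the endpoint [a], and [A] is tested at the chosen point
   of this component. *)
pose Q b c (p : pt S k * M) := exists a, rlt b a p.2 /\ (forall u, rlt b a u -> le (rlt b) u p.2 -> Yo (p.1, u)) /\
   (Ends b (p.1, a) /\ A (H (p.1, c (p.1, a)))).
have dQ b c : dset (fun p => Ends b p /\ A (H (p.1, c p))) -> dset (Q b c).
  move=> d; rewrite /Q; apply: dset_ex => //; apply: dset_and => //; first by dd.
  apply: dset_and => //; first by dd.
  by apply: (dset_comp omin (g := fun q : pt S k * M * M => (q.1.1, q.2)) d); ddm.
have dQ0 := dQ false c0 dA0; have dQ1 := dQ true c1 dA1.
(* A component equal to the whole line has no endpoint; there the fixed point [d0] is used. *)
pose Q2 (p : pt S k * M) := (forall u, (ole p.2 u /\ ole u d0) \/ (ole d0 u /\ ole u p.2) -> Yo (p.1, u)) /\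
  (Yo (p.1, d0) /\ A (H (p.1, d0))).
have dQ2 : dset Q2 by rewrite /Q2; apply: dset_and => //; dd.
have QA b c w t : (forall p, Ends b p -> chosen b (fun p t => Yo (p.1, t)) snd p (c p)) ->
   forall a, rlt b a t -> (forall u, rlt b a u -> le (rlt b) u t -> Yo (w, u)) -> Ends b (w, a) ->
   A (H (w, c (w, a))) <-> A (H (w, t)).
  move=> hc a at_ hat /hc [/= h1 h2].
  case: (classic (le (rlt b) (c (w, a)) t)) => h3.
    by apply: (@compb b) => // u h4 h5; apply: hat => //; dlo.
  symmetry; apply: (@compb b) => [|u h4 h5]; first by dlo.
  by apply: h2; dlo.
have dYn : dset (fun p => (Y p /\ ~ Yo p) /\ A (H p)).
  by apply: traceable_finite_fibres => //; [dd|move=> p [/YU]].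
apply: (@dset_iff _ _ _ (fun p => ((Y p /\ ~ Yo p) /\ A (H p)) \/ (Yo p /\ (Q false c0 p \/ (Q true c1 p \/ Q2 p))))); last by dd.
move=> [w t]; split.
  case=> [[[h1 _] h2] //|[Yt hQ]]; split; first exact: YoY.
  case: hQ => [[a [h1 [h2 [h3 h4]]]]|[[a [h1 [h2 [h3 h4]]]]|[h1 [h2 h3]]]].
  - exact/(QA _ _ _ _ hc0 a h1 h2 h3).
  - exact/(QA _ _ _ _ hc1 a h1 h2 h3).
  case: (classic (ole t d0)) => td.
    by apply/(comp w t d0 td) => // u *; apply: h1; left.
  have dt : ole d0 t by dlo.
  by apply/(comp w d0 t dt) => // u *; apply: h1; right.
move=> [Yt At]; case: (classic (Yo (w, t))) => Yot; last by left.
right; split=> //.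
case: (classic (exists y, ~ Yo (w, y))) => [[y ny]|nex]; last first.
  have all u : Yo (w, u) by apply: NNPP => h; apply: nex; exists u.
  right; right; split=> [u _|]; first exact: all.
  split; first exact: all.
  case: (classic (ole t d0)) => td; first by apply/(comp w t d0 td).
  have dt : ole d0 t by dlo.
  exact/(comp w d0 t dt).
have [b [a [na at_ hat]]] := open_end omin (dYow w) (Yopen w) Yot ny.
have Ea : Ends b (w, a) by split=> //; exists t; split=> // u h1 h2; apply: hat => //; left.
case: b at_ hat Ea => at_ hat Ea; [right; left|left]; exists a; split=> //; split=> //; split=> //.
  exact/(QA _ _ _ _ hc1 a at_ hat Ea).
exact/(QA _ _ _ _ hc0 a at_ hat Ea).
Qed.
End Step.

(* Slice U along coordinate lines of M^N: on all but finitely many points of a line the inclusion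
   into G is continuous, so A is constant on the remaining intervals, and one point chosen
   definably in each interval reduces the dimension. *)
Theorem path_invariant_definable : dset U -> dset (fun x => U x /\ A x).
Proof.
move=> dU.
have tr k : traceable k.
  elim: k => [|k IH]; last exact: traceable_step.
  move=> X F dX dF XU; have [[d0] _] := omin.
  apply: (@dset_iff _ _ _ (fun _ : pt S 0 => X (fun _ => d0) /\ A (F (fun _ => d0)))); last exact: dset_prop.
  by move=> x; rewrite (pt0_eq x (fun _ => d0)).
by apply: (tr N U id) => //; exact: dmap_id.
Qed.
End PathInvariant.

(** * Holonomy *)

Section Holonomy.
Variables (S : ostruct) (K : Type) (N N' : nat) (G : ldgroup S N) (G' : ldgroup S N').
Variables (T : (pt S N -> Prop) -> Prop) (U : pt S N -> Prop) (f : pt S N -> pt S N').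
Local Notation M := (carrier S).
Local Notation "x ** y" := (gmul G x y) (at level 40, left associativity).
Local Notation "x *' y" := (gmul G' x y) (at level 40, left associativity).
Local Hint Resolve gmul_in ginv_in gone_in ldiv_in : core.

Definition fine (gam : M -> pt S N) t' t :=
  ole t' t /\ forall u v, ole t' u -> ole u t -> ole t' v -> ole v t -> U (ldiv G (gam u) (gam v)).
(* Some subdivision of [a, t] into n fine steps has holonomy y. *)
Fixpoint hol (gam : M -> pt S N) a n t y := match n with
  | 0 => t = a /\ y = gone G'
  | n'.+1 => exists t' y', hol gam a n' t' y' /\ fine gam t' t /\
      y = y' *' f (ldiv G (gam t') (gam t))
  end.

Hypothesis omin : ominimal S.
Hypothesis UG : forall x, U x -> gset G x.
Hypothesis Ue : U (gone G).
Hypothesis fG : forall h, U h -> gset G' (f h).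
Hypothesis fM : forall h h', U h -> U h' -> U (h ** h') -> f (h ** h') = f h *' f h'.

Lemma f1 : f (gone G) = gone G'.
Proof.
have e : gone G ** gone G = gone G by rewrite gmul1 //; auto.
by apply: gidem; [apply: fG|rewrite -fM ?e].
Qed.

Section OnePath.
Variables (gam : M -> pt S N) (a b : M).
Hypothesis gamG : forall t, ole a t -> ole t b -> gset G (gam t).
Local Notation hol := (hol gam a).
Local Notation fine := (fine gam).

Lemma fine_sub t' t u v : fine t' t -> ole t' u -> ole u v -> ole v t -> fine u v.
Proof. by move=> [h1 h2] h3 h4 h5; split=> // w z h6 h7 h8 h9; apply: h2; dlo. Qed.
Lemma fine_U t' t : fine t' t -> U (ldiv G (gam t') (gam t)).
Proof. by move=> [h1 h2]; apply: h2 => //; by [right|]. Qed.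
Lemma fine_f t' u t : ole a t' -> ole t b -> fine t' t -> ole t' u -> ole u t ->
  f (ldiv G (gam t') (gam t)) = f (ldiv G (gam t') (gam u)) *' f (ldiv G (gam u) (gam t)).
Proof.
move=> h1 h2 h3 h4 h5; have h6 := h3.1.
have g1 : gset G (gam t') by apply: gamG; dlo.
have g2 : gset G (gam u) by apply: gamG; dlo.
have g3 : gset G (gam t) by apply: gamG; dlo.
rewrite -fM ?ldiv_trans //; last exact: fine_U.
- by apply: fine_U; apply: fine_sub h3 _ _ _ => //; right.
- by apply: fine_U; apply: fine_sub h3 _ _ _ => //; right.
Qed.
Lemma fine_refl t : ole a t -> ole t b -> fine t t.
Proof.
move=> h1 h2; split=> [|u v h3 h4 h5 h6]; first by right.
have -> : u = t by dlo.
have -> : v = t by dlo.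
by rewrite ldivxx //; apply: gamG.
Qed.
Lemma hol_ge n t y : hol n t y -> ole a t.
Proof.
elim: n t y => [|n IH] t y /=; first by case=> -> _; right.
by move=> [t' [y' [/IH h [[h' _] _]]]]; dlo.
Qed.
Lemma hol_in n t y : ole t b -> hol n t y -> gset G' y.
Proof.
elim: n t y => [|n IH] t y tb /=; first by case=> _ ->; auto.
move=> [t' [y' [h [h1 ->]]]]; apply: gmul_in; last by apply: fG; apply: fine_U.
by apply: (IH t') => //; have l := h1.1; dlo.
Qed.
Lemma hol_step n u t y : hol n u y -> fine u t -> hol n.+1 t (y *' f (ldiv G (gam u) (gam t))).
Proof. by move=> h h'; exists u, y. Qed.
Lemma hol_mono n m t y : n <= m -> ole t b -> hol n t y -> hol m t y.
Proof.
move=> nm tb; elim: m nm => [|m IH]; first by rewrite leqn0 => /eqP ->.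
rewrite leq_eqVlt => /orP [/eqP -> //|/IH{}IH /IH h].
have at_ := hol_ge h.
have e : y *' f (ldiv G (gam t) (gam t)) = y by rewrite ldivxx ?f1 ?gmulr1 //; [apply: hol_in h|apply: gamG].
by rewrite -e; apply: hol_step h (fine_refl _ _).
Qed.
Lemma hol_down n t y u : ole t b -> hol n t y -> ole a u -> ole u t -> exists y', hol n u y'.
Proof.
elim: n t y u => [|n IH] t y u tb; first by case=> -> _ h1 h2; exists (gone G'); split=> //; dlo.
move=> [t' [y' [h [h1 _]]]] h2 h3; have l := h1.1.
case: (classic (ole t' u)) => h4; last first.
  have [||||y2 hy2] := IH t' y' u => //; [dlo|dlo|].
  by exists y2; apply: (@hol_mono n) hy2 => //; dlo.
by exists (y' *' f (ldiv G (gam t') (gam u))), t', y'; split=> //; split=> //; apply: fine_sub h1 _ _ _ => //; right.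
Qed.
Lemma hol_start n y : ole a b -> hol n a y -> y = gone G'.
Proof.
move=> ab; have Ga : gset G (gam a) by apply: gamG => //; right.
elim: n y => [|n IH] y /=; first by case.
move=> [t' [y' [h [h1 ->]]]]; have h2 := hol_ge h; have h3 := h1.1.
have e : t' = a by dlo.
by rewrite e in h *; rewrite (IH _ h) ldivxx // f1 gmul1; auto.
Qed.
(** Of the two last division points, the later one splits the last step of the other subdivision, so
    the partial products up to it can be compared by induction. Inserting it lengthens one
    subdivision, yet [n + m] drops because both last steps are removed. *)
Lemma hol_unique n m t y z : ole t b -> hol n t y -> hol m t z -> y = z.
Proof.
move: {2}(n + m) (leqnn (n + m)) => k; elim: k n m t y z => [|k IH] n m t y z.
  by rewrite leqn0 addn_eq0 => /andP [/eqP -> /eqP ->] _ [_ ->] [_ ->].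
case: n => [|n]; first by move=> _ tb [ta ->]; rewrite ta in tb * => /(hol_start tb).
case: m => [|m]; first by move=> _ tb h [ta ->]; rewrite ta in tb h; exact: hol_start h.
rewrite addSn ltnS => nmk tb [t1 [y1 [h1 [h2 ->]]]] [t2 [z2 [k1 [k2 ->]]]].
have key n' m' s1 s2 v1 v2 : n' + m'.+1 <= k -> hol n' s1 v1 -> fine s1 t -> hol m' s2 v2 -> fine s2 t ->
   ole s2 s1 -> v1 *' f (ldiv G (gam s1) (gam t)) = v2 *' f (ldiv G (gam s2) (gam t)).
  move=> e hv1 f1' hv2 f2' ss; have [b1 b2] := (hol_ge hv1, hol_ge hv2); have [c1 c2] := (f1'.1, f2'.1).
  have fs : fine s2 s1 by apply: fine_sub f2' _ _ _ => //; right.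
  have -> : v1 = v2 *' f (ldiv G (gam s2) (gam s1)).
    by apply: (IH n' m'.+1 s1) => //; [dlo|exact: hol_step hv2 fs].
  rewrite (@fine_f s2 s1 t) // gmulA //; first by apply: hol_in hv2; dlo.
    by apply: fG; apply: fine_U.
  by apply: fG; apply: fine_U.
case: (classic (ole t2 t1)) => ss; first exact: (key n m).
by symmetry; apply: (key m n) => //; [rewrite addnS -addSn addnC|dlo].
Qed.
Lemma hol_fine n m u v y z : hol n u y -> hol m v z -> ole v b -> fine u v ->
  z = y *' f (ldiv G (gam u) (gam v)).
Proof. by move=> h1 h2 h3 h4; apply: (@hol_unique m n.+1 v) => //; apply: hol_step. Qed.
Lemma f_ldivC x y : gset G x -> gset G y -> U (ldiv G x y) -> U (ldiv G y x) ->
  f (ldiv G x y) *' f (ldiv G y x) = gone G'.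
Proof. by move=> gx gy h1 h2; rewrite -fM ?ldiv_trans ?ldivxx ?f1. Qed.
Lemma hol_near n m u v y z : hol n u y -> hol m v z -> ole u b -> ole v b ->
  (forall w w', (ole u w /\ ole w v) \/ (ole v w /\ ole w u) -> (ole u w' /\ ole w' v) \/ (ole v w' /\ ole w' u) ->
     U (ldiv G (gam w) (gam w'))) ->
  z = y *' f (ldiv G (gam u) (gam v)).
Proof.
move=> h1 h2 ub vb hU; have [au av] := (hol_ge h1, hol_ge h2).
case: (classic (ole u v)) => uv.
  by apply: (hol_fine h1 h2) => //; split=> // w w' *; apply: hU; left.
have vu : ole v u by dlo.
have fvu : fine v u by split=> // w w' *; apply: hU; right.
have [gu gv] : gset G (gam u) /\ gset G (gam v) by split; apply: gamG.
have [gy gz] : gset G' y /\ gset G' z by split; [apply: hol_in h1|apply: hol_in h2].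
have U1 : U (ldiv G (gam v) (gam u)) by exact: fine_U.
have U2 : U (ldiv G (gam u) (gam v)) by apply: hU; right; split=> //; right.
by rewrite (hol_fine h2 h1 ub fvu) -gmulA ?f_ldivC ?gmulr1 //; apply: fG.
Qed.
End OnePath.

Lemma hol_transl gam a b g n t y : gset G g -> (forall t, ole a t -> ole t b -> gset G (gam t)) ->
  ole t b -> hol gam a n t y -> hol (fun t => g ** gam t) a n t y.
Proof.
move=> gg hG; elim: n t y => [|n IH] t y tb //= [t' [y' [h [h1 ->]]]].
have at' := hol_ge h; have l := h1.1.
exists t', y'; split; first by apply: IH => //; dlo.
have E u v : ole t' u -> ole u t -> ole t' v -> ole v t ->
   ldiv G (g ** gam u) (g ** gam v) = ldiv G (gam u) (gam v).
  by move=> *; rewrite ldiv_mull //; apply: hG; dlo.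
split; last by rewrite E //; right.
by split=> // u v *; rewrite E //; apply: h1.2.
Qed.
Lemma hol_eq gam gam' a b n t y : (forall t, ole a t -> ole t b -> gam t = gam' t) ->
  ole t b -> hol gam a n t y -> hol gam' a n t y.
Proof.
move=> E; elim: n t y => [|n IH] t y tb //= [t' [y' [h [h1 ->]]]].
have at' := hol_ge h; have l := h1.1.
exists t', y'; split; first by apply: IH => //; dlo.
split; last by rewrite !E //; dlo.
by split=> // u v *; rewrite -!E; try dlo; apply: h1.2.
Qed.
Lemma hol_const x a b : ole a b -> gset G x -> hol (fun _ => x) a 1 b (gone G').
Proof.
move=> ab gx; exists a, (gone G'); split=> //; split.
  by split=> // u v *; rewrite ldivxx.
by rewrite ldivxx // f1 gmul1; auto.
Qed.

Hypothesis tau : is_tau_topology G T.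
Hypothesis nU : nbhd T U (gone G).

Lemma path_fine_nbhd a b gam t : gpath G T a b gam -> ole a t -> ole t b ->
  exists p q, [/\ olt p t, olt t q & forall u v, ole a u -> ole u b -> ole a v -> ole v b ->
    olt p u -> olt u q -> olt p v -> olt v q -> U (ldiv G (gam u) (gam v))].
Proof.
move=> [ab dg hG hc] h1 h2; have [O [TO [Oe OU]]] := nU.
have [O' [TO' O't h]] := open_ldivxx tau TO Oe (hG _ h1 h2).
have [p [q [pt tq hpq]]] := hc _ h1 h2 O' TO' O't.
by exists p, q; split=> // u v *; apply: OU; apply: h; apply: hpq.
Qed.

Hypotheses (uncK : uncountable K) (sat : saturated S K).
Variable V : pt S N -> Prop.
Hypothesis dV : dset V.
Hypothesis VG : forall x, V x -> gset G x.
Hypothesis genV : left_generic K G V.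
Hypothesis VU : forall x y, V x -> V y -> U (ldiv G x y).

(** Genericity yields fewer than kappa translates of [V], and saturation reduces them to finitely
    many. *)
Lemma generic_cover (X : Type) (cX : coded S X) (D : X -> Prop) (g : X -> pt S N) :
  dmapon D g -> (forall x, D x -> gset G (g x)) ->
  exists k (h : 'I_k -> pt S N), (forall j, gset G (h j)) /\
     (forall j, dset (fun x => D x /\ V (ldiv G (h j) (g x)))) /\
     forall x, D x -> exists j, V (ldiv G (h j) (g x)).
Proof.
move=> dg hg; have [A [cA [AG hA]]] := genV.
have dE c : gset G c -> dset (fun x => D x /\ V (ldiv G c (g x))).
  move=> gc; apply: (dset_compon omin (g := fun x => ldiv G c (g x)) dV).
  apply: (ldiv_dmapon omin uncK sat) => //.
  by apply: dmapon_dmap => //; [apply: dmapon_dom dg|ddm].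
have [||k [h hh]] := @sat_cover _ _ omin sat _ _ {x | A x} D (fun c x => D x /\ V (ldiv G (sval c) (g x))) cA (dmapon_dom omin dg).
- by move=> [c Ac]; apply: dE; apply: AG.
- move=> x Dx; have [c [v [Ac Vv e]]] := (hA (g x)).1 (hg _ Dx); exists (exist _ c Ac); split=> //=.
  by rewrite e gmulK //; [apply: AG|apply: VG].
exists k, (fun j => sval (h j)); split=> [j|]; first by apply: AG; apply: svalP.
split=> [j|x Dx]; first by apply: dE; apply: AG; apply: svalP.
by have [j []] := hh _ Dx; exists j.
Qed.

(* Otherwise the points that fine steps can reach form a cut. Finitely many translates of V cover the
   path, by genericity and saturation, and one of them contains a whole interval around the cut. *)
Lemma hol_total a b gam : gpath G T a b gam -> exists n y, hol gam a n b y.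
Proof.
move=> pg; have [ab dg hG hc] := pg; apply: NNPP => nb.
(* Points before [a] are included to make [Q] an initial segment of the whole line. *)
pose Q t := olt t a \/ ole t b /\ exists n y, hol gam a n t y.
have Qa : Q a by right; split; [dlo|exists 0, (gone G')].
have nQb : ~ Q b by case=> [h|[]] //; dlo.
have [k [h [gh [dh hh]]]] := generic_cover dg (fun t ht => hG t ht.1 ht.2).
have Qdn t u : Q t -> olt u t -> Q u.
  move=> [h1|[h1 [n [y hy]]]] h2; first by left; dlo.
  case: (classic (olt u a)) => h3; [by left|right]; split; first by dlo.
  by have [|||y' ?] := hol_down hG (t := t) (u := u) _ hy; [dlo|dlo|dlo|exists n, y'].
have Qup t u : Q t -> ole a t -> ole u b -> fine gam t u -> Q u.
  move=> [h1|[h1 [n [y hy]]]] h2 h3 h4; first by dlo.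
  by right; split=> //; exists n.+1, (y *' f (ldiv G (gam t) (gam u))); apply: hol_step.
have nomax t : Q t -> exists u, olt t u /\ Q u.
  move=> Qt; case: (classic (olt t a)) => ta.
    by have [u [h1 h2]] := dlo_dense ta; exists u; split=> //; left.
  have tb : olt t b by apply: dlo_ltP => -[h'|h']; apply: nQb; [apply: Qdn Qt h'|rewrite h'].
  have [||p [q [pt tq hpq]]] := path_fine_nbhd (t := t) pg; [dlo|dlo|].
  have [m [m1 m2 m3]] := dlo_min (R := @olt S) q b.
  have [u [u1 u2]] : exists u, olt t u /\ olt u m by apply: dlo_dense; case: m3 => ->.
  exists u; split=> //; apply: (Qup t) => //; [dlo|dlo|].
  by split=> [|v w *]; [dlo|apply: hpq; dlo].
have nomin t : ~ Q t -> exists u, olt u t /\ ~ Q u.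
  move=> nQt; case: (classic (olt b t)) => tb.
    by exists b.
  have ta : olt a t by apply: dlo_ltP => -[h'|h']; apply: nQt; [left|rewrite h'].
  have [||p [q [pt tq hpq]]] := path_fine_nbhd (t := t) pg; [dlo|dlo|].
  have [m [m1 m2 m3]] := dlo_max (R := @olt S) p a.
  have [u [u1 u2]] : exists u, olt m u /\ olt u t by apply: dlo_dense; case: m3 => ->.
  exists u; split=> // Qu; apply: nQt; apply: (Qup u) => //; [dlo|dlo|].
  by split=> [|v w *]; [dlo|apply: hpq; dlo].
have sep q c : Q q -> ~ Q c -> olt q c.
  move=> Qq Qc; apply: dlo_ltP => -[e|e]; apply: Qc; first exact: Qdn Qq e.
  by rewrite e.
pose X (j : 'I_k) t := (ole a t /\ ole t b) /\ V (ldiv G (h j) (gam t)).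
have [q [c [Qq nQc hX]]] := cut_constant omin Qa nQb Qdn nomax nomin dh.
have [q1 [q11 Qq1]] := nomax _ Qq; have [c1 [c11 nQc1]] := nomin _ nQc.
have qc1 := sep _ _ Qq1 nQc1.
have Qm : exists q2, [/\ Q q2, olt q q2 & ole a q2].
  have [m [m1 m2 m3]] := dlo_max (R := @olt S) q1 a; exists m.
  by split; [case: m3 => ->|dlo|].
have [q2 [Qq2 qq2 aq2]] := Qm.
have cm : exists c2, [/\ ~ Q c2, olt c2 c & ole c2 b].
  have [m [m1 m2 m3]] := dlo_min (R := @olt S) c1 b; exists m.
  by split; [case: m3 => ->|dlo|].
have [c2 [nQc2 cc2 cb2]] := cm; have qc2 := sep _ _ Qq2 nQc2.
have [|j Vj] := hh q2; first by split; dlo.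
have Xall t : int false q c t -> X j t.
  move=> it; case: (hX j) => h'; first exact: h'.
  case: (h' q2); first by split; dlo.
  have h2 : ole a q2 /\ ole q2 b by split; dlo.
  exact: conj h2 Vj.
(* Between [q] and [c] the path stays in one translate of [V], so its increments are quotients of
   elements of [V] and a single fine step crosses the cut. *)
apply: nQc2; apply: (Qup q2) => //; split=> [|u v h1 h2 h3 h4]; first by dlo.
have [|[_ _] Vu] := Xall u; first by split; dlo.
have [|[_ _] Vv] := Xall v; first by split; dlo.
have [h5 h6] : gset G (gam u) /\ gset G (gam v) by split; apply: hG; dlo.
suff <- : ldiv G (ldiv G (h j) (gam u)) (ldiv G (h j) (gam v)) = ldiv G (gam u) (gam v) by apply: VU.
by apply: ldiv_mull => //; apply: ginv_in.
Qed.

Hypothesis dU : dset U.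
Hypothesis df : dmapon U f.

Section Family.
Context {X : Type} {cX : coded S X}.
Variables (h : X * M -> pt S N) (Dx : X -> Prop) (a b : M).
Local Notation Dom := (fun p : X * M => Dx p.1 /\ (ole a p.2 /\ ole p.2 b)).
Hypothesis dh : dmapon Dom h.
Hypothesis hG : forall p, Dom p -> gset G (h p).
Hypothesis dDx : dset Dx.

(** With [n] fixed, every step adds one existential quantifier, over the division point and the
    partial product. The parameter in [X] allows for all rows of a rectangle at once. *)
Lemma hol_definable n : dset (fun p : X * M * pt S N' =>
  Dom p.1 /\ hol (fun t => h (p.1.1, t)) a n p.1.2 p.2).
Proof.
have dDom : dset Dom by dd.
pose D2 (w : X * M * M) := Dom w.1 /\ Dom (w.1.1, w.2).
have dD2 : dset D2 by rewrite /D2; dd.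
have ddiv : dmapon D2 (fun w : X * M * M => ldiv G (h w.1) (h (w.1.1, w.2))).
  apply: (ldiv_dmapon omin uncK sat); try by move=> w []; auto.
    by apply: (dmapon_comp omin dh (g := fun w : X * M * M => w.1)) => [|w []//]; apply: dmapon_dmap => //; ddm.
  by apply: (dmapon_comp omin dh (g := fun w : X * M * M => (w.1.1, w.2))) => [|w []//]; apply: dmapon_dmap => //; ddm.
pose del := ext_by D2 (fun w : X * M * M => ldiv G (h w.1) (h (w.1.1, w.2))) (gone G).
have ddel : dmap del by apply: dmap_ext.
have delE x u v : Dom (x, u) -> Dom (x, v) -> del (x, u, v) = ldiv G (h (x, u)) (h (x, v)).
  by move=> h1 h2; rewrite /del ext_in.
pose fine' (w : X * M * M) := ole w.1.2 w.2 /\ forall u v, ole w.1.2 u -> ole u w.2 -> ole w.1.2 v -> ole v w.2 -> U (del (w.1.1, u, v)).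
have dfine : dset fine' by rewrite /fine'; dd.
have fineE x u v : Dom (x, u) -> Dom (x, v) -> fine (fun t => h (x, t)) u v <-> fine' (x, u, v).
  move=> [/= h1 [h1' h1'']] [_ /= [h2 h2']].
  have HK w : ole u w -> ole w v -> Dom (x, w) by move=> h5 h6; split=> //=; split; dlo.
  split=> -[h3 h4]; split=> //= s t h5 h6 h7 h8; have [ks kt] := (HK s h5 h6, HK t h7 h8).
    by rewrite delE //; apply: h4.
  by rewrite -delE //; apply: h4.
pose phi := ext_by U f (gone G').
have dphi : dmap phi by apply: dmap_ext.
elim: n => [|n IH] /=; first by dd.
pose D3 (w : X * M * (M * pt S N')) := [/\ Dom w.1, fine' (w.1.1, w.2.1, w.1.2) &
   Dom (w.1.1, w.2.1) /\ hol (fun t => h (w.1.1, t)) a n w.2.1 w.2.2].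
have dD3 : dset D3.
  have dH : dset (fun w : X * M * (M * pt S N') => Dom (w.1.1, w.2.1) /\ hol (fun t => h (w.1.1, t)) a n w.2.1 w.2.2).
    by apply: (dset_comp omin (g := fun w : X * M * (M * pt S N') => (w.1.1, w.2.1, w.2.2)) IH); ddm.
  apply: (@dset_iff _ _ _ (fun w => Dom w.1 /\ (fine' (w.1.1, w.2.1, w.1.2) /\
    (Dom (w.1.1, w.2.1) /\ hol (fun t => h (w.1.1, t)) a n w.2.1 w.2.2)))).
    by move=> w; split=> [[? []]|[]].
  by dd.
have D3U w : D3 w -> U (del (w.1.1, w.2.1, w.1.2)).
  by case: w => -[x t] [t' y'] [h1 [h2 h3] h4]; apply: h3 => //; right.
have dm : dmapon D3 (fun w : X * M * (M * pt S N') => w.2.2 *' phi (del (w.1.1, w.2.1, w.1.2))).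
  apply: (gmul_dmapon omin uncK sat).
  - by apply: dmapon_dmap => //; ddm.
  - by apply: dmapon_dmap => //; ddm.
  - move=> [[x t] [t' y']] [[h1 h2] h3 [h4 h5]]; apply: (@hol_in (fun t => h (x, t)) a b n t' y') => //.
    by case: h4 => _ [].
  - by move=> w /D3U h1; rewrite /phi ext_in //; apply: fG.
rewrite /dmapon in dm.
apply: (@dset_iff _ _ _ (fun p : X * M * pt S N' => exists w : M * pt S N',
  D3 (p.1, w) /\ p.2 = w.2 *' phi (del (p.1.1, w.1, p.1.2)))); last first.
  apply: (dset_ex omin (P := fun (p : X * M * pt S N') w => D3 (p.1, w) /\ p.2 = w.2 *' phi (del (p.1.1, w.1, p.1.2)))).
  by apply: (dset_comp omin (g := fun q : X * M * pt S N' * (M * pt S N') => (q.1.1, q.2, q.1.2)) dm); ddm.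
move=> [[x t] y] /=; split.
  move=> [[t' y'] [hD ->]] /=; have hU := D3U _ hD; move: hD => [/= h1 h2 [h3 h4]].
  split=> //; exists t', y'; split=> //; split; first exact/fineE.
  by rewrite /phi ext_in // delE.
move=> [h1 [t' [y' [h2 [h3 ->]]]]].
have at' := hol_ge h2; have l := h3.1.
have h4 : Dom (x, t') by split=> /=; [tauto|split; [|case: h1 => _ [_ ?]]; dlo].
exists (t', y'); split=> /=; first by split=> //=; apply/fineE.
rewrite /phi delE // ext_in //.
by apply: (@fine_U (fun t => h (x, t))).
Qed.
End Family.

(** * Holonomy around a rectangle *)

Section Rectangle.
Variables (H : M * M -> pt S N) (a b c d : M).
Local Notation sq := (fun p : M * M => (ole a p.1 /\ ole p.1 b) /\ (ole c p.2 /\ ole p.2 d)).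
Hypotheses (ab : olt a b) (cd : olt c d).
Hypothesis dH : dmapon sq H.
Hypothesis HG : forall p, sq p -> gset G (H p).
Hypothesis HC : forall p, sq p -> forall O, T O -> O (H p) -> exists p1 q1 p2 q2,
  [/\ olt p1 p.1 /\ olt p.1 q1, olt p2 p.2 /\ olt p.2 q2 &
   forall u, sq u -> olt p1 u.1 -> olt u.1 q1 -> olt p2 u.2 -> olt u.2 q2 -> O (H u)].
Hypothesis Hl : forall s, ole c s -> ole s d -> H (a, s) = H (a, c).

Lemma dmapon_row s : ole c s -> ole s d -> dmapon (fun t => ole a t /\ ole t b) (fun t => H (t, s)).
Proof.
move=> h1 h2; apply: (dmapon_comp omin dH (g := fun t => (t, s))) => [|t [h3 h4]] //.
by apply: dmapon_dmap => //; [exact: dset_ival|ddm].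
Qed.
Lemma dmapon_col t : ole a t -> ole t b -> dmapon (fun s => ole c s /\ ole s d) (fun s => H (t, s)).
Proof.
move=> h1 h2; apply: (dmapon_comp omin dH (g := fun s => (t, s))) => [|s [h3 h4]] //.
by apply: dmapon_dmap => //; [exact: dset_ival|ddm].
Qed.
Lemma path_row s : ole c s -> ole s d -> gpath G T a b (fun t => H (t, s)).
Proof.
move=> h1 h2; split=> //; first exact: dmapon_row.
  by move=> t h3 h4; apply: HG.
move=> t h3 h4 O TO Ot; have [||p1 [q1 [p2 [q2 [[h5 h6] [h7 h8] h9]]]]] := @HC (t, s) _ O TO => //.
by exists p1, q1; split=> // u *; apply: h9.
Qed.
Lemma path_col t : ole a t -> ole t b -> gpath G T c d (fun s => H (t, s)).
Proof.
move=> h1 h2; split=> //; first exact: dmapon_col.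
  by move=> s h3 h4; apply: HG.
move=> s h3 h4 O TO Ot; have [||p1 [q1 [p2 [q2 [[h5 h6] [h7 h8] h9]]]]] := @HC (t, s) _ O TO => //.
by exists p2, q2; split=> // u *; apply: h9.
Qed.
Lemma rect_fine_nbhd t s : sq (t, s) -> exists p1 q1 p2 q2,
  [/\ olt p1 t /\ olt t q1, olt p2 s /\ olt s q2 &
   forall u v, sq u -> sq v -> olt p1 u.1 -> olt u.1 q1 -> olt p2 u.2 -> olt u.2 q2 ->
      olt p1 v.1 -> olt v.1 q1 -> olt p2 v.2 -> olt v.2 q2 -> U (ldiv G (H u) (H v))].
Proof.
move=> hs; have [O [TO [Oe OU]]] := nU.
have [O' [TO' O't h]] := open_ldivxx tau TO Oe (HG hs).
have [p1 [q1 [p2 [q2 [h1 h2 h3]]]]] := HC hs TO' O't.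
by exists p1, q1, p2, q2; split=> // u v *; apply: OU; apply: h; apply: h3.
Qed.

(* For nearby heights s and s0 the holonomies of the rows up to abscissa t differ by the value of f
   on the increment from H(t, s) to H(t, s0); this starts from the constant left edge and
   propagates along t. Hence the set of heights at which the identity holds is clopen in [c, d]. *)
Lemma hol_rectangle n0 n1 n2 y0 y1 r : hol (fun t => H (t, c)) a n0 b y0 ->
  hol (fun t => H (t, d)) a n1 b y1 -> hol (fun s => H (b, s)) c n2 d r -> y1 = y0 *' r.
Proof.
move=> hy0 hy1 hr.
pose h1 (p : M * M) := H (p.2, p.1).
have dh1 : dmapon (fun p : M * M => (ole c p.1 /\ ole p.1 d) /\ (ole a p.2 /\ ole p.2 b)) h1.
  apply: (dmapon_comp omin dH (g := fun p : M * M => (p.2, p.1))) => [|p []] //.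
  by apply: dmapon_dmap => //; [dd|ddm].
have h1G p : (ole c p.1 /\ ole p.1 d) /\ (ole a p.2 /\ ole p.2 b) -> gset G (h1 p) by case=> ? ?; apply: HG.
have dI1 : dset (fun s => ole c s /\ ole s d) by exact: dset_ival.
have dI2 : dset (fun s => ole a s /\ ole s b) by exact: dset_ival.
pose L n s t y := ((ole c s /\ ole s d) /\ (ole a t /\ ole t b)) /\ hol (fun t => H (t, s)) a n t y.
have dL n : dset (fun p : M * M * pt S N' => L n p.1.1 p.1.2 p.2) by exact: (hol_definable dh1 h1G dI1).
pose E n s r := ((ole a b /\ ole b b) /\ (ole c s /\ ole s d)) /\ hol (fun s => H (b, s)) c n s r.
have dE n : dset (fun p : M * pt S N' => E n p.1 p.2).
  have HG' p : (ole a p.1 /\ ole p.1 b) /\ (ole c p.2 /\ ole p.2 d) -> gset G (H p) by apply: HG.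
  have h := hol_definable dH HG' dI2 n.
  by apply: (dset_comp omin (g := fun p : M * pt S N' => (b, p.1, p.2)) h); ddm.
(* One number of steps for all rows: the relation [L n] then gives their holonomy definably. *)
have [n hn] : exists n, forall s, ole c s /\ ole s d -> exists y, L n s b y.
  apply: (sat_cover_incr omin uncK sat dI1).
  - by move=> i; have dLi := dL i; dd.
  - move=> i s [y [h2 h3]]; exists y; split=> //.
    by apply: (hol_mono (b := b)) h3 => //; [move=> t ? ?; apply: HG; tauto|right].
  - move=> s [h2 h3]; have [m [y hm]] := hol_total (path_row h2 h3).
    by exists m, y; split=> //; split=> //; split; [left|right].
have Lt s t : ole c s -> ole s d -> ole a t -> ole t b -> exists y, L n s t y.
  move=> h2 h3 h4 h5; have [|y [_ hy]] := hn s; first by split.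
  have [||y' hy'] := @hol_down (fun t => H (t, s)) a b _ n b y t _ hy h4 h5; last by exists y'.
    by move=> u ? ?; apply: HG.
  by right.
have Luniq s t y y' : L n s t y -> L n s t y' -> y = y'.
  move=> [[h2 [h3 h4]] h5] [_ h6]; apply: (@hol_unique (fun t => H (t, s)) a b) h5 h6 => //.
  by move=> u ? ?; apply: HG.
have LG s t y : L n s t y -> gset G' y.
  move=> [[h2 [h3 h4]] h5]; exact: (@hol_in (fun t => H (t, s)) a b) h5.
have cc : ole c c by right.
have cd' : ole c d by left.
have ab' : ole a b by left.
have dd' : ole d d by right.
have bb : ole b b by right.
have aa : ole a a by right.
have key s0 : ole c s0 -> ole s0 d -> exists p2 q2, [/\ olt p2 s0, olt s0 q2 & forall s, olt p2 s -> olt s q2 ->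
   ole c s -> ole s d -> forall y y0, L n s b y -> L n s0 b y0 -> U (ldiv G (H (b, s)) (H (b, s0))) /\
     y0 = y *' f (ldiv G (H (b, s)) (H (b, s0)))].
  move=> cs sd.
  pose del (p : M * M) := ext_by (fun p : M * M => sq p) (fun p => ldiv G (H p) (H (p.1, s0))) (gone G) p.
  have dsq : dset (fun p : M * M => sq p) by dd.
  have ddel : dmap del.
    apply: (dmap_ext omin (gone G) dsq); apply: (ldiv_dmapon omin uncK sat) => //; last by move=> p []; auto.
    by apply: (dmapon_comp omin dH (g := fun p : M * M => (p.1, s0))) => [|p []] //; apply: dmapon_dmap => //; ddm.
  pose phi := ext_by U f (gone G').
  have dphi : dmap phi by apply: dmap_ext.
  pose D4 (w : M * M * (pt S N' * pt S N')) := (L n w.1.2 w.1.1 w.2.1 /\ L n s0 w.1.1 w.2.2) /\ U (del w.1).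
  have dLn := dL n.
  have dD4 : dset D4 by rewrite /D4; dd.
  have dm : dset (fun p : M * M * (pt S N' * pt S N') * pt S N' => D4 p.1 /\ p.2 = p.1.2.1 *' phi (del p.1.1)).
    apply: (@gmul_dmapon _ _ _ G' omin uncK sat _ _ D4 (fun w => w.2.1) (fun w => phi (del w.1))).
    - by apply: dmapon_dmap => //; ddm.
    - by apply: dmapon_dmap => //; ddm.
    - by move=> w [[/LG]].
    - by move=> w [_ h]; rewrite /phi ext_in //; apply: fG.
  (* The neighborhood of [s0] is quantified inside [Q] and may shrink as [t] advances; this leaves a
     definable condition on [t] alone, fit for [interval_ind]. *)
  pose Q t := exists p2 q2, (olt p2 s0 /\ olt s0 q2) /\ forall s, olt p2 s -> olt s q2 -> ole c s -> ole s d ->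
     exists y y0 , D4 (t, s, (y, y0)) /\ y0 = y *' phi (del (t, s)).
  have dQ : dset Q.
    have dm' : dset (fun w : M * M * pt S N' * pt S N' => D4 (w.1.1.1, w.1.1.2, (w.1.2, w.2)) /\
       w.2 = w.1.2 *' phi (del (w.1.1.1, w.1.1.2))).
      by apply: (dset_comp omin (g := fun w : M * M * pt S N' * pt S N' => (w.1.1.1, w.1.1.2, (w.1.2, w.2), w.2)) dm); ddm.
    rewrite /Q; apply: dset_ex => //; apply: dset_ex => //; apply: dset_and => //; first by dd.
    apply: dset_all => //; do 4! [apply: dset_imp => //; first by dd].
    apply: dset_ex => //; apply: dset_ex => //.
    apply: (dset_comp omin (g := fun w : M * M * M * M * pt S N' * pt S N' => (w.1.1.1.1.1, w.1.1.2, w.1.2, w.2)) dm').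
    by ddm.
  have D4E t s y y1' : ole a t -> ole t b -> ole c s -> ole s d ->
    (D4 (t, s, (y, y1')) /\ y1' = y *' phi (del (t, s))) <->
    [/\ L n s t y, L n s0 t y1', U (ldiv G (H (t, s)) (H (t, s0))) & y1' = y *' f (ldiv G (H (t, s)) (H (t, s0)))].
    move=> h2 h3 h4 h5; rewrite /D4 /= /del ext_in //.
    split=> [[[[h6 h7] h8] e]|[h6 h7 h8 e]]; first by split=> //; rewrite e /phi ext_in.
    by split=> //; rewrite e /phi ext_in.
  (* On the constant left edge the holonomies and the increment between rows are trivial. *)
  have Qa : Q a.
    have [p hp] := dlo_below (R := @olt S) s0; have [q hq] := dlo_above (R := @olt S) s0.
    exists p, q; split=> // s _ _ h2 h3; exists (gone G'), (gone G'); apply/D4E => //.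
    have H0 s' : ole c s' -> ole s' d -> L n s' a (gone G').
      move=> h4 h5; have [y hy] := Lt _ _ h4 h5 aa ab'.
      have -> : gone G' = y; last by [].
      apply: (@hol_unique (fun t => H (t, s')) a b _ 0 n a _ _ ab') hy.2 => //.
      by move=> u ? ?; apply: HG.
    have -> : H (a, s) = H (a, s0) by rewrite !Hl.
    rewrite ldivxx; last by apply: HG.
    by split; [apply: H0|apply: H0|exact: Ue|rewrite f1 gmulr1; auto].
  have Qstep t0 : ole a t0 -> ole t0 b -> exists p q, [/\ olt p t0, olt t0 q &
     forall t t', olt p t -> olt t q -> ole a t -> ole t b -> olt p t' -> olt t' q -> ole a t' -> ole t' b -> Q t -> Q t'].
    move=> h2 h3; have [|p1 [q1 [p2 [q2 [[h4 h5] [h6 h7] hU]]]]] := @rect_fine_nbhd t0 s0; first by [].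
    exists p1, q1; split=> // t t' k1 k2 k3 k4 k5 k6 k7 k8 [p3 [q3 [[k9 k10] hQ]]].
    have [p [l1 l2 l3]] := dlo_max (R := @olt S) p2 p3.
    have [q [r1 r2 r3]] := dlo_min (R := @olt S) q2 q3.
    exists p, q; split; first by split; [case: l3 => ->|case: r3 => ->].
    move=> s ps sq cs' sd'.
    have [p3s [sq3 [p2s sq2]]] : olt p3 s /\ olt s q3 /\ olt p2 s /\ olt s q2 by do ! split; dlo.
    have [y [ys0 /D4E]] := hQ s p3s sq3 cs' sd'; case=> // L1 L2 Ud Ey.
    have [y' L1'] := Lt _ _ cs' sd' k7 k8; have [ys0' L2'] := Lt _ _ cs sd k7 k8.
    exists y', ys0'; apply/D4E => //.
    have BU u v : ole a u.1 -> ole u.1 b -> ole a v.1 -> ole v.1 b -> olt p1 u.1 -> olt u.1 q1 -> olt p1 v.1 -> olt v.1 q1 ->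
       u.2 = s \/ u.2 = s0 -> v.2 = s \/ v.2 = s0 -> U (ldiv G (H u) (H v)).
      case: u => [u1 u2]; case: v => [v1 v2] /= *.
      have E2 w : w = s \/ w = s0 -> [/\ ole c w, ole w d, olt p2 w & olt w q2] by case=> ->.
      have [] := E2 u2 => // *; have [] := E2 v2 => // *.
      by apply: hU.
    have NE s' z1 z2 : s' = s \/ s' = s0 -> L n s' t z1 -> L n s' t' z2 ->
        z2 = z1 *' f (ldiv G (H (t, s')) (H (t', s'))).
      move=> es [[[cs1 sd1] _] m1] [_ m2].
      apply: (@hol_near (fun t => H (t, s')) a b _ n n t t') => //.
        by move=> u ? ?; apply: HG.
      by move=> w w' h8 h9; apply: BU => //=; case: h8 => -[? ?]; case: h9 => -[? ?]; dlo.
    have E1 : y' = y *' f (ldiv G (H (t, s)) (H (t', s))) by apply: NE => //; left.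
    have E2 : ys0' = ys0 *' f (ldiv G (H (t, s0)) (H (t', s0))) by apply: NE => //; right.
    have g1 : gset G (H (t, s)) by apply: HG.
    have g2 : gset G (H (t', s)) by apply: HG.
    have g3 : gset G (H (t, s0)) by apply: HG.
    have g4 : gset G (H (t', s0)) by apply: HG.
    have gy := LG _ _ _ L1.
    have U1 : U (ldiv G (H (t', s)) (H (t', s0))) by apply: BU => //=; auto.
    have U2 : U (ldiv G (H (t, s)) (H (t', s))) by apply: BU => //=; auto.
    have U3 : U (ldiv G (H (t, s0)) (H (t', s0))) by apply: BU => //=; auto.
    have U4 : U (ldiv G (H (t, s)) (H (t', s0))) by apply: BU => //=; auto.
    (* Both ways around the small quadrilateral give the value of [f] on the diagonal increment from
       [H (t, s)] to [H (t', s0)], which [U4] places in [U]. *)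
    split=> //; rewrite E2 Ey E1 -!gmulA //; try exact: fG.
    by rewrite -!fM // ?ldiv_trans.
  have Qb : Q b.
    apply: (@interval_ind _ omin a b Q dQ Qa) => // t0 h2 h3; have [p [q [h4 h5 h6]]] := Qstep t0 h2 h3.
    by exists p, q; split=> // u *; split; apply: h6.
  have [p2 [q2 [[h2 h3] hQ]]] := Qb.
  exists p2, q2; split=> // s h4 h5 h6 h7 y ys0 L1 L2.
  have [y' [ys0' /D4E]] := hQ s h4 h5 h6 h7; case=> // L1' L2' Ud.
  by rewrite (Luniq _ _ _ _ L1 L1') (Luniq _ _ _ _ L2 L2').
have y0G : gset G' y0 by exact: (@hol_in (fun t => H (t, c)) a b _ _ _ bb hy0).
have Et s : ole c s -> ole s d -> exists r, E n2 s r.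
  move=> h2 h3; have [||r' hr'] := @hol_down (fun s => H (b, s)) c d _ n2 d r s _ hr h2 h3.
  - by move=> u ? ?; apply: HG.
  - by [].
  - by exists r'.
have HGb u : ole c u -> ole u d -> gset G (H (b, u)) by move=> ? ?; apply: HG.
have EG s r' : E n2 s r' -> gset G' r' by move=> [[_ [h2 h3]] h4]; exact: (@hol_in (fun s => H (b, s)) c d) h4.
have Euniq s r1 r2 : E n2 s r1 -> E n2 s r2 -> r1 = r2.
  by move=> [[_ [h2 h3]] h4] [_ h5]; apply: (@hol_unique (fun s => H (b, s)) c d) h4 h5.
pose D5 (w : M * (pt S N' * pt S N')) := L n w.1 b w.2.1 /\ E n2 w.1 w.2.2.
have dLn := dL n; have dEn := dE n2.
have dD5 : dset D5 by rewrite /D5; dd.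
have dm5 : dset (fun p : M * (pt S N' * pt S N') * pt S N' => D5 p.1 /\ p.2 = y0 *' p.1.2.2).
  apply: (@gmul_dmapon _ _ _ G' omin uncK sat _ _ D5 (fun w => y0) (fun w => w.2.2)) => //.
  - by apply: dmapon_dmap => //; ddm.
  - by apply: dmapon_dmap => //; ddm.
  - by move=> w [_ /EG].
pose Z s := exists w : pt S N' * pt S N', D5 (s, w) /\ w.1 = y0 *' w.2.
have dZ : dset Z.
  rewrite /Z; apply: dset_ex => //.
  by apply: (dset_comp omin (g := fun q : M * (pt S N' * pt S N') => ((q.1, q.2), q.2.1)) dm5); ddm.
have ZE s y r' : L n s b y -> E n2 s r' -> (Z s <-> y = y0 *' r').
  move=> h2 h3; split=> [[[y' r2] [[/= h4 h5]]]|h4]; last by exists (y, r').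
  by rewrite (Luniq _ _ _ _ h2 h4) (Euniq _ _ _ h3 h5).
have Zc : Z c.
  have Ec : E n2 c (gone G').
    have [r' hr'] := Et c cc cd'.
    suff -> : gone G' = r' by [].
    by apply: (@hol_unique (fun s => H (b, s)) c d _ 0 n2 c _ _ cd') hr'.2.
  have [y hy] := Lt c b cc cd' ab' bb.
  apply/(ZE c y (gone G')) => //; rewrite gmulr1 //.
  by apply: (@hol_unique (fun t => H (t, c)) a b) hy.2 hy0 => // u ? ?; apply: HG.
have Zd : Z d.
  apply: (@interval_ind _ omin c d Z dZ Zc) => // s0 h2 h3.
  have [p2 [q2 [h4 h5 h6]]] := key s0 h2 h3.
  have [p3 [q3 [h7 h8 h9]]] := path_fine_nbhd (path_col ab' bb) h2 h3.
  have [p [l1 l2 l3]] := dlo_max (R := @olt S) p2 p3.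
  have [q [r1 r2 r3]] := dlo_min (R := @olt S) q2 q3.
  exists p, q; split; [by case: l3 => ->|by case: r3 => ->|] => s h10 h11 h12 h13.
  have [y hy] := Lt s b h12 h13 ab' bb; have [ys hys] := Lt s0 b h2 h3 ab' bb.
  have [r4 hr4] := Et _ h12 h13; have [r5 hr5] := Et _ h2 h3.
  have [p2s sq2] : olt p2 s /\ olt s q2 by split; dlo.
  have [U1 E1] := h6 s p2s sq2 h12 h13 y ys hy hys.
  have E2 : r5 = r4 *' f (ldiv G (H (b, s)) (H (b, s0))).
    apply: (@hol_near (fun s => H (b, s)) c d _ n2 n2 s s0) => //; [exact: hr4.2|exact: hr5.2|].
    by move=> w w' k1 k2; apply: h9; case: k1 => -[? ?]; case: k2 => -[? ?]; dlo.
  have [gr4 gy] := (EG _ _ hr4, LG _ _ _ hy).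
  have gf := fG U1.
  (* From [s] to [s0] the holonomy of the row and that of the right edge gain the same right factor,
     which cancels. *)
  rewrite (ZE s y r4) // (ZE s0 ys r5) // E1 E2 gmulA //; split=> [->|] // e.
  by apply: (@gmul_injr _ _ G' _ _ (f (ldiv G (H (b, s)) (H (b, s0))))) => //; auto.
have Ed : E n2 d r by [].
have [y hy] := Lt d b cd' dd' ab' bb.
have -> : y1 = y by apply: (@hol_unique (fun t => H (t, d)) a b) hy1 hy.2 => // u ? ?; apply: HG.
by apply/(ZE d y r).
Qed.
End Rectangle.

(** * Pointwise products of paths and extension by constants *)

Local Notation gpath := (gpath G T).

Definition lmin (x y : M) := if excluded_middle_informative (olt x y) then x else y.
Lemma lminP x y : [/\ ole (lmin x y) x, ole (lmin x y) y & lmin x y = x \/ lmin x y = y].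
Proof.
rewrite /lmin; case: excluded_middle_informative => h /=; split; [by right|by left|by left| |by right|by right].
by dlo.
Qed.
Lemma dmap_lmin : dmap (fun p : M * M => lmin p.1 p.2).
Proof.
apply: (@dset_iff _ _ _ (fun p : M * M * M => (olt p.1.1 p.1.2 /\ p.2 = p.1.1) \/ (~ olt p.1.1 p.1.2 /\ p.2 = p.1.2))).
  move=> [[x y] z] /=; rewrite /lmin; case: excluded_middle_informative => h /=; tauto.
by dd.
Qed.
Definition clamp (a b t : M) :=
  if excluded_middle_informative (olt t a) then a else
  if excluded_middle_informative (olt b t) then b else t.
Lemma clamp_low a b t : ole t a -> olt a b -> clamp a b t = a.
Proof.
rewrite /clamp => h ab; case: excluded_middle_informative => h' //=.
by case: excluded_middle_informative => h'' /=; dlo.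
Qed.
Lemma clamp_high a b t : ole b t -> olt a b -> clamp a b t = b.
Proof.
rewrite /clamp => h ab; case: excluded_middle_informative => h' /=; first by dlo.
by case: excluded_middle_informative => h'' /= //; dlo.
Qed.
Lemma clamp_id a b t : ole a t -> ole t b -> clamp a b t = t.
Proof.
rewrite /clamp => h ab; case: excluded_middle_informative => h' /=; first by dlo.
by case: excluded_middle_informative => h'' /= //; dlo.
Qed.
Lemma clamp_in a b t : olt a b -> ole a (clamp a b t) /\ ole (clamp a b t) b.
Proof.
move=> ab; rewrite /clamp; case: excluded_middle_informative => h /=; first by split; dlo.
by case: excluded_middle_informative => h' /=; split; dlo.
Qed.
Lemma dmap_clamp a b : dmap (clamp a b).
Proof.
apply: (@dset_iff _ _ _ (fun p : M * M => (olt p.1 a /\ p.2 = a) \/ (~ olt p.1 a /\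
   ((olt b p.1 /\ p.2 = b) \/ (~ olt b p.1 /\ p.2 = p.1))))); last by dd.
move=> [t u] /=; rewrite /clamp; case: excluded_middle_informative => h /=; first by tauto.
by case: excluded_middle_informative => h' /=; tauto.
Qed.

Lemma gpath_mul a b g1 g2 : gpath a b g1 -> gpath a b g2 -> gpath a b (fun t => g1 t ** g2 t).
Proof.
move=> [ab d1 G1 c1] [_ d2 G2 c2]; split=> //.
- by apply: (gmul_dmapon omin uncK sat) => // x []; auto.
- by move=> *; apply: gmul_in; auto.
move=> t h1 h2 O TO Ot.
have [O1 [O2 [TO1 TO2 e1 e2 hO]]] := open_gmul tau TO (G1 _ h1 h2) (G2 _ h1 h2) Ot.
have [p1 [q1 [h3 h4 h5]]] := c1 t h1 h2 _ TO1 e1.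
have [p2 [q2 [h6 h7 h8]]] := c2 t h1 h2 _ TO2 e2.
have [p [l1 l2 l3]] := dlo_max (R := @olt S) p1 p2.
have [q [r1 r2 r3]] := dlo_min (R := @olt S) q1 q2.
exists p, q; split; [by case: l3 => ->|by case: r3 => ->|] => u *.
by apply: hO; [apply: h5|apply: h8] => //; dlo.
Qed.
Lemma gpath_inv a b g : gpath a b g -> gpath a b (fun t => ginv G (g t)).
Proof.
move=> [ab d1 G1 c1]; split=> //.
- by apply: (ginv_dmapon omin uncK sat) => // x []; auto.
- by move=> *; apply: ginv_in; auto.
move=> t h1 h2 O TO Ot.
have [O' [TO' e' hO]] := open_ginv tau TO (G1 _ h1 h2) Ot.
have [p [q [h3 h4 h5]]] := c1 t h1 h2 _ TO' e'.
by exists p, q; split=> // u *; apply: hO; apply: h5.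
Qed.
Lemma gpath_transl a b g c : gset G c -> gpath a b g -> gpath a b (fun t => c ** g t).
Proof. by move=> gc pg; apply: gpath_mul => //; apply: path_const => //; case: pg. Qed.

Lemma hol_total' a b gam : gpath a b gam -> exists n y, hol gam a n b y.
Proof. exact: hol_total. Qed.

(* Apply the rectangle lemma to H(t,s) = g1 t * g2 (min t s): its bottom edge is g1, its right
   edge a translate of g2, and its top edge the pointwise product. *)
Lemma hol_mul a b g1 g2 n1 n2 n3 y1 y2 y3 : gpath a b g1 -> gpath a b g2 -> g2 a = gone G ->
  hol g1 a n1 b y1 -> hol g2 a n2 b y2 -> hol (fun t => g1 t ** g2 t) a n3 b y3 -> y3 = y1 *' y2.
Proof.
move=> [ab d1 G1 c1] [_ d2 G2 c2] e2 h1 h2 h3.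
have aa : ole a a by right. have bb : ole b b by right. have ab' : ole a b by left.
have lmin_in t s : ole a t -> ole t b -> ole a s -> ole s b -> ole a (lmin t s) /\ ole (lmin t s) b.
  by move=> *; have [l1 l2 []->] := lminP t s.
apply: (@hol_rectangle (fun p => g1 p.1 ** g2 (lmin p.1 p.2)) a b a b ab ab _ _ _ _ n1 n3 n2).
- have dI : dset (fun t => ole a t /\ ole t b) by exact: dset_ival.
  have dsq : dset (fun p : M * M => (ole a p.1 /\ ole p.1 b) /\ (ole a p.2 /\ ole p.2 b)) by dd.
  apply: (gmul_dmapon omin uncK sat).
  + by apply: (dmapon_comp omin d1 (g := fst)) => [|p []//]; apply: dmapon_dmap => //; ddm.
  + apply: (dmapon_comp omin d2 (g := fun p : M * M => lmin p.1 p.2)).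
      by apply: dmapon_dmap => //; exact: dmap_lmin.
    by move=> [t s] [[? ?] [? ?]]; apply: lmin_in.
  + by move=> p [[? ?] _]; apply: G1.
  + by move=> [t s] [[k1 k2] [k3 k4]]; have [? ?] := lmin_in t s k1 k2 k3 k4; apply: G2.
- move=> [t s] /= [[k1 k2] [k3 k4]]; have [k5 k6] := lmin_in t s k1 k2 k3 k4.
  by apply: gmul_in; auto.
- move=> [t s] /= [[k1 k2] [k3 k4]] O TO Ot; have [k5 k6] := lmin_in t s k1 k2 k3 k4.
  have [O1 [O2 [TO1 TO2 f1' f2' hO]]] := open_gmul tau TO (G1 _ k1 k2) (G2 _ k5 k6) Ot.
  have [p1 [q1 [i1 i2 i3]]] := c1 t k1 k2 _ TO1 f1'.
  have [p2 [q2 [i4 i5 i6]]] := c2 _ k5 k6 _ TO2 f2'.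
  have [l1 l2 l3] := lminP t s.
  have [p [m1 m2 m3]] := dlo_max (R := @olt S) p1 p2.
  have [B hB] := dlo_above (R := @olt S) s.
  have pt' : olt p t by case: m3 => ->; dlo.
  (* The upper bound on the minimum is imposed on a coordinate that attains it; when this is [t],
     [B] is just some bound above [s]. *)
  case: (classic (ole t s)) => ts.
    have tq2 : olt t q2 by case: l3 => e; rewrite e in i5; dlo.
    have [q [r1 r2 r3]] := dlo_min (R := @olt S) q1 q2.
    exists p, q, p2, B; split; [split=> //; by case: r3 => -> | split; dlo|].
    move=> [t' s'] /= [[j1 j2] [j3 j4]] j5 j6 j7 j8.
    have [j9 j10] := lmin_in t' s' j1 j2 j3 j4; have [l4 l5 l6] := lminP t' s'.
    apply: hO; first by apply: i3 => //; dlo.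
    by apply: i6 => //; last dlo; case: l6 => ->; dlo.
  have sq2 : olt s q2 by case: l3 => e; rewrite e in i5; dlo.
  exists p, q1, p2, q2; split; [split=> // | split; dlo|].
  move=> [t' s'] /= [[j1 j2] [j3 j4]] j5 j6 j7 j8.
  have [j9 j10] := lmin_in t' s' j1 j2 j3 j4; have [l4 l5 l6] := lminP t' s'.
  apply: hO; first by apply: i3 => //; dlo.
  by apply: i6 => //; last dlo; case: l6 => ->; dlo.
- move=> s as_ sb /=; congr (_ ** g2 _); have [l1 l2 l3] := lminP a s; have [l4 l5 l6] := lminP a a.
  by case: l3 => e; rewrite e in l1 *; case: l6 => ->; dlo.
- apply: (hol_eq _ bb h1) => // t at_ tb /=; have [l1 l2 l3] := lminP t a.
  have -> : lmin t a = a by case: l3 => e; rewrite e in l2 *; dlo.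
  by rewrite e2 gmulr1 //; apply: G1.
- apply: (hol_eq _ bb h3) => // t at_ tb /=; have [l1 l2 l3] := lminP t b.
  by have -> : lmin t b = t by case: l3 => e; rewrite e in l1 *; dlo.
- apply: (hol_eq _ bb (hol_transl (G1 _ ab' bb) G2 bb h2)) => t at_ tb /=.
  have [l1 l2 l3] := lminP b t.
  by have -> : lmin b t = t by case: l3 => e; rewrite e in l2 *; dlo.
Qed.

Lemma gpath_clamp a b p q g : ole p a -> ole b q -> gpath a b g -> gpath p q (fun t => g (clamp a b t)).
Proof.
move=> pa bq [ab d1 G1 c1]; have pq : olt p q by dlo.
have hin t := clamp_in t ab.
split=> //.
- apply: (dmapon_comp omin d1 (g := clamp a b)) => [|t _]; last exact: hin.
  by apply: dmapon_dmap => //; [exact: dset_ival|exact: dmap_clamp].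
- by move=> t _ _; have [? ?] := hin t; apply: G1.
move=> t _ _ O TO Ot; have [k1 k2] := hin t.
have [p1 [q1 [h1 h2 h3]]] := c1 _ k1 k2 _ TO Ot.
case: (classic (olt t a)) => ta.
  have [B hB] := dlo_below (R := @olt S) t.
  exists B, a; split=> // u _ ua _ _; rewrite clamp_low; [|by left|by []].
  by rewrite clamp_low in Ot; [|by left|by []].
case: (classic (olt b t)) => bt.
  have [B hB] := dlo_above (R := @olt S) t.
  exists b, B; split=> // u bu _ _ _; rewrite clamp_high; [|by left|by []].
  by rewrite clamp_high in Ot; [|by left|by []].
rewrite clamp_id in h1 h2; [|by dlo|by dlo].
exists p1, q1; split=> // u pu uq _ _; have [k3 k4] := hin u; apply: h3 => //.
  case: (classic (ole u b)) => ub; last by rewrite clamp_high; dlo.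
  case: (classic (ole a u)) => au; first by rewrite clamp_id.
  by rewrite clamp_low; dlo.
case: (classic (ole u b)) => ub; last by rewrite clamp_high; dlo.
case: (classic (ole a u)) => au; first by rewrite clamp_id.
by rewrite clamp_low; dlo.
Qed.
(** One constant step is added at each end, hence [n.+2]. *)
Lemma hol_clamp a b p q g n y : ole p a -> ole b q -> gpath a b g -> hol g a n b y ->
  hol (fun t => g (clamp a b t)) p n.+2 q y.
Proof.
move=> pa bq pg hy; have [ab d1 G1 c1] := pg.
have aa : ole a a by right. have bb : ole b b by right. have ab' : ole a b by left.
have Ga : gset G (g a) by apply: G1. have Gb : gset G (g b) by apply: G1.
have key m t z : ole t b -> hol g a m t z -> hol (fun t => g (clamp a b t)) p m.+1 t z.
  elim: m t z => [|m IH] t z tb.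
    move=> [-> ->]; exists p, (gone G'); split=> //; rewrite !clamp_low //; split.
      split=> // u v h1 h2 h3 h4; rewrite !clamp_low //; by rewrite ldivxx.
    by rewrite ldivxx // f1 gmul1; auto.
  move=> [t' [z' [h1 [[h2 h3] ->]]]]; have at' := hol_ge h1.
  exists t', z'; split; first by apply: IH => //; dlo.
  rewrite !clamp_id; try dlo; split=> //.
  by split=> // u v h4 h5 h6 h7; rewrite !clamp_id; try dlo; apply: h3.
exists b, y; split; first exact: key.
rewrite (clamp_id ab' bb) clamp_high //; split; last first.
  rewrite ldivxx // f1 gmulr1 //; exact: (@hol_in g a b _ _ _ bb hy).
by split=> // u v h1 h2 h3 h4; rewrite !clamp_high // ldivxx.
Qed.

(** * The extension and its agreement with [f] on [U] *)

Hypothesis sc : simply_connected G T.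

Lemma hol_loop a b g n y : gpath a b g -> g a = gone G -> g b = gone G -> hol g a n b y -> y = gone G'.
Proof.
move=> pg ga gb hy; have [ab d1 G1 c1] := pg.
have [_ sl] := sc; have [c [d [H [[cd ldH] HG HC Htop Hside]]]] := sl a b _ _ (ldpath_of_path omin pg) ga gb.
have aa : ole a a by right. have bb : ole b b by right. have ab' : ole a b by left.
have cc : ole c c by right. have dd' : ole d d by right. have cd' : ole c d by left.
have pE (u : pt S 2) : u = pt2 (u ord0) (u ord_max).
  apply: functional_extensionality => i; rewrite /pt2; case: eqP => h; congr u; apply: val_inj => //.
  by case: i h => -[|[|]].
have dsqq : dset (square a b c d).
  by apply: (@dset_iff _ _ _ (fun x : pt S 2 => (ole a (x ord0) /\ ole (x ord0) b) /\ (ole c (x ord_max) /\ ole (x ord_max) d))) => //; dd.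
have sqE t s : ole a t -> ole t b -> ole c s -> ole s d -> square a b c d (pt2 t s) by [].
have dpt2 : dmap (fun p : M * M => pt2 p.1 p.2).
  apply: (@dset_iff _ _ _ (fun p : M * M * pt S 2 => p.2 ord0 = p.1.1 /\ p.2 ord_max = p.1.2)); last by dd.
  by move=> [[t s] u] /=; split=> [[<- <-]|->].
have dH : dmapon (square a b c d) H by apply/(defmapP omin); apply: ldH.
have -> : y = y *' gone G' by rewrite gmulr1 //; exact: (@hol_in g a b _ _ _ bb hy).
symmetry.
(* The loop is the bottom edge; the constant top and right edges take one step each. *)
apply: (@hol_rectangle (fun p => H (pt2 p.1 p.2)) a b c d ab cd _ _ _ _ n 1 1).
- apply: (dmapon_comp omin dH (g := fun p : M * M => pt2 p.1 p.2)) => [|p [[? ?] [? ?]]]; last exact: sqE.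
  by apply: dmapon_dmap => //; dd.
- by move=> [t s] [[? ?] [? ?]]; apply: HG; apply: sqE.
- move=> [t s] /= [[k1 k2] [k3 k4]] O TO Ot.
  have [p [q [hpq h]]] := HC (pt2 t s) (sqE _ _ k1 k2 k3 k4) O TO Ot.
  exists (p ord0), (q ord0), (p ord_max), (q ord_max); split; [exact: (hpq ord0)|exact: (hpq ord_max)|].
  move=> [t' s'] /= [[k5 k6] [k7 k8]] *; apply: h; first exact: sqE.
  move=> i; rewrite /pt2; case: eqP => e; first by have -> : i = ord0 by apply: val_inj.
  have -> : i = ord_max by apply: val_inj; case: i e => -[|[|]].
  by [].
- by move=> s k1 k2 /=; have [-> _] := Hside s (conj k1 k2); have [-> _] := Hside c (conj cc cd').
- by apply: (hol_eq _ bb hy) => // t k1 k2 /=; have [-> _] := Htop t (conj k1 k2).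
- apply: (hol_eq (gam := fun _ => gone G) (b := b)) => //; last by apply: hol_const; auto.
  by move=> t k1 k2 /=; have [_ ->] := Htop t (conj k1 k2).
- apply: (hol_eq (gam := fun _ => gone G) (b := d)) => //; last by apply: hol_const; auto.
  by move=> s k1 k2 /=; have [_ ->] := Hside s (conj k1 k2).
Qed.

Definition hol_to g y := exists a b gam n,
  [/\ gpath a b gam, gam a = gone G, gam b = g & hol gam a n b y].

(* Paths on different intervals of M cannot be concatenated, but they can be extended by
   constants to a common interval and multiplied pointwise. *)
Lemma hol_to_common g h y z : hol_to g y -> hol_to h z -> exists p q,
  (exists gam n, [/\ gpath p q gam, gam p = gone G, gam q = g & hol gam p n q y]) /\
  (exists gam n, [/\ gpath p q gam, gam p = gone G, gam q = h & hol gam p n q z]).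
Proof.
move=> [a [b [gam [n [p1 p2 p3 p4]]]]] [a' [b' [gam' [n' [k1 k2 k3 k4]]]]].
have [p [m1 m2 m3]] := dlo_min (R := @olt S) a a'.
have [q [l1 l2 l3]] := dlo_max (R := @olt S) b b'.
have [ab _ _ _] := p1; have [ab' _ _ _] := k1.
exists p, q; split.
  exists (fun t => gam (clamp a b t)), n.+2; split; [exact: gpath_clamp| | |exact: hol_clamp].
    by rewrite clamp_low.
  by rewrite clamp_high.
exists (fun t => gam' (clamp a' b' t)), n'.+2; split; [exact: gpath_clamp| | |exact: hol_clamp].
  by rewrite clamp_low.
by rewrite clamp_high.
Qed.
Lemma hol_to_total g : gset G g -> exists y, hol_to g y.
Proof.
move=> gg; have [pc _] := sc; have [a [b [gam [p1 p2 p3]]]] := pc _ _ (gone_in G) gg.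
have pg := path_of_ldpath omin p1.
by have [n [y hy]] := hol_total' pg; exists y, a, b, (fun t => gam (pt1 t)), n.
Qed.
Lemma hol_to_in g y : hol_to g y -> gset G g /\ gset G' y.
Proof.
move=> [a [b [gam [n [[ab _ hG _] _ <- hy]]]]].
have bb : ole b b by right. have ab' : ole a b by left.
by split; [exact: hG|exact: (@hol_in gam a b _ _ _ bb hy)].
Qed.
(** Both paths are multiplied pointwise by the inverse of the second one. The results are loops at
    the identity, so with [w] the holonomy of the inverse path, [y *' w] and [z *' w] are both
    trivial. *)
Lemma hol_to_unique g y z : hol_to g y -> hol_to g z -> y = z.
Proof.
move=> hy hz; have [gg gy] := hol_to_in hy; have [_ gz] := hol_to_in hz.
have [p [q [[g1 [n1 [p1 p2 p3 p4]]] [g2 [n2 [k1 k2 k3 k4]]]]]] := hol_to_common hy hz.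
have pi := gpath_inv k1; have [n3 [w hw]] := hol_total' pi.
have [n4 [y4 h4]] := hol_total' (gpath_mul p1 pi).
have [n5 [y5 h5]] := hol_total' (gpath_mul k1 pi).
have i1 : ginv G (g2 p) = gone G by rewrite k2 -[LHS](gmulr1 (ginv_in (gone_in G))) gmulV; auto.
have e4 := hol_mul p1 pi i1 p4 hw h4.
have e5 := hol_mul k1 pi i1 k4 hw h5.
have gw : gset G' w by have qq : ole q q by [right]; exact: (@hol_in _ p q _ _ _ qq hw).
apply: (@gmul_injr _ _ G' _ _ w) => //; rewrite -e4 -e5.
rewrite (hol_loop (gpath_mul p1 pi) _ _ h4) ?(hol_loop (gpath_mul k1 pi) _ _ h5) //.
- by rewrite i1 k2 gmul1; auto.
- by rewrite k3 gmulVr.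
- by rewrite i1 p2 gmul1; auto.
- by rewrite p3 k3 gmulVr.
Qed.
Lemma hol_to_mul g h y z : hol_to g y -> hol_to h z -> hol_to (g ** h) (y *' z).
Proof.
move=> hy hz; have [p [q [[g1 [n1 [p1 p2 p3 p4]]] [g2 [n2 [k1 k2 k3 k4]]]]]] := hol_to_common hy hz.
have pm := gpath_mul p1 k1; have [n3 [w hw]] := hol_total' pm.
exists p, q, (fun t => g1 t ** g2 t), n3; split=> //.
- by rewrite p2 k2 gmul1; auto.
- by rewrite p3 k3.
- by rewrite -(hol_mul p1 k1 k2 p4 k4 hw).
Qed.

Definition extension (g : pt S N) : pt S N' := epsilon (inhabits (gone G')) (hol_to g).
Lemma extensionP g : gset G g -> hol_to g (extension g).
Proof. by move/hol_to_total; apply: epsilon_spec. Qed.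
Lemma extension_in g : gset G g -> gset G' (extension g).
Proof. by move/extensionP/hol_to_in => []. Qed.
Lemma extensionM g h : gset G g -> gset G h -> extension (g ** h) = extension g *' extension h.
Proof.
by move=> gg gh; apply: hol_to_unique; [apply: extensionP; auto|apply: hol_to_mul; apply: extensionP].
Qed.
(** Translated to start at the identity, the path keeps its increments and hence its holonomy. *)
Lemma extension_path a b gam n y : gpath a b gam -> hol gam a n b y ->
  extension (gam b) = extension (gam a) *' y.
Proof.
move=> pg hy; have [ab _ gG _] := pg.
have aa : ole a a by right. have bb : ole b b by right. have ab' : ole a b by left.
have ga : gset G (gam a) by exact: gG. have gb : gset G (gam b) by exact: gG.
have h : hol_to (ldiv G (gam a) (gam b)) y.
  exists a, b, (fun t => ldiv G (gam a) (gam t)), n; split=> //; [|by rewrite ldivxx|].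
    by apply: gpath_transl; auto.
  by apply: (hol_transl (ginv_in ga) gG bb).
have <- : extension (ldiv G (gam a) (gam b)) = y by apply: hol_to_unique h; apply: extensionP; auto.
by rewrite -extensionM ?ldivK; auto.
Qed.
Lemma extension1 : extension (gone G) = gone G'.
Proof.
by apply: gidem; [apply: extension_in; auto|rewrite -extensionM ?gmul1; auto].
Qed.

(* Along a path in U, both f and the extension are multiplied by the holonomy. *)
Lemma agree_along_path a b gam : gpath a b gam -> (forall t, ole a t -> ole t b -> U (gam t)) ->
  extension (gam a) = f (gam a) <-> extension (gam b) = f (gam b).
Proof.
move=> pg gU; have [ab _ gG _] := pg.
have aa : ole a a by right. have bb : ole b b by right. have ab' : ole a b by left.
have [n [y hy]] := hol_total' pg; rewrite (extension_path pg hy).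
have key m t z : ole t b -> hol gam a m t z -> f (gam t) = f (gam a) *' z.
  elim: m t z => [|m IH] t z tb; first by move=> [-> ->]; rewrite gmulr1 //; apply: fG; apply: gU.
  move=> [t' [z' [h1 [h2 ->]]]]; have at' := hol_ge h1; have l := h2.1.
  have t'b : ole t' b by dlo.
  have U1 := fine_U h2.
  rewrite gmulA //; [|by apply: fG; apply: gU|exact: (@hol_in gam a b _ _ _ t'b h1)|by apply: fG].
  have [g1 g2] : gset G (gam t') /\ gset G (gam t) by split; apply: gG; dlo.
  rewrite -(IH _ _ t'b h1) -fM ?ldivK //; apply: gU; dlo.
rewrite (key _ _ _ bb hy); split=> [->|] // e.
have gy : gset G' y by exact: (@hol_in gam a b _ _ _ bb hy).
by apply: (@gmul_injr _ _ G' _ _ y) => //; [apply: extension_in; apply: gG|apply: fG; apply: gU].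
Qed.

(* An extension of f is determined along every path by the holonomy. *)
Lemma extension_unique fb : (forall g, gset G g -> gset G' (fb g)) ->
  (forall g h, gset G g -> gset G h -> fb (g ** h) = fb g *' fb h) ->
  (forall u, U u -> fb u = f u) -> forall g, gset G g -> fb g = extension g.
Proof.
move=> fbG fbM fbU g gg; have [a [b [gam [n [pg ga gb hy]]]]] := extensionP gg.
have [ab _ gG _] := pg; have bb : ole b b by right.
suff key m t z : ole t b -> hol gam a m t z -> fb (gam t) = z by rewrite -{1}gb; apply: key hy.
elim: m t z => [|m IH] t z tb; first by move=> [-> ->]; rewrite ga fbU // f1.
move=> [t' [z' [h1 [h2 ->]]]]; have at' := hol_ge h1; have l := h2.1.
have t'b : ole t' b by dlo.
have U1 := fine_U h2.
have [g1 g2] : gset G (gam t') /\ gset G (gam t) by split; apply: gG; dlo.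
by rewrite -(IH _ _ t'b h1) -(fbU _ U1) -fbM ?ldivK; auto.
Qed.

(** Dimension zero is treated apart because definable choice uses a coordinate of the chart. Here
    the identity is isolated, so paths are constant and path connectedness leaves one point. *)
Lemma gset_trivial (psi : pt S 0 -> pt S N) z0 : chart G T psi z0 -> forall g, gset G g -> g = gone G.
Proof.
move=> ch g gg; have [O [TO Oe hO]] := chart_nbhd ch.
have O1 y : O y -> y = gone G by move=> /hO [z <-]; rewrite (pt0_eq z z0); exact: chart_one ch.
have [pc _] := sc; have [a [b [gam' [p1 p2 p3]]]] := pc _ _ (gone_in G) gg.
have pg := path_of_ldpath omin p1; have [ab dg hG hc] := pg.
set gam := fun t => gam' (pt1 t) in p2 p3 dg hG hc.
pose Q t := (ole a t /\ ole t b) /\ gam t = gone G.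
have dQ : dset Q by apply: (dset_compon omin (P := fun x => x = gone G) _ dg); exact: dset_point.
have aa : ole a a by right. have bb : ole b b by right. have ab' : ole a b by left.
have Qa : Q a by [].
suff [_ <-] : Q b by rewrite -p3.
apply: (@interval_ind _ omin a b Q dQ Qa) => // t h1 h2.
have [O' [TO' Ot hO']] := open_ldivxx tau TO Oe (hG _ h1 h2).
have [p [q [h3 h4 h5]]] := hc _ h1 h2 _ TO' Ot; exists p, q; split=> // u k1 k2 k3 k4.
have e : gam t = gam u by apply: (ldiv_eq1 (hG _ h1 h2) (hG _ k3 k4)); apply: O1; apply: hO' => //; apply: h5.
by rewrite /Q -e; tauto.
Qed.

Lemma extension_near_one : exists O, [/\ T O, O (gone G) & forall y, O y -> U y /\ extension y = f y].
Proof.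
have [n [psi [z0 [_ ch]]]] := chart_at_one omin tau.
have [|O [TO Oe hO]] := invariant_near_one omin tau ch (A := fun u => extension u = f u) nU agree_along_path.
  by rewrite extension1 f1.
have [O' [TO' [Oe' hO']]] := nU.
exists (fun y => O y /\ O' y); split=> //; first exact: (open_setI tau TO TO').
by move=> y [h1 h2]; split; [apply: hO'|apply: hO].
Qed.

(** For [y] near [x] the increment lies where [f] and the extension already agree, so both change by
    the same factor. Hence the agreement set and its complement are relatively open in [U]. *)
Lemma agree_locally_constant x : U x -> exists O, [/\ T O, O x &
  forall y, O y -> U y -> (extension y = f y <-> extension x = f x)].
Proof.
move=> Ux; have gx := UG Ux; have [O [TO Oe hO]] := extension_near_one.
have Ox : O (ldiv G x x) by rewrite ldivxx.
have [O1 [O2 [T1 T2 e1 e2 h12]]] := open_ldiv tau TO gx gx Ox.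
exists O2; split=> // y Oy Uy; have gy := UG Uy.
have [Uw ew] := hO _ (h12 _ _ e1 Oy).
have Ey : extension y = extension x *' f (ldiv G x y) by rewrite -ew -extensionM ?ldivK; auto.
have fy : f y = f x *' f (ldiv G x y) by rewrite -fM ?ldivK.
rewrite Ey fy; split=> [|->] //.
by apply: gmul_injr; [apply: extension_in|apply: fG|apply: fG].
Qed.

Lemma relopen_of_local (A : pt S N -> Prop) : (forall x, A x -> U x) ->
  (forall x, A x -> exists O, [/\ T O, O x & forall y, O y -> U y -> A y]) -> relopen T U A.
Proof.
move=> AU loc.
pose F (O : pt S N -> Prop) := T O /\ forall y, O y -> U y -> A y.
exists (fun x => exists O, F O /\ O x); split; first by apply: (open_bigcup tau) => O [].
move=> x; split=> [Ax|[[O [[_ h] Ox]] Ux]]; last exact: h.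
by split; [have [O [TO Ox h]] := loc x Ax; exists O|apply: AU].
Qed.

Hypothesis conU : def_connected T U.

Lemma extension_agrees u : U u -> extension u = f u.
Proof.
have [n [psi [z0 [dimG ch]]]] := chart_at_one omin tau.
case: n psi z0 dimG ch => [|n] psi z0 dimG ch Uu.
  by rewrite (gset_trivial ch (UG Uu)) extension1 f1.
have dA : dset (fun x => U x /\ extension x = f x).
  exact: (path_invariant_definable omin uncK sat tau ch dimG UG agree_along_path).
have dB : dset (fun x => U x /\ ~ extension x = f x).
  apply: (@dset_iff _ _ _ (fun x => U x /\ ~ (U x /\ extension x = f x))) => [x|]; first by tauto.
  by apply: dset_and => //; apply: dset_not.
apply: NNPP => nu; apply: conU.
exists (fun x => U x /\ extension x = f x), (fun x => U x /\ ~ extension x = f x); split.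
- by split.
- split; apply: relopen_of_local => x [Ux ex] //; have [O [TO Ox hO]] := agree_locally_constant Ux;
    by exists O; split=> // y Oy Uy; rewrite hO.
- by split=> x [].
- by split; [exists (gone G); rewrite extension1 f1|exists u].
- by split=> [x [[_ h] [_ h']]|x Ux] //; case: (classic (extension x = f x)); [left|right].
Qed.

Hypothesis nV : nbhd T V (gone G).

(** Finitely many translates of [V] cover a definable set, and on the translate by [h j] the
    extension is a constant times [f] of the increment from [h j]. *)
Lemma extension_ldmap : ldmap (gset G) extension.
Proof.
have Ve : V (gone G) by have [O [_ [Oe h]]] := nV; apply: h.
move=> D dD DG; apply/(defmapP omin).
have dD' : dset D by [].
have did : dmapon D (fun x : pt S N => x) by apply: dmapon_dmap => //; exact: dmap_id.
have [k [h [hG [dh hh]]]] := generic_cover did DG.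
(* As [V] contains the identity, [v] is itself a quotient of elements of [V]. *)
have VU' v : V v -> U v by move=> Vv; rewrite -(ldiv1x (VG Vv)); apply: VU.
pose Dj j x := D x /\ V (ldiv G (h j) x).
have dm j : dmapon (Dj j) (fun x => extension (h j) *' f (ldiv G (h j) x)).
  have dl : dmapon (Dj j) (fun x => ldiv G (h j) x).
    apply: (ldiv_dmapon omin uncK sat) => [| | |x [/DG]] //.
      by apply: dmapon_dmap; [|exact: dh|ddm].
    by apply: dmapon_dmap; [|exact: dh|ddm].
  apply: (gmul_dmapon omin uncK sat).
  - by apply: dmapon_dmap; [|exact: dh|ddm].
  - by apply: (dmapon_comp omin df dl) => x [_ /VU'].
  - by move=> x _; apply: extension_in.
  - by move=> x [_ /VU'/fG].
have E j x : Dj j x -> extension x = extension (h j) *' f (ldiv G (h j) x).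
  move=> [/DG gx /VU' Ux]; rewrite -(extension_agrees Ux) -extensionM ?ldivK; auto.
apply: (@dset_iff _ _ _ (fun p => exists j, Dj j p.1 /\ p.2 = extension (h j) *' f (ldiv G (h j) p.1))).
  move=> [x y] /=; split=> [[j [Dx ->]]|[Dx ->]]; first by rewrite -(E j) //; case: Dx.
  by have [j Vj] := hh x Dx; exists j; rewrite -E.
by apply: (dset_exists_ord omin) => j; exact: (dm j).
Qed.
End Holonomy.

Theorem mainTheorem1 (S : ostruct) (K : Type) (N N' : nat)
    (G : ldgroup S N) (G' : ldgroup S N') (T : (pt S N -> Prop) -> Prop)
    (U V : pt S N -> Prop) (f : pt S N -> pt S N') :
  ominimal S -> uncountable K -> saturated S K ->
  is_tau_topology G T ->
  Def S U -> (forall x, U x -> gset G x) -> nbhd T U (gone G) -> def_connected T U ->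
  defmap U f -> local_hom G G' U f ->
  Def S V -> (forall x, V x -> gset G x) -> nbhd T V (gone G) -> generic K G V ->
  (forall x y, V x -> V y -> U (gmul G (ginv G x) y)) ->
  simply_connected G T ->
  exists fb : pt S N -> pt S N',
    ld_hom_extending G G' U f fb /\
    forall fb' : pt S N -> pt S N', ld_hom_extending G G' U f fb' ->
      forall g, gset G g -> fb' g = fb g.
Proof.
move=> omin uncK sat tau dU UG nU conU df [fG fM] dV VG nV [genV _] VU sc.
have Ue : U (gone G) by have [O [_ [Oe h]]] := nU; apply: h.
have df' : dmapon U f by apply/(defmapP omin).
exists (extension G G' T U f); split; first split.
- by move=> g; apply: (extension_in omin Ue fG fM tau nU uncK sat dV VG genV VU sc).
- exact: (extension_ldmap omin UG Ue fG fM tau nU uncK sat dV VG genV VU dU df' sc conU nV).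
- by move=> g h; apply: (extensionM omin UG Ue fG fM tau nU uncK sat dV VG genV VU dU df' sc).
- by move=> u; apply: (extension_agrees omin UG Ue fG fM tau nU uncK sat dV VG genV VU dU df' sc conU).
move=> fb' [h1 _ h3 h4] g.
exact: (extension_unique omin UG Ue fG fM tau nU uncK sat dV VG genV VU sc h1 h3 h4).
Qed.
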